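(* Let $n\ge1$ and $0\le r\le\binom{n+1}{2}$, and let $L$ be a generic $k$-Lie-algebra of type $(n,r)$. (1) If $r\le n^2/4$ or $r\ge (n^2-1)/3$, then $L$ has Hilbert series $$L(z)=\left[\mathrm{Log}\!\left(\frac{1}{1-nz+rz^2}\right)\right].$$ (2) $L_3=0$ if and only if $r\ge (n^2-1)/3$.
   Context: $k$ is a field with prime field $k_0$; it is a standing assumption that $k$ has sufficiently high transcendence degree over $k_0$ (at least the number of indeterminates $c$ below). Lie superalgebras here are graded, with parity given by the degree mod 2, and are equipped with squares of odd elements. For a field $K$, $\mathcal L_K(x_1,\ldots,x_n)$ denotes the free Lie $K$-superalgebra (with squares of odd elements) on odd generators $x_1,\ldots,x_n$ of degree 1; it can be realized as the smallest graded subspace of $K\langle x_1,\ldots,x_n\rangle$ containing the $x_i$ and closed under the supercommutator ($[a,b]=ab+ba$ if $a,b$ are both of odd degree, $[a,b]=ab-ba$ for homogeneous $a,b$ otherwise) and under squaring of homogeneous elements of odd degree. Ideals are closed under brackets with arbitrary elements and under squares of their odd elements. A $k$-Lie-algebra of type $(n,r)$ is a quotient of $\mathcal L_k(x_1,\ldots,x_n)$ by the Lie ideal generated by $r$ linearly independent elements $f_i=\sum_{1\le j\le n}c_{i,j}x_j^2+\sum_{1\le j<l\le n}c_{i,j,l}[x_j,x_l]$ with $c_{i,j},c_{i,j,l}\in k$. Its Hilbert series is $L(z)=\sum_{i\ge1}\dim(L_i)z^i$. Let $c=\{c_{i,j}\}\cup\{c_{i,j,l}\}$ ($1\le i\le r$,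 $1\le j\le n$, respectively $1\le j<l\le n$) be indeterminates, $f_{i,c}=\sum_j c_{i,j}x_j^2+\sum_{j<l}c_{i,j,l}[x_j,x_l]$, and $L_t=\mathcal L_{k_0(c)}(x_1,\ldots,x_n)/(f_{1,c},\ldots,f_{r,c})$. A $k$-Lie-algebra $L$ of type $(n,r)$ is generic if $L(z)=L_t(z)$. For a power series $V(z)$ with constant term 1, $$\mathrm{Log}(V)(z)=\sum_{q=1}^\infty\frac{\mu(q)}{q}\log\bigl(V((-1)^{q+1}z^q)\bigr),$$ where $\mu$ is the Möbius function and $\log$ the natural logarithm. It is the inverse of the operator $\mathrm{Exp}\bigl(\sum_{i\ge1}e_iz^i\bigr)=\prod_{i\ge1}\frac{(1+z^{2i-1})^{e_{2i-1}}}{(1-z^{2i})^{e_{2i}}}$. For a power series $\sum_{i\ge1}a_iz^i$ without constant term, $\left[\sum_{i\ge1} a_iz^i\right]=\sum_{i\ge1} b_iz^i$, where $b_i=a_i$ if $a_j>0$ for all $1\le j\le i$ and $b_i=0$ otherwise. *)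

(* Defs.v *)
From HB Require Import structures.
From mathcomp Require Import all_boot all_order all_algebra.
From mathcomp Require Import monalg mpoly.

Set Implicit Arguments.
Unset Strict Implicit.
Unset Printing Implicit Defensive.

Import Order.TTheory GRing.Theory Num.Theory.
Local Open Scope ring_scope.

(* K<x_0, ..., x_(n-1)>, as the algebra of the free monoid on 'I_n. *)
Notation ncpoly K n := {malg K[{fmonom 'I_n}]}.

Definition ncvar (K : fieldType) (n : nat) (j : 'I_n) : ncpoly K n :=
  mkmalgU (fmu j) 1.

(* The supercommutator of an element [u] of degree [d] and an element [v] of
   degree [e]; the degrees are passed explicitly, as they determine the
   parities. *)
Definition sbracket (K : fieldType) (n d e : nat) (u v : ncpoly K n) :
    ncpoly K n :=
  if odd d && odd e then u * v + v * u else u * v - v * u.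

(* [free_lie d u]: [u] lies in the degree [d] component of the smallest graded
   subspace of K<x_0, ..., x_(n-1)> which contains the variables (in degree 1)
   and is closed under supercommutators and squares of odd elements. *)
Inductive free_lie (K : fieldType) (n : nat) : nat -> ncpoly K n -> Prop :=
| FreeLieVar j : free_lie 1 (ncvar K j)
| FreeLie0 d : free_lie d 0
| FreeLieD d u v : free_lie d u -> free_lie d v -> free_lie d (u + v)
| FreeLieZ d (a : K) u : free_lie d u -> free_lie d (a *: u)
| FreeLieBracket d e u v :
    free_lie d u -> free_lie e v -> free_lie (d + e) (sbracket d e u v)
| FreeLieSq d u : odd d -> free_lie d u -> free_lie (d + d) (u * u).

(* [lie_ideal f d u]: [u] lies in the degree [d] component of the Lie ideal of
   the free Lie superalgebra generated by the quadratic elements [f i]. By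
   antisymmetry it is enough to bracket on one side, and since the generators
   are homogeneous it is enough to square homogeneous elements. *)
Inductive lie_ideal (K : fieldType) (n r : nat) (f : 'I_r -> ncpoly K n) :
    nat -> ncpoly K n -> Prop :=
| LieIdealGen i : lie_ideal f 2 (f i)
| LieIdeal0 d : lie_ideal f d 0
| LieIdealD d u v :
    lie_ideal f d u -> lie_ideal f d v -> lie_ideal f d (u + v)
| LieIdealZ d (a : K) u : lie_ideal f d u -> lie_ideal f d (a *: u)
| LieIdealBracket d e u v :
    lie_ideal f d u -> free_lie e v -> lie_ideal f (d + e) (sbracket d e u v)
| LieIdealSq d u : odd d -> lie_ideal f d u -> lie_ideal f (d + d) (u * u).

(* [inl j] indexes the coefficient of x_j^2, and [inr (j, l)], with j < l, that
   of [x_j, x_l]. *)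
Definition coef_idx (n r : nat) : finType :=
  ('I_r * ('I_n + {p : 'I_n * 'I_n | (p.1 < p.2)%N}))%type.

Definition relator (K : fieldType) (n r : nat) (c : coef_idx n r -> K)
    (i : 'I_r) : ncpoly K n :=
  \sum_(j < n) c (i, inl j) *: ncvar K j ^+ 2
  + \sum_(p : {p : 'I_n * 'I_n | (p.1 < p.2)%N})
      c (i, inr p) *: sbracket 1 1 (ncvar K (val p).1) (ncvar K (val p).2).

Definition lin_indep (K : fieldType) (V : lmodType K) (r : nat)
    (f : 'I_r -> V) : Prop :=
  forall a : 'I_r -> K, \sum_(i < r) a i *: f i = 0 -> forall i, a i = 0.

(* The quotient U / W of two subspaces W <= U of V has dimension m: there is a
   family of m elements of U whose classes form a basis of U / W. *)
Definition quot_dim (K : fieldType) (V : lmodType K) (U W : V -> Prop)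
    (m : nat) : Prop :=
  exists b : 'I_m -> V,
  [/\ forall i, U (b i),
      forall u, U u -> exists a : 'I_m -> K, W (u - \sum_(i < m) a i *: b i)
    & forall a : 'I_m -> K, W (\sum_(i < m) a i *: b i) -> forall i, a i = 0].

(* Formal power series over rat are represented by their coefficients. *)
Definition series := nat -> rat.

(* S is the Hilbert series of the quotient by the relators with coefficients c. *)
Definition has_hilbert_series (K : fieldType) (n r : nat)
    (c : coef_idx n r -> K) (S : series) : Prop :=
  S 0%N = 0 /\
  forall d, (0 < d)%N -> exists2 m : nat,
    quot_dim (@free_lie K n d) (lie_ideal (relator c) d) m & S d = m%:R.

(* The degree d component of the quotient vanishes. *)
Definition component_eq0 (K : fieldType) (n r : nat) (c : coef_idx n r -> K)
    (d : nat) : Prop :=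
  forall u, free_lie d u -> lie_ideal (relator c) d u.

(* A prime field is a field without proper subfields. *)
Definition prime_field (F : fieldType) : Prop :=
  forall S : F -> Prop, S 1 ->
    (forall x y, S x -> S y -> S (x - y)) ->
    (forall x y, S x -> S y -> S (x / y)) ->
    forall x, S x.

(* The notation {mpoly F[m]} is bound to monalg's polynomials here, so mpoly.v's
   type is written [mpoly m F]. *)
Definition alg_indep (F K : fieldType) (iota : {rmorphism F -> K}) (m : nat)
    (a : 'I_m -> K) : Prop :=
  forall P : mpoly m F, (map_mpoly iota P).@[a] = 0 -> P = 0.

Definition trdeg_ge (F K : fieldType) (iota : {rmorphism F -> K}) (m : nat) :
    Prop :=
  exists a : 'I_m -> K, alg_indep iota a.

(* The indeterminates c in the field of rational functions F(c). *)
Definition generic_coef (F : fieldType) (n r : nat) (t : coef_idx n r) :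
    {fraction mpoly #|coef_idx n r| F} :=
  FracField.tofrac (mpolyX F (mnm1 (enum_rank t))).

Definition generic (k0 k : fieldType) (n r : nat) (c : coef_idx n r -> k) :
    Prop :=
  exists S : series,
    has_hilbert_series c S /\ has_hilbert_series (@generic_coef k0 n r) S.

(* The composite a(U(z)), for U 0 = 0: the coefficient of z^d only depends on
   the terms of degree at most d of a and U. *)
Definition series_comp (a U : series) : series := fun d =>
  ((\poly_(i < d.+1) a i) \Po (\poly_(i < d.+1) U i))`_d.

Definition sub_one (V : series) : series := fun d => V d - (d == 0%N)%:R.

(* 1 / V and log V, for V 0 = 1: substitute V - 1 in the expansions of
   1 / (1 + z) and log (1 + z). For m = 0 the logarithmic coefficient is 0, as
   0^-1 = 0. *)
Definition series_inv (V : series) : series :=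
  series_comp (fun m => (-1) ^+ m) (sub_one V).

Definition series_log (V : series) : series :=
  series_comp (fun m => (-1) ^+ m.+1 / m%:R) (sub_one V).

(* V((-1)^(q+1) z^q), for q > 0 *)
Definition series_adams (q : nat) (V : series) : series := fun d =>
  if (q %| d)%N then ((-1) ^+ q.+1) ^+ (d %/ q) * V (d %/ q)%N else 0.

Definition moebius (q : nat) : rat :=
  if all (fun p => logn p q == 1%N) (primes q)
  then (-1) ^+ size (primes q) else 0.

(* The summands with q > d do not contribute to the coefficient of z^d when
   d > 0, and no summand has a constant term. *)
Definition series_Log (V : series) : series := fun d =>
  \sum_(1 <= q < d.+1) moebius q / q%:R * series_log (series_adams q V) d.

Definition truncate_pos (S : series) : series := fun d =>
  if (0 < d)%N && all (fun j => 0 < S j) (iota 1 d) then S d else 0.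

(* 1 - n z + r z^2 *)
Definition quadratic_series (n r : nat) : series := fun d =>
  (1 - n%:R *: 'X + r%:R *: 'X^2 : {poly rat})`_d.

(* Main.v *)
(** Semicontinuity. A minor of a matrix over k0[c] which does not vanish at a
    specialization of c does not vanish, so the dimensions of the components of
    L_t are bounded above by those of the quotient by any relators over k0.

    The case r <= n^2 / 4. Split the variables into x's and y's, of numbers p
    and q with p q = floor (n^2 / 4), and take r of the brackets [x_a, y_b] as
    relators. Lazard elimination of the y's, followed by repeated elimination
    of single elements, gives spanning families of the quotient whose numbers
    e_d of elements satisfy Exp(sum e_d z^d) = 1 / (1 - n z + r z^2). For the
    other inequality, let a_d be the dimensions of the components of the
    associative algebra A on n generators with the same relators as L_t. As in
    the theorem of Golod and Shafarevich, a_(d+2) >= n a_(d+1) - r a_d, and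
    since n^2 >= 4 r this forces a_d to be at least the coefficient of
    1 / (1 - n z + r z^2); ordered monomials span A, so a_d is at most the
    coefficient of Exp(L_t(z)).

    The case r >= (n^2 - 1) / 3. By the Jacobi identities, a linear form on the
    brackets [x_d, w] which vanishes on the ideal amounts to a linear syzygy of
    the quadrics orthogonal to the relators. Sets of quadrics without linear
    syzygies (Hochster and Laksov) are built over k0(t) by passing from n to
    n + 3 variables, so the degree 3 component of L_t vanishes. Conversely, if
    L_3 = 0, the two bounds on a_3 give n^3 - n <= 3 n r. *)
Require Import Defs.
From HB Require Import structures.
From mathcomp Require Import all_boot all_order all_algebra finmap.
From mathcomp Require Import monalg mpoly.
From mathcomp Require Import ring lra zify.
From Stdlib Require Import Classical.
Import monalg.
Import Order.TTheory GRing.Theory Num.Theory.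
Set Implicit Arguments.
Unset Strict Implicit.
Unset Printing Implicit Defensive.
Local Open Scope ring_scope.
Local Notation "g @_ k" := (mcoeff k g) : ring_scope.

(** * Quotients of subspaces *)

(** In the first case both bounds come from spanning families, and they close up degree by degree.
    If the dimensions agree with e_1, ..., e_D, then Exp(L_t(z)) and 1 / (1 - n z + r z^2) differ
    modulo z^(D + 2) by x z^(D + 1), where x is the difference of the two numbers in degree D + 1.
    Semicontinuity gives x <= 0, the bound on a_(D + 1) gives x >= 0. The bipartite relators have
    coefficients 0 and 1, so they are defined over k0. In the second case the constants come from
    counting. The degree 3 component of the free superalgebra has dimension (n^3 - n) / 3, and there
    are n r brackets [x_d, f_i]; dually, m quadrics without linear syzygy satisfy n m <= C(n + 2,
    3). The generators being odd, the Jacobi identities carry no signs, which is why commutative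
    cubics appear. The inductive construction spends one parameter per step; the parameters must be
    distinct and avoid 0, 1, -1, 2, while k0 may be finite, so powers of a transcendental t are
    used. The given algebra is compared with L_t only through the equality of Hilbert series. *)

Lemma sum_enum_val (V : nmodType) (I : finType) (F : I -> V) :
  \sum_i F i = \sum_(i < #|I|) F (enum_val i).
Proof. by rewrite (reindex (@enum_val I I)) //; apply/onW_bij/enum_val_bij. Qed.

Section SubspaceDimension.
Variables (K : fieldType) (V : lmodType K).
Implicit Types U W : V -> Prop.

Definition subspace W : Prop :=
  [/\ W 0, forall u v, W u -> W v -> W (u + v)
    & forall (a : K) u, W u -> W (a *: u)].

Lemma zero_subspace : subspace (fun u => u = 0).
Proof. by split=> [//|u v -> ->|a u ->]; rewrite ?addr0 ?scaler0. Qed.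

Definition indep_mod W m (b : 'I_m -> V) : Prop :=
  forall a : 'I_m -> K, W (\sum_(i < m) a i *: b i) -> forall i, a i = 0.

Definition spans_mod U W m (b : 'I_m -> V) : Prop :=
  forall u, U u -> exists a : 'I_m -> K, W (u - \sum_(i < m) a i *: b i).

Definition spanned U W m : Prop := exists b : 'I_m -> V, spans_mod U W b.

Lemma subspace_sum W (I : Type) (s : seq I) (P : pred I) (F : I -> V) :
  subspace W -> (forall i, P i -> W (F i)) -> W (\sum_(i <- s | P i) F i).
Proof. by case=> W0 WD _ WF; apply: (big_ind W) => //; apply: WD. Qed.

Lemma subspaceN W u : subspace W -> W u -> W (- u).
Proof. by case=> _ _ WZ Wu; rewrite -scaleN1r; apply: WZ. Qed.

Lemma subspaceB W u v : subspace W -> W u -> W v -> W (u - v).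
Proof. by move=> sW Wu Wv; have [_ WD _] := sW; apply: WD => //; apply: subspaceN. Qed.

(** A coefficient matrix with more rows than columns has a nonzero vector in its left kernel, and
    this would be a dependency of the [v i] modulo [W]. *)
Lemma indep_mod_le W m N (v : 'I_m -> V) (w : 'I_N -> V) : subspace W ->
  indep_mod W v -> (forall i, exists a : 'I_N -> K, W (v i - \sum_j a j *: w j)) ->
  (m <= N)%N.
Proof.
move=> sW vI vw; have [W0 WD WZ] := sW.
have [a aP] := fin_all_exists vw.
pose A := \matrix_(i < m, j < N) a i j.
rewrite leqNgt; apply/negP => Nm.
have : kermx A != 0.
  by rewrite kermx_eq0 -row_leq_rank -ltnNge (leq_ltn_trans (rank_leq_col A)).
case/eqP; apply/row_matrixP => k; rewrite row0; apply/rowP => i; rewrite !mxE.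
pose x := row k (kermx A).
have xA : x *m A = 0 by rewrite -row_mul mulmx_ker row0.
suff: W (\sum_i x 0 i *: v i) by move/vI/(_ i); rewrite !mxE.
have -> : \sum_i x 0 i *: v i = \sum_i x 0 i *: (v i - \sum_j a i j *: w j).
  under [RHS]eq_bigr do rewrite scalerBr.
  rewrite sumrB -[LHS]subr0; congr (_ - _); apply/esym.
  under eq_bigr do rewrite scaler_sumr.
  rewrite exchange_big big1 // => j _.
  have := congr1 (fun M : 'rV_N => M 0 j) xA; rewrite !mxE => xAj.
  rewrite -[RHS](scale0r (w j)) -xAj scaler_suml.
  by apply: eq_bigr => l _; rewrite scalerA !mxE.
by apply: subspace_sum => // l _; apply/WZ/aP.
Qed.

Definition cons_fam m (u : V) (b : 'I_m -> V) (i : 'I_m.+1) : V :=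
  if unlift ord0 i is Some j then b j else u.

Lemma sum_cons_fam m (u : V) (b : 'I_m -> V) (a : 'I_m.+1 -> K) :
  \sum_i a i *: cons_fam u b i = a ord0 *: u + \sum_i a (lift ord0 i) *: b i.
Proof.
rewrite big_ord_recl {1}/cons_fam unlift_none; congr (_ + _).
by apply: eq_bigr => i _; rewrite /cons_fam liftK.
Qed.

Lemma max_indep_spans U W m (b : 'I_m -> V) : subspace W ->
  (forall i, U (b i)) -> indep_mod W b ->
  (forall c : 'I_m.+1 -> V, (forall i, U (c i)) -> ~ indep_mod W c) ->
  spans_mod U W b.
Proof.
move=> sW Ub bI bmax u Uu; have [W0 WD WZ] := sW.
have Uub i : U (cons_fam u b i) by rewrite /cons_fam; case: unliftP.
have nI : ~ indep_mod W (cons_fam u b) by apply: bmax.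
have [a na] := not_all_ex_not _ _ nI; have [] := imply_to_and _ _ na.
rewrite sum_cons_fam => Wa naI; have [i ai] := not_all_ex_not _ _ naI.
have a0 : a ord0 != 0.
  apply/eqP => a0; case: ai; move: Wa; rewrite a0 scale0r add0r => /bI aI.
  by case: (unliftP ord0 i) => [j ->|->].
exists (fun i => - ((a ord0)^-1 * a (lift ord0 i))).
have := WZ (a ord0)^-1 _ Wa; rewrite scalerDr scalerA mulVf // scale1r scaler_sumr.
rewrite -sumrN; congr (W (_ + _)); apply: eq_bigr => j _.
by rewrite scaleNr opprK scalerA.
Qed.

Lemma spans_mod_of_indep U W m (b : 'I_m -> V) : subspace W ->
  (forall i, U (b i)) -> indep_mod W b -> spanned U W m -> spans_mod U W b.
Proof.
move=> sW Ub bI [w wS]; apply: max_indep_spans => // c Uc cI.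
by have := indep_mod_le sW cI (fun i => wS _ (Uc i)); rewrite ltnn.
Qed.

(** [U] and [W] are bare predicates, so a maximal independent family is found by classical
    reasoning; [N] bounds its size. *)
Lemma quot_dim_exists U W N : subspace W -> spanned U W N ->
  exists2 m, (m <= N)%N & quot_dim U W m.
Proof.
move=> sW [w wS].
pose P m := exists2 b : 'I_m -> V, forall i, U (b i) & indep_mod W b.
have Ple m : P m -> (m <= N)%N.
  by case=> b Ub bI; apply: (indep_mod_le sW bI) => i; apply: wS.
have [m Pm mmax] : exists2 m, P m & ~ P m.+1.
  apply: NNPP => none; have Pall m : P m.
    elim: m => [|m IHm]; first by exists (fun _ => 0) => [[]|a _ []].
    by apply: NNPP => nP; apply: none; exists m.
  by have := Ple N.+1 (Pall _); rewrite ltnn.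
exists m; first exact: Ple.
case: Pm => b Ub bI; exists b; split=> //.
by apply: max_indep_spans => // c Uc cI; apply: mmax; exists c.
Qed.

Lemma quot_dim_le U W m N : subspace W -> quot_dim U W m -> spanned U W N -> (m <= N)%N.
Proof.
move=> sW [b [Ub _ bI]] [w wS].
by apply: (indep_mod_le sW bI) => i; apply: wS.
Qed.

Lemma quot_dim_spanned U W m : quot_dim U W m -> spanned U W m.
Proof. by case=> b [Ub bS _]; exists b. Qed.

Lemma quot_dim_unique U W m m' : subspace W -> quot_dim U W m -> quot_dim U W m' -> m = m'.
Proof.
by move=> sW Um Um'; apply/eqP; rewrite eqn_leq; apply/andP; split;
  [apply: (quot_dim_le sW Um) | apply: (quot_dim_le sW Um')]; exact: quot_dim_spanned.
Qed.

Lemma spanned_le U W m N : (m <= N)%N -> spanned U W m -> spanned U W N.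
Proof.
move=> mN [b bS].
exists (fun i => if insub (i : nat) is Some j then b j else 0) => u /bS[a Wa].
exists (fun i => if insub (i : nat) is Some j then a j else 0).
congr (W (_ - _)): Wa; rewrite -(subnKC mN) big_split_ord /= [X in _ + X]big1 ?addr0.
  by apply: eq_bigr => i _; rewrite insubT //= => lt; congr (a _ *: b _); apply: val_inj.
by move=> i _; rewrite insubF ?scale0r //= ltnNge leq_addr.
Qed.

Lemma spannedP U W (I : finType) (b : I -> V) :
  (forall u, U u -> exists a : I -> K, W (u - \sum_i a i *: b i)) -> spanned U W #|I|.
Proof.
move=> bS; exists (fun i => b (enum_val i)) => u /bS[a Wa].
by exists (fun i => a (enum_val i)); rewrite -(sum_enum_val (fun i => a i *: b i)).
Qed.

Lemma indep_enum_val W (I : finType) (b : I -> V) :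
  (forall a : I -> K, W (\sum_i a i *: b i) -> forall i, a i = 0) ->
  indep_mod W (fun i : 'I_#|I| => b (enum_val i)).
Proof.
move=> bI a Wa i; rewrite -(enum_valK i); apply: (bI (fun i => a (enum_rank i))).
by rewrite sum_enum_val; under eq_bigr do rewrite enum_valK.
Qed.

Lemma indep_mod_fin_le W (I J : finType) (v : I -> V) (w : J -> V) : subspace W ->
  (forall a : I -> K, W (\sum_i a i *: v i) -> forall i, a i = 0) ->
  (forall i, exists a : J -> K, W (v i - \sum_j a j *: w j)) -> (#|I| <= #|J|)%N.
Proof.
move=> sW vI vw; apply: (indep_mod_le (w := fun j => w (enum_val j)) sW (indep_enum_val vI)).
move=> i; have [a Wa] := vw (enum_val i); exists (fun j => a (enum_val j)).
by rewrite -(sum_enum_val (fun j => a j *: w j)).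
Qed.

Lemma spans_of_indep_fin U W (I : finType) (b : I -> V) : subspace W ->
  (forall i, U (b i)) ->
  (forall a : I -> K, W (\sum_i a i *: b i) -> forall i, a i = 0) ->
  spanned U W #|I| ->
  forall u, U u -> exists a : I -> K, W (u - \sum_i a i *: b i).
Proof.
move=> sW Ub bI US u Uu.
have [a Wa] := spans_mod_of_indep sW (fun i : 'I_#|I| => Ub (enum_val i)) (indep_enum_val bI) US Uu.
exists (fun i => a (enum_rank i)); rewrite sum_enum_val.
by under eq_bigr do rewrite enum_valK.
Qed.

Definition combination (I : finType) (b : I -> V) u : Prop :=
  exists a : I -> K, u = \sum_i a i *: b i.

Lemma combination_subspace (I : finType) (b : I -> V) : subspace (combination b).
Proof.
split=> [|_ _ [a ->] [a' ->]|a _ [a' ->]].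
- by exists (fun _ => 0); rewrite big1 // => i _; rewrite scale0r.
- exists (fun i => a i + a' i).
  by rewrite -big_split; apply: eq_bigr => i _; rewrite scalerDl.
- exists (fun i => a * a' i).
  by rewrite scaler_sumr; apply: eq_bigr => i _; rewrite scalerA.
Qed.

Lemma combination_mem (I : finType) (b : I -> V) i : combination b (b i).
Proof.
exists (fun j => (j == i)%:R).
rewrite (bigD1 i) //= eqxx scale1r big1 ?addr0 // => j /negPf ->; exact: scale0r.
Qed.
End SubspaceDimension.

Lemma row_full_of_injective (K : fieldType) (E J : finType) (M : E -> J -> K) :
  (forall u : J -> K, (forall e, \sum_j u j * M e j = 0) -> forall j, u j = 0) ->
  row_full (\matrix_(i < #|E|, j < #|J|) M (enum_val i) (enum_val j)).
Proof.
move=> Minj; set A := \matrix_(_, _) _.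
rewrite /row_full -mxrank_tr -/(row_free _) -kermx_eq0; apply/eqP/row_matrixP => k.
rewrite row0; apply/rowP => j; rewrite !mxE.
pose w := row k (kermx A^T).
have wA : w *m A^T = 0 by rewrite -row_mul mulmx_ker row0.
have := Minj (fun j => w 0 (enum_rank j)) _ (enum_val j).
rewrite enum_valK !mxE; apply=> e.
have := congr1 (fun B : 'rV_#|E| => B 0 (enum_rank e)) wA; rewrite !mxE => e0.
rewrite -[RHS]e0 sum_enum_val.
by apply: eq_bigr => i _; rewrite !mxE enum_valK enum_rankK.
Qed.

(** * Supercommutators *)

Section MapMalg.
Variables (M : monomType) (R S : comRingType) (phi : {rmorphism R -> S}).
Implicit Types g : {malg R[M]}.

Definition map_malg g : {malg S[M]} := \sum_(k <- msupp g) << phi g@_k *g k >>.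

Lemma mcoeff_map_malg g k : (map_malg g)@_k = phi g@_k.
Proof.
rewrite [in RHS](monalgE g) !raddf_sum; apply: eq_bigr => l _ /=.
by rewrite !mcoeffU rmorphMn.
Qed.

Lemma map_malgD g1 g2 : map_malg (g1 + g2) = map_malg g1 + map_malg g2.
Proof. by apply/malgP=> k; rewrite mcoeffD !mcoeff_map_malg mcoeffD rmorphD. Qed.

Lemma map_malg0 : map_malg 0 = 0.
Proof. by apply/malgP=> k; rewrite mcoeff_map_malg !mcoeff0 rmorph0. Qed.

Lemma map_malgB g1 g2 : map_malg (g1 - g2) = map_malg g1 - map_malg g2.
Proof. by apply/malgP=> k; rewrite mcoeffB !mcoeff_map_malg mcoeffB rmorphB. Qed.

Lemma map_malgZ a g : map_malg (a *: g) = phi a *: map_malg g.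
Proof. by apply/malgP=> k; rewrite mcoeffZ !mcoeff_map_malg mcoeffZ rmorphM. Qed.

Lemma map_malgM g1 g2 : map_malg (g1 * g2) = map_malg g1 * map_malg g2.
Proof.
(* [phi] may kill coefficients, so the product on the right is expanded over the larger supports of
   [g1] and [g2]. *)
have sub g : (msupp (map_malg g) `<=` msupp g)%fset.
  apply/fsubsetP => k; rewrite -!mcoeff_neq0 mcoeff_map_malg.
  by apply: contra_neq => ->; rewrite rmorph0.
apply/malgP=> k; rewrite mcoeff_map_malg (mcoeffMlw k (sub g1) (sub g2)) mcoeffMl.
rewrite raddf_sum; apply: eq_bigr => k1 _; rewrite raddf_sum; apply: eq_bigr => k2 _.
by rewrite /= rmorphMn rmorphM !mcoeff_map_malg.
Qed.

Lemma map_malgU k a : map_malg << a *g k >> = << phi a *g k >>.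
Proof. by apply/malgP=> l; rewrite mcoeff_map_malg !mcoeffU rmorphMn. Qed.

Lemma map_malg_sum (I : Type) (s : seq I) (P : pred I) (F : I -> {malg R[M]}) :
  map_malg (\sum_(i <- s | P i) F i) = \sum_(i <- s | P i) map_malg (F i).
Proof. exact: (big_morph _ map_malgD map_malg0). Qed.
End MapMalg.

Section SuperCommutator.
Variable A : nzRingType.
Implicit Types (b : bool) (x u v w : A).

(** The sign depends only on whether both parities are odd; keeping this single boolean turns the
    super identities into finite case checks in any ring. *)
Definition scomm b u v : A := if b then u * v + v * u else u * v - v * u.

Lemma scommDl b u u' v : scomm b (u + u') v = scomm b u v + scomm b u' v.
Proof. by case: b => /=; rewrite mulrDl mulrDr ?opprD addrACA. Qed.

Lemma scommDr b u v v' : scomm b u (v + v') = scomm b u v + scomm b u v'.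
Proof. by case: b => /=; rewrite mulrDl mulrDr ?opprD addrACA. Qed.

Lemma scommC b u v : scomm b u v = if b then scomm b v u else - scomm b v u.
Proof. by case: b => /=; rewrite ?opprB // addrC. Qed.

(** ad(x) is a superderivation: [i], [d], [e] are the parities of [x], [u], [v], and the conditional
    is the sign (-1)^(i d). *)
Lemma scomm_jacobi i d e x u v :
  scomm (i && (d (+) e)) x (scomm (d && e) u v) =
  scomm ((i (+) d) && e) (scomm (i && d) x u) v
  + (if i && d then - scomm (d && (i (+) e)) u (scomm (i && e) x v)
     else scomm (d && (i (+) e)) u (scomm (i && e) x v)).
Proof.
case: i; case: d; case: e => /=;
  rewrite !(mulrDl, mulrDr, mulrBl, mulrBr) ?(mulNr, mulrN) !mulrA !(opprD, opprB, opprK);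
  (* The eight monomials on the right are permuted so that four of them cancel in pairs and the
     others match the left-hand side. *)
  by rewrite [RHS](AC ((2*2)*(2*2)) (((1*7)*(6*4))*((2*5)*(3*8)))) /= ?subrr ?addNr !addr0.
Qed.

(** The Jacobi identity for [x, [u, u]] with u odd, divided by 2 so that it also holds in
    characteristic 2; [~~ i] is the parity of [x, u]. *)
Lemma scomm_sq i x u : scomm false x (u * u) = scomm (~~ i) (scomm i x u) u.
Proof.
case: i => /=; rewrite !(mulrDl, mulrDr, mulrBl, mulrBr) !mulrA.
  by rewrite opprD addrA addrK.
by rewrite addrA mulNr mulrN !mulrA subrK.
Qed.

Lemma mulr_sqD u v : (u + v) * (u + v) = u * u + scomm true u v + v * v.
Proof. by rewrite mulrDl !mulrDr /= !addrA. Qed.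
End SuperCommutator.

Section FreeLie.
Variables (K : fieldType) (n : nat).
Local Notation T := (ncpoly K n).
Implicit Types (u v w : T) (d e : nat).

Lemma ncscaleAr (a : K) u v : u * (a *: v) = a *: (u * v).
Proof.
apply/malgP => k; rewrite mcoeffZ [in RHS]mcoeffMl [RHS]mulr_sumr.
rewrite (@mcoeffMlw _ _ (msupp u) (msupp v)) ?fsubset_refl ?msuppZ_le //.
apply: eq_bigr => k1 _; rewrite [RHS]mulr_sumr; apply: eq_bigr => k2 _ /=.
by rewrite mcoeffZ mulrCA mulrnAr.
Qed.

Lemma ncscaleAl (a : K) u v : (a *: u) * v = a *: (u * v).
Proof. by rewrite scalerAl. Qed.

Lemma sbracketE d e u v : sbracket d e u v = scomm (odd d && odd e) u v.
Proof. by []. Qed.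

Lemma sbracketDl d e u u' v : sbracket d e (u + u') v = sbracket d e u v + sbracket d e u' v.
Proof. exact: scommDl. Qed.

Lemma sbracketDr d e u v v' : sbracket d e u (v + v') = sbracket d e u v + sbracket d e u v'.
Proof. exact: scommDr. Qed.

Lemma sbracketZl d e (a : K) u v : sbracket d e (a *: u) v = a *: sbracket d e u v.
Proof.
by rewrite /sbracket ncscaleAl ncscaleAr; case: ifP => _; rewrite ?scalerBr ?scalerDr.
Qed.

Lemma sbracketZr d e (a : K) u v : sbracket d e u (a *: v) = a *: sbracket d e u v.
Proof.
by rewrite /sbracket ncscaleAl ncscaleAr; case: ifP => _; rewrite ?scalerBr ?scalerDr.
Qed.

Lemma sbracket0l d e v : sbracket d e 0 v = 0.
Proof. by rewrite -(scale0r 0) sbracketZl !scale0r. Qed.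

Lemma sbracket0r d e u : sbracket d e u 0 = 0.
Proof. by rewrite -(scale0r 0) sbracketZr !scale0r. Qed.

Lemma sbracket_subspacel (X : T -> Prop) d e v : subspace X ->
  subspace (fun u => X (sbracket d e u v)).
Proof.
case=> X0 XD XZ; split=> [|u u' Xu Xu'|a u Xu]; rewrite ?sbracket0l ?sbracketDl ?sbracketZl //.
  exact: XD.
exact: XZ.
Qed.

Lemma sbracket_subspacer (X : T -> Prop) d e u : subspace X ->
  subspace (fun v => X (sbracket d e u v)).
Proof.
case=> X0 XD XZ; split=> [|v v' Xv Xv'|a v Xv]; rewrite ?sbracket0r ?sbracketDr ?sbracketZr //.
  exact: XD.
exact: XZ.
Qed.

Lemma sbracketC d e u v :
  sbracket d e u v = if odd d && odd e then sbracket e d v u else - sbracket e d v u.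
Proof. by rewrite [LHS]scommC /sbracket andbC. Qed.

Lemma sbracket_jacobi i d e x u v :
  sbracket i (d + e) x (sbracket d e u v) =
  sbracket (i + d) e (sbracket i d x u) v
  + (if odd i && odd d then - sbracket d (i + e) u (sbracket i e x v)
     else sbracket d (i + e) u (sbracket i e x v)).
Proof. by rewrite !sbracketE !oddD; apply: scomm_jacobi. Qed.

Lemma sbracket_sq i d x u : odd d ->
  sbracket i (d + d) x (u * u) = sbracket (i + d) d (sbracket i d x u) u.
Proof.
by move=> od; rewrite !sbracketE !oddD od addbb andbF !andbT addbT; apply: scomm_sq.
Qed.

Lemma free_lie_subspace d : subspace (@free_lie K n d).
Proof. by split; [apply: FreeLie0 | apply: FreeLieD | apply: FreeLieZ]. Qed.

Lemma lie_ideal_subspace r (f : 'I_r -> T) d : subspace (lie_ideal f d).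
Proof. by split; [apply: LieIdeal0 | apply: LieIdealD | apply: LieIdealZ]. Qed.

Lemma lie_ideal_sub_free r (f : 'I_r -> T) : (forall i, free_lie 2 (f i)) ->
  forall d u, lie_ideal f d u -> free_lie d u.
Proof.
move=> ff d u; elim=> {d u} [i|d|d u v _ IHu _|d a u _|d e u v _ IHu|d u od _].
- exact: ff.
- exact: FreeLie0.
- exact: FreeLieD.
- exact: FreeLieZ.
- exact: FreeLieBracket.
- exact: FreeLieSq.
Qed.

Lemma lie_ideal_bracketr r (f : 'I_r -> T) d e u v :
  lie_ideal f d u -> free_lie e v -> lie_ideal f (e + d) (sbracket e d v u).
Proof.
move=> Ju Fv; rewrite addnC sbracketC.
have Juv := LieIdealBracket Ju Fv.
by case: ifP => _ //; apply: subspaceN (lie_ideal_subspace _ _) Juv.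
Qed.

Lemma relator_free_lie r (c : coef_idx n r -> K) i : free_lie 2 (relator c i).
Proof.
have sF := free_lie_subspace 2; have [_ FD FZ] := sF.
apply: FD; apply: subspace_sum => // j _; apply: FZ.
  exact: (@FreeLieSq _ _ 1 _ isT (FreeLieVar _ j)).
exact: (@FreeLieBracket _ _ 1 1 _ _ (FreeLieVar _ _) (FreeLieVar _ _)).
Qed.

End FreeLie.

(** * Homogeneous elements *)

Section Homogeneous.
Variables (K : fieldType) (n : nat).
Local Notation T := (ncpoly K n).
Implicit Types (u v w : T) (d e : nat).

(** The recursion peels off the first letter: this matches the uniqueness in [ncvar_free] and the
    recursive description of the two-sided ideal used for the Golod-Shafarevich inequality. *)
Fixpoint homogeneous d u : Prop :=
  if d is e.+1 then
    exists2 v : 'I_n -> T, forall j, homogeneous e (v j) & u = \sum_j ncvar K j * v j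
  else exists a : K, u = a *: 1.

Lemma homogeneous_subspace d : subspace (homogeneous d).
Proof.
elim: d => [|d [IH0 IHD IHZ]] /=.
  split; first by exists 0; rewrite scale0r.
    by move=> _ _ [a ->] [b ->]; exists (a + b); rewrite scalerDl.
  by move=> a _ [b ->]; exists (a * b); rewrite scalerA.
split.
- by exists (fun _ => 0) => //; rewrite big1 // => j _; rewrite mulr0.
- move=> _ _ [u hu ->] [v hv ->]; exists (fun j => u j + v j) => [j|]; first exact: IHD.
  by rewrite -big_split; apply: eq_bigr => j _; rewrite mulrDr.
- move=> a _ [u hu ->]; exists (fun j => a *: u j) => [j|]; first exact: IHZ.
  by rewrite scaler_sumr; apply: eq_bigr => j _; rewrite ncscaleAr.
Qed.

Lemma homogeneous_mul d e u v : homogeneous d u -> homogeneous e v -> homogeneous (d + e) (u * v).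
Proof.
have [_ _ hZ] := homogeneous_subspace e.
elim: d u => [|d IHd] u /=; first by move=> [a ->] hv; rewrite ncscaleAl mul1r; apply: hZ.
move=> [w hw ->] hv; exists (fun j => w j * v) => [j|]; first exact: IHd.
by rewrite mulr_suml; apply: eq_bigr => j _; rewrite mulrA.
Qed.

Lemma homogeneous_var j : homogeneous 1 (ncvar K j).
Proof.
exists (fun k => (k == j)%:R *: 1) => [k|]; first by exists (k == j)%:R.
rewrite (bigD1 j) //= big1 ?addr0 => [|k /negPf ->]; last by rewrite scale0r mulr0.
by rewrite eqxx scale1r mulr1.
Qed.

Lemma homogeneous_var_mul d j u : homogeneous d u -> homogeneous d.+1 (ncvar K j * u).
Proof. exact: (@homogeneous_mul 1 _ _ _ (homogeneous_var j)). Qed.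

Lemma free_lie_homogeneous d u : free_lie d u -> homogeneous d u.
Proof.
elim=> {d u} [j|d|d u v _ hu _ hv|d a u _ hu|d e u v _ hu _ hv|d u _ _ hu].
- exact: homogeneous_var.
- by have [] := homogeneous_subspace d.
- by have [_ hD _] := homogeneous_subspace d; apply: hD.
- by have [_ _ hZ] := homogeneous_subspace d; apply: hZ.
- have sh := homogeneous_subspace (d + e); rewrite /sbracket; case: ifP => _.
    have [_ hD _] := sh; apply: hD; first exact: homogeneous_mul.
    by rewrite addnC; apply: homogeneous_mul.
  by apply: subspaceB => //; [|rewrite addnC]; apply: homogeneous_mul.
- exact: homogeneous_mul.
Qed.

Lemma homogeneous_spanned d : exists N, spanned (homogeneous d) (fun u => u = 0) N.
Proof.
elim: d => [|d [N [b bS]]].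
  exists 1, (fun _ => 1) => _ [a ->]; exists (fun _ => a).
  by rewrite big_ord1 subrr.
exists #|{: 'I_n * 'I_N}|.
apply: (@spannedP _ _ _ _ _ (fun p => ncvar K p.1 * b p.2)) => _ [v hv ->].
have [a aP] := fin_all_exists (fun j => bS _ (hv j)).
exists (fun p => a p.1 p.2); apply/eqP; rewrite subr_eq0; apply/eqP.
rewrite -(pair_big xpredT xpredT (fun j i => a j i *: (ncvar K j * b i))) /=.
apply: eq_bigr => j _; have /eqP := aP j; rewrite subr_eq0 => /eqP ->.
by rewrite mulr_sumr; apply: eq_bigr => i _; rewrite ncscaleAr.
Qed.

Lemma mcoeff_var_mul j k u (m : {fmonom 'I_n}) :
  (ncvar K k * u)@_(mmul (fmu j) m) = u@_m *+ (k == j).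
Proof.
rewrite /ncvar malgM_def fgmulUg raddf_sum /=.
have monoE l : (mmul (fmu k) l == mmul (fmu j) m) = (k == j) && (l == m).
  rewrite /mmul /= !fmmulE !fmuE.
  by rewrite -!val_eqE /= eqseq_cons.
under eq_bigr do rewrite mcoeffU mul1r monoE.
case: (k == j) => /=; last by rewrite big1 // => l _.
rewrite [in RHS](monalgE u) raddf_sum /=.
by apply: eq_bigr => l _; rewrite mcoeffU.
Qed.

(** The coefficient of a word starting with the letter j only involves [v j]. *)
Lemma ncvar_free (v : 'I_n -> T) : \sum_j ncvar K j * v j = 0 -> forall j, v j = 0.
Proof.
move=> v0 j; apply/malgP => m; have := congr1 (mcoeff (mmul (fmu j) m)) v0.
rewrite raddf_sum /= !mcoeff0 (bigD1 j) //= big1 ?addr0 => [|k /negPf kj].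
  by rewrite mcoeff_var_mul eqxx.
by rewrite mcoeff_var_mul kj.
Qed.
End Homogeneous.

(* A maximal minor of M which is nonzero after the specialization ev is nonzero. *)
Lemma specialize_injective (R : comNzRingType) (K1 K2 : fieldType)
    (ev : {rmorphism R -> K1}) (fr : {rmorphism R -> K2}) (E J : finType)
    (M : E -> J -> R) : injective fr ->
  (forall u : J -> K1, (forall e, \sum_j u j * ev (M e j) = 0) -> forall j, u j = 0) ->
  forall u : J -> K2, (forall e, \sum_j u j * fr (M e j) = 0) -> forall j, u j = 0.
Proof.
move=> fr_inj evM u frM.
pose A : 'M[R]_(#|E|, #|J|) := \matrix_(i, j) M (enum_val i) (enum_val j).
have A_full : row_full (map_mx ev A).
  by have := row_full_of_injective evM; congr (row_full _); apply/matrixP => i j; rewrite !mxE.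
pose f := fullrankfun A_full.
have detA : \det (rowsub f A) != 0.
  apply: contraTneq (fullrowsub_unit A_full) => det0.
  by rewrite unitmxE -map_mxsub det_map_mx det0 rmorph0 unitr0.
have frA : rowsub f (map_mx fr A) \in unitmx.
  rewrite unitmxE -map_mxsub det_map_mx unitfE.
  by rewrite -(rmorph0 fr) (inj_eq fr_inj).
pose c : 'cV[K2]_#|J| := \col_j u (enum_val j).
have Ac : rowsub f (map_mx fr A) *m c = 0.
  apply/colP => i; rewrite !mxE -[RHS](frM (enum_val (f i))).
  rewrite [RHS]sum_enum_val.
  by apply: eq_bigr => j _; rewrite !mxE mulrC.
have c0 : c = 0 by rewrite -(mulKmx frA c) Ac mulmx0.
by move=> j; have := congr1 (fun B : 'cV_#|J| => B (enum_rank j) 0) c0; rewrite !mxE enum_rankK.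
Qed.

(** * Specialization of the indeterminates *)

Lemma map_malg_scomm (M : monomType) (R S : comNzRingType) (phi : {rmorphism R -> S})
    (b : bool) (u v : {malg R[M]}) :
  map_malg phi (scomm b u v) = scomm b (map_malg phi u) (map_malg phi v).
Proof. by case: b; rewrite /scomm ?(map_malgB, map_malgD) !map_malgM. Qed.

Section ScalarExtension.
Variables (k K : fieldType) (n : nat) (iota : {rmorphism k -> K}).

Lemma map_malg_var j : map_malg iota (ncvar k j) = ncvar K j :> ncpoly K n.
Proof. by rewrite /ncvar map_malgU rmorph1. Qed.

Lemma free_lie_map d (u : ncpoly k n) : free_lie d u -> free_lie d (map_malg iota u).
Proof.
elim=> {d u} [j|d|d u v _ IHu _ IHv|d a u _ IHu|d e u v _ IHu _ IHv|d u od _ IHu].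
- by rewrite map_malg_var; apply: FreeLieVar.
- by rewrite map_malg0; apply: FreeLie0.
- by rewrite map_malgD; apply: FreeLieD.
- by rewrite map_malgZ; apply: FreeLieZ.
- by rewrite sbracketE map_malg_scomm -sbracketE; apply: FreeLieBracket.
- by rewrite map_malgM; apply: FreeLieSq.
Qed.

(** The K-span of the free Lie superalgebra over k, written with lists of scaled elements so that no
    basis has to be chosen. *)
Definition defined_over d (u : ncpoly K n) : Prop :=
  exists2 s : seq (K * ncpoly k n), (forall p, p \in s -> free_lie d p.2) &
    u = \sum_(p <- s) p.1 *: map_malg iota p.2.

Lemma defined_over1 d (v : ncpoly k n) : free_lie d v -> defined_over d (map_malg iota v).
Proof.
move=> Fv; exists [:: (1, v)] => [p|]; first by rewrite inE => /eqP ->.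
by rewrite big_seq1 scale1r.
Qed.

Lemma defined_over_subspace d : subspace (defined_over d).
Proof.
split.
- by exists [::] => //; rewrite big_nil.
- move=> _ _ [s Fs ->] [t Ft ->]; exists (s ++ t); last by rewrite big_cat.
  by move=> p; rewrite mem_cat => /orP[/Fs|/Ft].
- move=> a _ [s Fs ->]; exists [seq (a * p.1, p.2) | p <- s] => [p|].
    by case/mapP=> q /Fs Fq ->.
  by rewrite scaler_sumr big_map; apply: eq_bigr => p _; rewrite scalerA.
Qed.

Lemma defined_over_bracket d e u v :
  defined_over d u -> defined_over e v -> defined_over (d + e) (sbracket d e u v).
Proof.
have sS := defined_over_subspace (d + e); have [S0 SD SZ] := sS.
case=> s Fs -> [t Ft ->]; elim: s Fs => [|p s IHs] Fs; first by rewrite big_nil sbracket0l.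
rewrite big_cons sbracketDl; apply: (SD); last by apply: IHs => q qs; apply: Fs; rewrite inE qs orbT.
rewrite sbracketZl; apply: (SZ); have Fp := Fs p (mem_head _ _).
elim: t Ft {IHs} => [|q t IHt] Ft; first by rewrite big_nil sbracket0r.
rewrite big_cons sbracketDr; apply: (SD); last by apply: IHt => w wt; apply: Ft; rewrite inE wt orbT.
rewrite sbracketZr; apply: (SZ).
rewrite sbracketE -map_malg_scomm; apply: defined_over1.
by rewrite -sbracketE; apply: FreeLieBracket => //; apply/Ft/mem_head.
Qed.

(** The cross terms in the square of a sum of odd elements are supercommutators, so only squares of
    elements over k remain. *)
Lemma defined_over_sq d u : odd d -> defined_over d u -> defined_over (d + d) (u * u).
Proof.
move=> od; have [S0 SD SZ] := defined_over_subspace (d + d).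
case=> s Fs ->; elim: s Fs => [|p s IHs] Fs; first by rewrite big_nil mul0r.
have Fs' q : q \in s -> free_lie d q.2 by move=> qs; apply: Fs; rewrite inE qs orbT.
have Fp := Fs p (mem_head _ _).
rewrite big_cons mulr_sqD; apply: (SD); last exact: IHs.
apply: (SD); first rewrite ncscaleAl ncscaleAr.
  by apply/SZ/SZ; rewrite -map_malgM; apply/defined_over1/FreeLieSq.
have [_ _ SZ'] := defined_over_subspace d.
have := defined_over_bracket (SZ' p.1 _ (defined_over1 Fp)) (ex_intro2 _ _ s Fs' erefl).
by rewrite sbracketE od.
Qed.

Lemma free_lie_defined_over d u : free_lie d u -> defined_over d u.
Proof.
elim=> {d u} [j|d|d u v _ Su _ Sv|d a u _ Su|d e u v _ Su _ Sv|d u od _ Su].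
- by rewrite -map_malg_var; apply/defined_over1/FreeLieVar.
- by have [] := defined_over_subspace d.
- by have [_ SD _] := defined_over_subspace d; apply: SD.
- by have [_ _ SZ] := defined_over_subspace d; apply: (SZ).
- exact: defined_over_bracket.
- exact: defined_over_sq.
Qed.
End ScalarExtension.

Lemma free_lie_dim (K : fieldType) n d :
  exists m, quot_dim (@free_lie K n d) (fun u => u = 0) m.
Proof.
have [N hN] := homogeneous_spanned K n d.
have [|m _ mP] := @quot_dim_exists K _ (@free_lie K n d) _ N (zero_subspace _); last by exists m.
by have [b bS] := hN; exists b => u /free_lie_homogeneous; apply: bS.
Qed.

Lemma addr_eq_sub0 (V : zmodType) (x y a b : V) : y = a -> x = b -> x + y - (a + b) = 0.
Proof. by move=> -> ->; rewrite (addrC b) subrr. Qed.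

Lemma sum_addZ (F : fieldType) (V : lmodType F) (J : finType) (a b : J -> F) (e : F)
    (w : J -> V) :
  \sum_j (a j + e * b j) *: w j = \sum_j a j *: w j + e *: \sum_j b j *: w j.
Proof.
by rewrite scaler_sumr -big_split; apply: eq_bigr => j _; rewrite scalerDl scalerA.
Qed.

Section Specialization.
Variables (k0 : fieldType) (n r : nat) (s : coef_idx n r -> k0).
Local Notation R := (mpoly #|coef_idx n r| k0).
Local Notation K := {fraction mpoly #|coef_idx n r| k0}.

Let ev : {rmorphism R -> k0} := meval (fun i => s (enum_val i)).
Let fr : {rmorphism R -> K} := @FracField.tofrac R.
Let cst : {rmorphism k0 -> R} := @mpolyC #|coef_idx n r| k0.
Let iota : {rmorphism k0 -> K} := fr \o cst.

Lemma map_malg_ev_cst (v : ncpoly k0 n) : map_malg ev (map_malg cst v) = v.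
Proof. by apply/malgP => m; rewrite !mcoeff_map_malg; apply: mevalC. Qed.

Lemma map_malg_fr_cst (v : ncpoly k0 n) : map_malg fr (map_malg cst v) = map_malg iota v.
Proof.
apply/malgP => m; apply: (etrans (mcoeff_map_malg fr _ m)).
exact: (etrans (congr1 fr (mcoeff_map_malg cst v m)) (esym (mcoeff_map_malg iota v m))).
Qed.

(** The relators over k0[c], the common source of both sides: [ev] sends them to [relator s] and
    [fr] to the generic relators. *)
Definition poly_relator (i : 'I_r) : {malg R[{fmonom 'I_n}]} :=
  \sum_(j < n) mpolyX k0 (mnm1 (enum_rank ((i, inl j) : coef_idx n r)))
     *: (mkmalgU (fmu j) 1 ^+ 2)
  + \sum_(p : {p : 'I_n * 'I_n | (p.1 < p.2)%N})
      mpolyX k0 (mnm1 (enum_rank ((i, inr p) : coef_idx n r)))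
      *: scomm true (mkmalgU (fmu (val p).1) 1) (mkmalgU (fmu (val p).2) 1).

Lemma map_malg_poly_relator (L : fieldType) (phi : {rmorphism R -> L}) i :
  map_malg phi (poly_relator i) =
  relator (fun t => phi (mpolyX k0 (mnm1 (enum_rank t)))) i.
Proof.
rewrite /poly_relator /relator.
rewrite map_malgD.
rewrite !map_malg_sum.
apply: (congr2 +%R).
  apply: eq_bigr => j _; rewrite map_malgZ expr2 map_malgM map_malgU rmorph1.
  by rewrite expr2.
by apply: eq_bigr => p _; rewrite map_malgZ map_malg_scomm !map_malgU rmorph1.
Qed.

(** A derivation of membership in the specialized ideal is replayed with the relators over k0[c];
    scalars and elements of the free superalgebra are lifted as constants. *)
Lemma lie_ideal_lift d g : lie_ideal (@relator k0 n r s) d g ->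
  exists2 G : {malg R[{fmonom 'I_n}]}, map_malg ev G = g &
    lie_ideal (relator (@generic_coef k0 n r)) d (map_malg fr G).
Proof.
have evX t : ev (mpolyX k0 (mnm1 (enum_rank t))) = s t.
  by rewrite -[RHS](congr1 s (enum_rankK _)); apply: mevalXU.
have evC a : ev (cst a) = a by apply: mevalC.
elim=> {d g} [i|d|d _ _ _ [U <- JU] _ [V <- JV]|d a _ _ [U <- JU]|d e _ v _ [U <- JU] Fv|d _ od _ [U <- JU]].
- exists (poly_relator i).
    rewrite map_malg_poly_relator /relator.
    by apply: (congr2 +%R); apply: eq_bigr => j _; rewrite evX.
  by rewrite map_malg_poly_relator; apply: LieIdealGen.
- by exists 0; rewrite map_malg0 //; apply: LieIdeal0.
- by exists (U + V); rewrite map_malgD //; apply: LieIdealD.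
- exists (cst a *: U); rewrite map_malgZ; first by rewrite evC.
  exact: LieIdealZ.
- exists (scomm (odd d && odd e) U (map_malg cst v)); rewrite map_malg_scomm.
    by rewrite map_malg_ev_cst.
  by rewrite map_malg_fr_cst -sbracketE; apply: LieIdealBracket => //; apply: free_lie_map.
- by exists (U * U); rewrite map_malgM //; apply: LieIdealSq.
Qed.

Lemma fr_inj : injective fr.
Proof. by move=> x y /eqP; rewrite tofrac_eq => /eqP. Qed.

(** The finitely many words occurring in the specialized family give a coefficient matrix whose
    injectivity passes from [ev] to [fr]. *)
Lemma indep_lift (J : finType) (H : J -> {malg R[{fmonom 'I_n}]}) :
  (forall a : J -> k0, \sum_j a j *: map_malg ev (H j) = 0 -> forall j, a j = 0) ->
  forall a : J -> K, \sum_j a j *: map_malg fr (H j) = 0 -> forall j, a j = 0.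
Proof.
move=> evH a aH.
pose mons : seq {fmonom 'I_n} := flatten [seq enum_fset (msupp (map_malg ev (H j))) | j <- enum J].
pose M (e : seq_sub mons) (j : J) : R := (H j)@_(val e).
apply: (@specialize_injective R k0 K ev fr _ _ M fr_inj).
  move=> b bM; apply: evH; apply/malgP => m; rewrite raddf_sum mcoeff0 /=.
  under eq_bigr do rewrite mcoeffZ mcoeff_map_malg.
  case: (boolP (m \in mons)) => [m_in|m_out]; first exact: (bM (SeqSub m_in)).
  rewrite big1 // => j _; rewrite -mcoeff_map_malg mcoeff_outdom ?mulr0 //.
  apply: contra m_out => m_in; apply/flattenP.
  by exists (enum_fset (msupp (map_malg ev (H j)))) => //; apply/map_f/mem_enum.
move=> e; have := congr1 (mcoeff (val e)) aH; rewrite raddf_sum mcoeff0 /= => e0.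
by rewrite -[RHS]e0; apply: eq_bigr => j _; rewrite mcoeffZ mcoeff_map_malg.
Qed.

(** Take a basis [g] of the specialized ideal in degree [d] and a basis [b] of its complement. The
    lifts of [g] lie in the generic ideal and stay independent together with [b]; their number is
    the dimension of the free component, so they span it, and [b] alone spans the quotient. *)
Lemma generic_spanned d N :
  spanned (@free_lie k0 n d) (lie_ideal (relator s) d) N ->
  spanned (@free_lie K n d) (lie_ideal (relator (@generic_coef k0 n r)) d) N.
Proof.
move=> sN.
have sJ := lie_ideal_subspace (relator s) d.
have [m mN [b [Fb bS bI]]] := quot_dim_exists sJ sN.
apply: spanned_le mN _.
have JF := lie_ideal_sub_free (@relator_free_lie k0 n r s).
have [M [fb [_ fbS _]]] := free_lie_dim k0 n d.
have [|P _ [g [Jg gS gI]]] := @quot_dim_exists _ _ (lie_ideal (relator s) d) _ M (zero_subspace _).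
  by exists fb => u /JF; apply: fbS.
have [G GP] : exists G : 'I_P -> {malg R[{fmonom 'I_n}]}, forall i,
    map_malg ev (G i) = g i /\ lie_ideal (relator (@generic_coef k0 n r)) d (map_malg fr (G i)).
  apply: (@fin_all_exists _ _ (fun i G => map_malg ev G = g i /\ lie_ideal (relator (@generic_coef k0 n r)) d (map_malg fr G))) => i.
  by have [G GE JG] := lie_ideal_lift (Jg i); exists G.
pose H (x : 'I_P + 'I_m) := match x with inl i => G i | inr j => map_malg cst (b j) end.
have HI : forall a : 'I_P + 'I_m -> k0, \sum_j a j *: map_malg ev (H j) = 0 -> forall j, a j = 0.
  move=> a; rewrite big_sumType /=.
  under eq_bigr do rewrite (proj1 (GP _)).
  under [X in _ + X]eq_bigr do rewrite map_malg_ev_cst.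
  move=> aH.
  have a0 : forall j, a (inr j) = 0.
    apply: bI; rewrite -[X in _ X](addKr (\sum_i a (inl i) *: g i)) aH addr0.
    by apply: subspaceN (sJ) _; apply: subspace_sum => // i _; have [_ _ JZ] := sJ; apply: JZ.
  case=> // i; apply: (gI (fun i => a (inl i))); move: aH.
  by rewrite [X in _ + X]big1 ?addr0 // => j _; rewrite a0 scale0r.
have frI := indep_lift HI.
have FH x : free_lie d (map_malg fr (H x)).
  case: x => [i|j]; last by rewrite /H map_malg_fr_cst; apply: free_lie_map.
  exact: (lie_ideal_sub_free (@relator_free_lie K n r _) (proj2 (GP i))).
(* The free component over [K] has no larger dimension than over [k0]: the images of [g] and [b]
   span it. *)
have span0 : spanned (@free_lie K n d) (fun u => u = 0) #|{: 'I_P + 'I_m}|.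
  apply: (@spannedP _ _ _ _ _ (fun x => map_malg iota (match x with inl i => g i | inr j => b j end))).
  move=> u /(free_lie_defined_over iota)[t Ft ->].
  elim: t Ft => [|p t IHt] Ft.
    exists (fun _ => 0); rewrite big_nil sub0r; apply/eqP; rewrite oppr_eq0; apply/eqP.
    by rewrite big1 // => x _; rewrite scale0r.
  have [|a aP] := IHt; first by move=> q qt; apply: Ft; rewrite inE qt orbT.
  have Fp := Ft p (mem_head _ _).
  have [y yP] := bS _ Fp; have [z zP] := gS _ yP.
  exists (fun x => a x + p.1 * iota (match x with inl i => z i | inr j => y j end)).
  rewrite big_cons sum_addZ; apply: addr_eq_sub0 (subr0_eq aP) _.
  have -> : p.2 = \sum_i z i *: g i + \sum_j y j *: b j.
    by rewrite -(subr0_eq zP) subrK.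
  rewrite map_malgD !map_malg_sum [X in _ = _ *: X]big_sumType.
  apply: (congr1 ( *:%R _)); apply: (congr2 +%R); apply: eq_bigr => i _; exact: map_malgZ.
have frS := spans_of_indep_fin (zero_subspace _) FH frI span0.
exists (fun j => map_malg fr (H (inr j))) => u Fu; have [a /eqP] := frS u Fu.
rewrite subr_eq0 => /eqP ->; exists (fun j => a (inr j)).
rewrite big_sumType /= addrK; apply: subspace_sum => [|i _]; first exact: lie_ideal_subspace.
exact: (LieIdealZ _ (proj2 (GP i))).
Qed.
End Specialization.

(** * Elimination *)

Section Elimination.
Variables (K : fieldType) (n r : nat) (f : 'I_r -> ncpoly K n).
Hypothesis free_f : forall i, free_lie 2 (f i).
Local Notation T := (ncpoly K n).
Local Notation J := (lie_ideal f).
Implicit Types (u v w : T) (d e i : nat) (P : nat -> T -> Prop).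

(** For [P] inside the free superalgebra this is the preimage of the subalgebra of the quotient
    generated by [P]; [LieGenIdeal] makes every later identity one modulo the relators. *)
Inductive lie_gen P : nat -> T -> Prop :=
| LieGenIn d u : P d u -> lie_gen P d u
| LieGenIdeal d u : J d u -> lie_gen P d u
| LieGenD d u v : lie_gen P d u -> lie_gen P d v -> lie_gen P d (u + v)
| LieGenZ d (a : K) u : lie_gen P d u -> lie_gen P d (a *: u)
| LieGenBracket d e u v :
    lie_gen P d u -> lie_gen P e v -> lie_gen P (d + e) (sbracket d e u v)
| LieGenSq d u : odd d -> lie_gen P d u -> lie_gen P (d + d) (u * u).

Lemma lie_gen_subspace P d : subspace (lie_gen P d).
Proof. by split; [apply/LieGenIdeal/LieIdeal0 | apply: LieGenD | apply: LieGenZ]. Qed.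

Lemma lie_genN P d u : lie_gen P d u -> lie_gen P d (- u).
Proof. exact: subspaceN (lie_gen_subspace P d). Qed.

Lemma lie_gen_swap P d e u v :
  lie_gen P (d + e) (sbracket d e u v) -> lie_gen P (e + d) (sbracket e d v u).
Proof.
by rewrite addnC (sbracketC e d) andbC; case: ifP => // _ /lie_genN.
Qed.

Lemma sub_lie_gen P P' d u : (forall e v, P e v -> lie_gen P' e v) ->
  lie_gen P d u -> lie_gen P' d u.
Proof.
move=> PP'; elim=> {d u} [d u|d u Ju|d u v _ IHu _|d a u _|d e u v _ IHu _|d u od _].
- exact: PP'.
- exact: LieGenIdeal.
- exact: LieGenD.
- exact: LieGenZ.
- exact: LieGenBracket.
- exact: LieGenSq.
Qed.

Lemma lie_gen_free P d u : (forall e v, P e v -> free_lie e v) ->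
  lie_gen P d u -> free_lie d u.
Proof.
move=> PF; elim=> {d u} [d u|d u Ju|d u v _ IHu _|d a u _|d e u v _ IHu _|d u od _].
- exact: PF.
- exact: lie_ideal_sub_free Ju.
- exact: FreeLieD.
- exact: FreeLieZ.
- exact: FreeLieBracket.
- exact: FreeLieSq.
Qed.

(** Degrees add up, so generators of degree above [D] cannot contribute in degrees at most [D]. This
    ends the elimination. *)
Lemma lie_gen_ideal P D d u : (forall e v, P e v -> (D < e)%N) -> (d <= D)%N ->
  lie_gen P d u -> J d u.
Proof.
move=> PD dD gu; elim: gu dD => {d u} [d u /PD Dd|d u //|d u v _ IHu _ IHv|d a u _ IHu|d e u v _ IHu _ IHv|d u od _ IHu] dD.
- by move: Dd; rewrite ltnNge dD.
- by apply: LieIdealD; [apply: IHu | apply: IHv].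
- by apply/LieIdealZ/IHu.
- apply: LieIdealBracket; first by apply: IHu; apply: leq_trans dD; rewrite leq_addr.
  apply: (lie_ideal_sub_free free_f); apply: IHv; apply: leq_trans dD; exact: leq_addl.
- by apply: LieIdealSq => //; apply: IHu; apply: leq_trans dD; rewrite leq_addr.
Qed.

Section Normalizer.
Variables (Y W : nat -> T -> Prop) (D : nat).
Hypothesis free_Y : forall d u, Y d u -> free_lie d u.
Hypothesis free_W : forall d u, W d u -> free_lie d u.
Hypothesis YW : forall d e u v, Y d u -> W e v -> (d + e <= D)%N ->
  lie_gen W (d + e) (sbracket d e u v).

(** Since ad(u) is a superderivation compatible with squares, it is enough to know its values on the
    generators [W]. The bound [D] is carried along because the lists of generators are truncated. *)
Lemma generator_normalizes d e u v : Y d u -> lie_gen W e v -> (d + e <= D)%N ->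
  lie_gen W (d + e) (sbracket d e u v).
Proof.
move=> Yu; elim=> {e v} [e v|e v Jv|e v v' _ IHv _ IHv'|e a v _ IHv|e e' v v' Wv IHv Wv' IHv'|e v oe Wv IHv] deD.
- by move=> Wv; apply: YW.
- by apply: LieGenIdeal; apply: lie_ideal_bracketr => //; apply: free_Y.
- by rewrite sbracketDr; apply: LieGenD; [apply: IHv | apply: IHv'].
- by rewrite sbracketZr; apply/LieGenZ/IHv.
- rewrite sbracket_jacobi; apply: LieGenD.
    rewrite addnA; apply: LieGenBracket => //; apply: IHv.
    by apply: leq_trans deD; rewrite leq_add2l leq_addr.
  rewrite addnCA; have W' : lie_gen W (e + (d + e')) (sbracket e (d + e') v (sbracket d e' u v')).
    apply: LieGenBracket => //; apply: IHv'.
    by apply: leq_trans deD; rewrite leq_add2l leq_addl.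
  by case: ifP => // _; apply: lie_genN.
- rewrite sbracket_sq // addnA; apply: LieGenBracket => //; apply: IHv.
  by apply: leq_trans deD; rewrite leq_add2l leq_addr.
Qed.

(** The elements whose ad preserves the subalgebra generated by [W] are closed under brackets by
    Jacobi, and under squares because ad(u^2) is ad(u) applied twice, up to sign. *)
Lemma subalgebra_normalizes d e u v : lie_gen Y d u -> lie_gen W e v -> (d + e <= D)%N ->
  lie_gen W (d + e) (sbracket d e u v).
Proof.
move=> gu; elim: gu e v => {d u} [d u Yu|d u Ju|d u u' _ IHu _ IHu'|d a u _ IHu|d d' u u' Yu IHu Yu' IHu'|d u od Yu IHu] e v Wv deD.
- exact: generator_normalizes.
- by apply: LieGenIdeal; apply: LieIdealBracket => //; apply: (lie_gen_free free_W).
- by rewrite sbracketDl; apply: LieGenD; [apply: IHu | apply: IHu'].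
- by rewrite sbracketZl; apply/LieGenZ/IHu.
- have le1 : (d' + e <= D)%N by apply: leq_trans deD; rewrite -addnA leq_addl.
  have le2 : (d + e <= D)%N by apply: leq_trans deD; rewrite addnAC leq_addr.
  have W1 : lie_gen W (d + d' + e) (sbracket d (d' + e) u (sbracket d' e u' v)).
    by rewrite -addnA; apply: IHu; [apply: IHu' | rewrite addnA].
  have W2 : lie_gen W (d + d' + e) (sbracket d' (d + e) u' (sbracket d e u v)).
    by rewrite -addnA addnCA; apply: IHu'; [apply: IHu | rewrite addnCA addnA].
  have -> : sbracket (d + d') e (sbracket d d' u u') v =
      sbracket d (d' + e) u (sbracket d' e u' v)
      + (if odd d && odd d' then sbracket d' (d + e) u' (sbracket d e u v)
         else - sbracket d' (d + e) u' (sbracket d e u v)).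
    by rewrite sbracket_jacobi; case: ifP => _; rewrite ?addrNK ?addrK.
  by apply: LieGenD => //; case: ifP => // _; apply: lie_genN.
- apply: lie_gen_swap; rewrite sbracket_sq // addnA.
  have le1 : (d + e <= D)%N by apply: leq_trans deD; rewrite -addnA leq_addl.
  apply: lie_gen_swap; rewrite (addnC e d).
  apply: (IHu); first by rewrite addnC; apply: lie_gen_swap; apply: (IHu).
  by rewrite addnA.
Qed.

(** Lazard elimination: the subalgebra generated by [W] is an ideal of the one generated by [Y] and
    [W] together, so the sum of the two subalgebras is closed; cross terms of brackets and squares
    fall into the [W] part. *)
Lemma elimination d u : (d <= D)%N -> lie_gen (fun e v => Y e v \/ W e v) d u ->
  exists a b, [/\ lie_gen Y d a, lie_gen W d b & u = a + b].
Proof.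
move=> dD gu; elim: gu dD => {d u} [d u [Yu|Wu]|d u Ju|d u u' _ IHu _ IHu'|d a u _ IHu|d e u v _ IHu _ IHv|d u od _ IHu] dD.
- exists u, 0; rewrite addr0; split=> //; first exact: LieGenIn.
  by have [] := lie_gen_subspace W d.
- exists 0, u; rewrite add0r; split=> //; last exact: LieGenIn.
  by have [] := lie_gen_subspace Y d.
- exists 0, u; rewrite add0r; split=> //; last exact: LieGenIdeal.
  by have [] := lie_gen_subspace Y d.
- have [a [b [Ya Wb ->]]] := IHu dD; have [a' [b' [Ya' Wb' ->]]] := IHu' dD.
  by exists (a + a'), (b + b'); rewrite addrACA; split=> //; apply: LieGenD.
- have [y [w [Yy Ww ->]]] := IHu dD.
  by exists (a *: y), (a *: w); rewrite scalerDr; split=> //; apply: LieGenZ.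
- have [|a [b [Ya Wb ->]]] := IHu; first by apply: leq_trans dD; rewrite leq_addr.
  have [|a' [b' [Ya' Wb' ->]]] := IHv; first by apply: leq_trans dD; rewrite leq_addl.
  exists (sbracket d e a a'), (sbracket d e b a' + sbracket d e (a + b) b').
  split; first exact: LieGenBracket.
    apply: LieGenD; first by apply: lie_gen_swap; apply: subalgebra_normalizes; rewrite 1?addnC.
    rewrite sbracketDl; apply: LieGenD; last exact: LieGenBracket.
    exact: subalgebra_normalizes.
  by rewrite sbracketDr sbracketDl -addrA.
- have [|a [b [Ya Wb ->]]] := IHu; first by apply: leq_trans dD; rewrite leq_addr.
  exists (a * a), (scomm true a b + b * b); split; first exact: LieGenSq.
    apply: LieGenD; last exact: LieGenSq.
    by have := subalgebra_normalizes Ya Wb dD; rewrite sbracketE od.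
  by rewrite mulr_sqD; apply/esym/addrA.
Qed.
End Normalizer.
End Elimination.

(** * Exponential products and bases obtained by elimination *)

Section Truncation.
Variable R : comNzRingType.
Implicit Types p q s : {poly R}.

(** Congruence modulo z^(D + 1); all power series identities are handled through it on
    polynomials. *)
Definition eqmod D p q : Prop := forall i, (i <= D)%N -> p`_i = q`_i.

Lemma eqmod_refl D p : eqmod D p p. Proof. by []. Qed.

Lemma eqmod_sym D p q : eqmod D p q -> eqmod D q p.
Proof. by move=> pq i iD; rewrite pq. Qed.

Lemma eqmod_trans D q p s : eqmod D p q -> eqmod D q s -> eqmod D p s.
Proof. by move=> pq qs i iD; rewrite pq ?qs. Qed.

Lemma eqmodD D p p' q q' : eqmod D p p' -> eqmod D q q' -> eqmod D (p + q) (p' + q').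
Proof. by move=> pp qq i iD; rewrite !coefD pp ?qq. Qed.

Lemma eqmodM D p p' q q' : eqmod D p p' -> eqmod D q q' -> eqmod D (p * q) (p' * q').
Proof.
move=> pp qq i iD; rewrite !coefM; apply: eq_bigr => j _.
have ji : (j <= i)%N by rewrite -ltnS ltn_ord.
by rewrite pp ?qq // (leq_trans _ iD) // leq_subr.
Qed.

Lemma eqmodMl D s p q : eqmod D p q -> eqmod D (s * p) (s * q).
Proof. exact: eqmodM. Qed.

Lemma eqmodMr D s p q : eqmod D p q -> eqmod D (p * s) (q * s).
Proof. by move=> pq; apply: eqmodM. Qed.

Lemma eqmod_le D E p q : (D <= E)%N -> eqmod E p q -> eqmod D p q.
Proof. by move=> DE pq i iD; apply/pq/(leq_trans iD). Qed.

Lemma eqmodMXn D p q e : (D < e)%N -> eqmod D (p - 'X^e * q) p.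
Proof.
by move=> De i iD; rewrite coefB coefXnM (leq_ltn_trans iD De) subr0.
Qed.

Lemma eqmod_cancel D s p q : s`_0 = 1 -> eqmod D (s * p) (s * q) -> eqmod D p q.
Proof.
move=> s0 spq i; elim/ltn_ind: i => i IHi iD; have := spq i iD.
rewrite !coefM !big_ord_recl /= !subn0 s0 !mul1r => /eqP.
rewrite (eq_bigr (fun j : 'I_i => s`_(bump 0 j) * q`_(i - bump 0 j))).
  by rewrite (inj_eq (addIr _)) => /eqP.
move=> j _; rewrite IHi ?(leq_trans (leq_subr _ _)) //.
by rewrite /bump leq0n; have := ltn_ord j; lia.
Qed.
End Truncation.

(* Generators and bases are lists of elements tagged with their degrees. *)
Section DegreeSeries.
Variable A : Type.
Implicit Types B S : seq (nat * A).

Definition gen_poly S : {poly rat} := \sum_(p <- S) 'X^(p.1).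
(** [odd_prod] and [even_prod] are the numerator and denominator of Exp, kept apart so that no
    series has to be inverted. *)
Definition odd_prod B : {poly rat} := \prod_(p <- B | odd p.1) (1 + 'X^(p.1)).
Definition even_prod B : {poly rat} := \prod_(p <- B | ~~ odd p.1) (1 - 'X^(p.1)).
Definition deg_count d B : nat := count (fun p => p.1 == d) B.

(* Exp(B(z)) = 1 / q(z) modulo z^(D + 1) *)
Definition exp_inv D (q : {poly rat}) B : Prop :=
  eqmod D (q * odd_prod B) (even_prod B).

Lemma odd_prod_cons i b B : odd_prod ((i, b) :: B) =
  (if odd i then 1 + 'X^i else 1) * odd_prod B.
Proof. by rewrite /odd_prod big_cons /=; case: ifP => _; rewrite ?mul1r. Qed.

Lemma even_prod_cons i b B : even_prod ((i, b) :: B) =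
  (if odd i then 1 else 1 - 'X^i) * even_prod B.
Proof. by rewrite /even_prod big_cons /=; case: (odd i); rewrite ?mul1r. Qed.

Lemma exp_inv_cat D q1 q2 B1 B2 : exp_inv D q1 B1 -> exp_inv D q2 B2 ->
  exp_inv D (q1 * q2) (B1 ++ B2).
Proof.
move=> e1 e2; rewrite /exp_inv /odd_prod /even_prod !big_cat /= -!/(odd_prod _) -!/(even_prod _).
by rewrite mulrACA; apply: eqmodM.
Qed.
End DegreeSeries.

(** * Spans of lists of elements tagged with degrees *)

Section InSpan.
Variables (K : fieldType) (T : lmodType K).
Implicit Types (u v : T) (B : seq (nat * T)).

(** Coefficients are peeled off along the list, those of other degrees being skipped; this keeps
    concatenation and induction on lists free of index types. *)
Fixpoint in_span (W : nat -> T -> Prop) B d u : Prop :=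
  if B is (i, b) :: B' then
    if i == d then exists a : K, in_span W B' d (u - a *: b) else in_span W B' d u
  else W d u.

Variable W : nat -> T -> Prop.
Hypothesis sW : forall d, subspace (W d).

Lemma in_span_subspace B d : subspace (in_span W B d).
Proof.
elim: B => [|[i b] B IHB] //=; case: eqP => // _; have [B0 BD BZ] := IHB; split.
- by exists 0; rewrite scale0r subr0.
- move=> u v [a ua] [a' va']; exists (a + a').
  by rewrite scalerDl opprD addrACA; apply: BD.
- move=> a u [a' ua']; exists (a * a').
  by rewrite -scalerA -scalerBr; apply: BZ.
Qed.

Lemma in_span0 B d u : W d u -> in_span W B d u.
Proof.
elim: B => [|[i b] B IHB] //= Wu; case: eqP => _; last exact: IHB.
by exists 0; rewrite scale0r subr0; apply: IHB.
Qed.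

Lemma in_span_cat B B' d u v : in_span W B d u -> in_span W B' d v ->
  in_span W (B ++ B') d (u + v).
Proof.
elim: B u => [|[i b] B IHB] u /=.
  have [_ BD _] := in_span_subspace B' d.
  by move=> /(in_span0 B') Bu Bv; apply: BD.
case: eqP => _; last exact: IHB.
by case=> a Bu Bv; exists a; rewrite addrAC; apply: IHB.
Qed.

Lemma in_span_spanned (U : T -> Prop) B d : (forall u, U u -> in_span W B d u) ->
  spanned U (W d) (deg_count d B).
Proof.
suff [b bP] : exists b : 'I_(deg_count d B) -> T, forall u, in_span W B d u ->
    exists a : 'I_(deg_count d B) -> K, W d (u - \sum_i a i *: b i).
  by move=> UB; exists b => u /UB /bP.
elim: B {U} => [|[i b] B [c cP]] /=.
  exists (fun _ => 0) => u Wu; exists (fun _ => 0); rewrite big_ord0 subr0.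
  exact: Wu.
rewrite /deg_count /= -/(deg_count d B); case: eqP => _; rewrite ?add0n ?add1n; last by exists c.
exists (cons_fam b c) => u [a /cP[a' Wu]].
exists (fun j => if unlift ord0 j is Some k then a' k else a).
rewrite sum_cons_fam unlift_none opprD addrA.
congr (W d (_ - _)): Wu; apply: eq_bigr => j _; by rewrite liftK.
Qed.

Lemma in_span_min (X : T -> Prop) B d u : subspace X -> (forall v, W d v -> X v) ->
  (forall b, (d, b) \in B -> X b) -> in_span W B d u -> X u.
Proof.
move=> sX WX; have [_ XD XZ] := sX; elim: B u => [|[i b] B IHB] u BX /=; first exact: WX.
have BX' b' : (d, b') \in B -> X b' by move=> dB; apply: BX; rewrite inE dB orbT.
case: eqP => [id|_]; last exact: IHB.
case=> a Bu; rewrite -[u](subrK (a *: b)); apply: XD; first exact: IHB.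
by apply/XZ/BX; rewrite id mem_head.
Qed.

Lemma in_span_mem B d b : (forall e, W e 0) -> (d, b) \in B -> in_span W B d b.
Proof.
move=> W0; elim: B => [//|[i b'] B IHB] /=; rewrite inE xpair_eqE eq_sym.
have [B0 BD BZ] := in_span_subspace B d.
case: eqP => [_ | _ //] /=; case: eqP => [<- _ | _ /= dB]; last by exists 0; rewrite scale0r subr0; apply: IHB.
by exists 1; rewrite scale1r subrr.
Qed.
End InSpan.

Lemma scomm_self (A : nzRingType) (x : A) b :
  scomm b x x = if b then x * x + x * x else 0.
Proof. by case: b => //=; rewrite subrr. Qed.

Lemma scomm_self_sq (A : nzRingType) (x : A) : scomm false x (x * x) = 0.
Proof. by rewrite /= mulrA subrr. Qed.

(** * Repeated elimination of single elements *)

Section Spanning.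
Variables (K : fieldType) (n r : nat) (f : 'I_r -> ncpoly K n).
Hypothesis free_f : forall i, free_lie 2 (f i).
Local Notation T := (ncpoly K n).
Local Notation J := (lie_ideal f).
Implicit Types (u v w x : T) (d e i : nat) (S B : seq (nat * T)).

Definition listed S d u : Prop := (d, u) \in S.

(* ad(x)^k u, for x of degree i and u of degree d *)
Fixpoint ad i x k d u : T := if k is k'.+1 then sbracket i (d + k' * i) x (ad i x k' d u) else u.

(** Generators of the ideal left after eliminating [x]. As [i] is positive in the applications,
    exponents up to [D] cover all degrees up to [D]. *)
Definition ad_list D i x S : seq (nat * T) :=
  [seq ((p.1 + k * i)%N, ad i x k p.1 p.2) | k <- iota 0 D.+1, p <- S].

Lemma ad_free i x k d u : free_lie i x -> free_lie d u -> free_lie (d + k * i) (ad i x k d u).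
Proof.
move=> Fx Fu; elim: k => [|k IHk] /=; first by rewrite mul0n addn0.
by rewrite mulSn addnCA; apply: FreeLieBracket.
Qed.

(** Spans the subalgebra generated by one element: [x, x] = 0 for x even, while for x odd one gets x
    and x^2, with [x, x^2] = 0. *)
Definition single i x : seq (nat * T) :=
  if odd i then [:: (i, x); ((i + i)%N, x * x)] else [:: (i, x)].

Lemma single_free i x d b : (0 < i)%N -> free_lie i x -> (d, b) \in single i x -> free_lie d b.
Proof.
rewrite /single => i0 Fx; case: ifP => oi; rewrite !inE ?xpair_eqE.
  by case/orP=> /andP[/eqP -> /eqP ->] //; apply: FreeLieSq.
by move=> /andP[/eqP -> /eqP ->].
Qed.

Lemma lie_gen_single i x d u : (0 < i)%N -> free_lie i x ->
  lie_gen f (fun e v => e = i /\ v = x) d u -> in_span J (single i x) d u.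
Proof.
move=> i0 Fx gu.
have sJ := lie_ideal_subspace f.
have J0 e : J e 0 by have [] := sJ e.
set S := single i x.
have sS e := in_span_subspace sJ S e.
have JS e v : J e v -> in_span J S e v by exact: in_span0.
have Sx : in_span J S i x.
  by apply: in_span_mem => //; rewrite /S /single; case: ifP => _; rewrite mem_head.
have Sxx : odd i -> in_span J S (i + i) (x * x).
  by move=> oi; apply: in_span_mem => //; rewrite /S /single oi !inE eqxx orbT.
have genF e v : lie_gen f (fun e v => e = i /\ v = x) e v -> free_lie e v.
  by apply: lie_gen_free => // e' v' [-> ->].
have memS e b : (e, b) \in S -> (e = i /\ b = x) \/ [/\ odd i, e = (i + i)%N & b = x * x].
  rewrite /S /single; case: ifP => oi; rewrite !inE ?xpair_eqE.
    by case/orP=> /andP[/eqP -> /eqP ->]; [left | right].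
  by move=> /andP[/eqP -> /eqP ->]; left.
have S_xx : in_span J S (i + i) (sbracket i i x x).
  rewrite sbracketE scomm_self // andbb; case: ifP => oi; last by have [] := sS (i + i)%N.
  by have [_ SD _] := sS (i + i)%N; apply: SD; apply: Sxx.
have S0 e : in_span J S e 0 by have [] := sS e.
have brS e e' b b' : (e, b) \in S -> (e', b') \in S -> in_span J S (e + e') (sbracket e e' b b').
  have xxx (oi : odd i) : sbracket i (i + i) x (x * x) = 0.
    rewrite sbracketE oddD addbb andbF; exact: scomm_self_sq.
  move=> /memS[[-> ->]|[oi -> ->]] /memS[[-> ->]|[oi' -> ->]].
  - exact: S_xx.
  - by rewrite (xxx oi').
  - by rewrite sbracketC (xxx oi) oppr0 if_same.
  - rewrite sbracketE oddD addbb scomm_self //; exact: S0.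
elim: gu => {d u} [d u [-> ->] //|d u /JS //|d u v _ Su _ Sv|d a u _ Su|d e u v gu Su gv Sv|d u od gu Su].
- by have [_ SD _] := sS d; apply: SD.
- by have [_ _ SZ] := sS d; apply: SZ.
- have sX := sS (d + e)%N.
  apply: (in_span_min (X := fun u => in_span J S (d + e) (sbracket d e u v)) _ _ _ Su).
  + exact: sbracket_subspacel.
  + by move=> w Jw; apply/JS/LieIdealBracket => //; apply: genF.
  move=> b bS; apply: (in_span_min (X := fun v => in_span J S (d + e) (sbracket d e b v)) _ _ _ Sv).
  + exact: sbracket_subspacer.
  + by move=> w Jw; apply/JS/lie_ideal_bracketr => //; apply: single_free bS.
  by move=> b' b'S; apply: brS.
- (* an odd element is a combination of x and of the ideal *)
  have [a Ju] : exists a : K, J d (u - a *: x) /\ (a != 0 -> d = i).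
    move: Su; rewrite /S /single; case: ifP => oi /=.
      case: eqP => [id|_]; case: eqP => [iid|_]; try by move: od; rewrite -iid oddD addbb.
        by case=> a Ju; exists a; split=> // _; rewrite id.
      by move=> Ju; exists 0; rewrite scale0r subr0 eqxx.
    case: eqP => [id|_]; first by move: od; rewrite -id oi.
    by move=> Ju; exists 0; rewrite scale0r subr0 eqxx.
  have [_ SD SZ] := sS (d + d)%N.
  have [a0 | a_neq0] := eqVneq a 0.
    by apply/JS/LieIdealSq => //; move: (proj1 Ju); rewrite a0 scale0r subr0.
  have di := (proj2 Ju) a_neq0; subst d; have {}Ju := proj1 Ju.
  rewrite -[u](subrK (a *: x)); set j := (X in J _ X) in Ju; rewrite -/j.
  rewrite mulr_sqD; apply: (SD); last by rewrite ncscaleAl ncscaleAr; apply/SZ/SZ/Sxx.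
  apply: (SD); first by apply/JS/LieIdealSq.
  have := LieIdealBracket Ju (FreeLieZ a Fx); rewrite sbracketE od; exact: JS.
Qed.

Lemma ad_list_bracket D i x S : (0 < i)%N -> free_lie i x ->
  (forall p, p \in S -> (0 < p.1)%N) ->
  forall d e u v, d = i /\ u = x -> listed (ad_list D i x S) e v -> (d + e <= D)%N ->
  lie_gen f (listed (ad_list D i x S)) (d + e) (sbracket d e u v).
Proof.
move=> i0 Fx S0 d e _ v [-> ->] /allpairsP[[k p] /= [kD pS [-> ->]]] iD.
apply: LieGenIn; apply/allpairsP; exists (k.+1, p); split=> //; last first.
  by rewrite /= mulSn addnCA.
by rewrite mem_iota add0n /=; move: iD; have := leq_pmulr k i0; have := S0 _ pS; lia.
Qed.

(** The last clause, that no degree count drops, serves to show later that the coefficients of the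
    logarithm are positive. *)
Definition elim_basis D S B : Prop :=
  [/\ forall p, p \in B -> free_lie p.1 p.2,
      forall d u, (d <= D)%N -> lie_gen f (listed S) d u -> in_span J B d u,
      exp_inv D (1 - gen_poly S) B
    & forall d, (d <= D)%N -> (deg_count d S <= deg_count d B)%N].

Lemma elim_basis_perm D S S' B : perm_eq S S' -> elim_basis D S B -> elim_basis D S' B.
Proof.
move=> SS' [BF BS Be Bc]; split=> // [d u dD gu||d dD].
- apply: BS => //; apply: sub_lie_gen gu => e v.
  by rewrite /listed -(perm_mem SS'); apply: LieGenIn.
- by rewrite /gen_poly -(perm_big _ SS').
- by rewrite /deg_count -(permP SS'); apply: Bc.
Qed.

Lemma deg_count_ad_list D i x S d : (deg_count d S <= deg_count d (ad_list D i x S))%N.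
Proof.
rewrite /ad_list /= /deg_count count_cat -[X in (X <= _)%N]addn0 leq_add //.
by rewrite count_map leq_eqVlt; apply/orP; left; apply/eqP/eq_count => p /=; rewrite mul0n addn0.
Qed.

(* Exp(z^i) = 1 / (1 - z^i) for i even, and Exp(z^i + z^(2 i)) = 1 / (1 - z^i) for i odd *)
Lemma elim_basis_step D i x S B : (0 < i)%N -> free_lie i x ->
  (forall p, p \in S -> (0 < p.1)%N /\ free_lie p.1 p.2) ->
  elim_basis D (ad_list D i x S) B -> elim_basis D ((i, x) :: S) (single i x ++ B).
Proof.
move=> i0 Fx SP; set W := ad_list D i x S => -[BF BS Be Bc]; split.
- by move=> p; rewrite mem_cat => /orP[|/BF //]; case: p => d b; apply: single_free.
- move=> d u dD gu.
  have sJ := lie_ideal_subspace f.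
  have [||||a [b [ga gb ->]]] := @elimination _ _ _ f free_f (fun e v => e = i /\ v = x) (listed W) D _ _ _ d u dD.
  + by move=> e v [-> ->].
  + by move=> e v /allpairsP[[k q] /= [_ /SP[_ Fq] [-> ->]]]; apply: ad_free.
  + by apply: ad_list_bracket => // p /SP[].
  + apply: sub_lie_gen gu => e v eS; apply: LieGenIn.
    move: eS; rewrite /listed inE xpair_eqE => /orP[/andP[/eqP -> /eqP ->]|eS'].
      by left.
    right; apply/allpairsP; exists (0%N, (e, v)); split=> //=.
    by rewrite mul0n addn0.
  apply: in_span_cat => //; first exact: lie_gen_single.
  exact: BS.
(* Elimination on generating functions: W(z) = S(z) (1 + z^i + ... + z^(D i)), so (1 - z^i) (1 -
   W(z)) is 1 - z^i - S(z) up to a multiple of z^(i (D + 1)). *)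
- have WE : eqmod D ((1 - 'X^i) * (1 - gen_poly W)) (1 - gen_poly ((i, x) :: S)).
    have -> : gen_poly W = (\sum_(k < D.+1) ('X^i) ^+ k) * gen_poly S.
      rewrite /gen_poly /W /ad_list big_allpairs_dep /= -/(iota 0 D.+1).
      rewrite -/(index_iota 0 D.+1) big_mkord mulr_suml.
      apply: eq_bigr => k _; rewrite mulr_sumr; apply: eq_bigr => p _.
      by rewrite -exprM mulnC -exprD addnC.
    rewrite [gen_poly (_ :: _)]big_cons -/(gen_poly S) /=.
    have geo : (1 - 'X^i) * (\sum_(k < D.+1) ('X^i) ^+ k) = 1 - 'X^(i * D.+1) :> {poly rat}.
      by rewrite -opprB mulNr -subrX1 opprB exprM.
    have -> : (1 - 'X^i) * (1 - (\sum_(k < D.+1) ('X^i) ^+ k) * gen_poly S) =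
        (1 - ('X^i + gen_poly S)) - 'X^(i * D.+1) * (- gen_poly S).
      rewrite mulrBr mulr1 mulrA geo; ring.
    by apply: eqmodMXn; rewrite leq_pmull.
  rewrite /exp_inv /odd_prod /even_prod !big_cat /= -/(odd_prod B) -/(even_prod B).
  rewrite /single; case: ifP => oi; rewrite !big_cons !big_nil /= ?oddD oi /= ?addbb ?mulr1 ?mul1r.
    apply: (eqmod_trans (q := (1 - 'X^i) * (1 - gen_poly W) * ((1 + 'X^i) * odd_prod B))).
      by apply: eqmodMr; apply: eqmod_sym.
    have -> : (1 - 'X^i) * (1 - gen_poly W) * ((1 + 'X^i) * odd_prod B) =
      (1 - 'X^(i + i)) * ((1 - gen_poly W) * odd_prod B) by rewrite exprD; ring.
    exact: eqmodMl.
  apply: (eqmod_trans (q := (1 - 'X^i) * ((1 - gen_poly W) * odd_prod B))).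
    by rewrite mulrA; apply: eqmodMr; apply: eqmod_sym.
  exact: eqmodMl.
move=> d dD; rewrite /deg_count count_cat -/(deg_count d B) /= leq_add //.
  by rewrite /single; case: ifP => _ /=; case: eqP.
by apply: leq_trans (deg_count_ad_list _ _ _ _ _) _; apply: Bc.
Qed.

(** Induction on the lowest degree [i] still allowed and on the number [c] of generators of that
    degree: eliminating one of them only creates generators of degree above [i]. Once [i] exceeds
    [D] nothing is left. *)
Lemma span_elimination D S : (forall p, p \in S -> (0 < p.1)%N /\ free_lie p.1 p.2) ->
  exists B, elim_basis D S B.
Proof.
move=> S0.
suff main m i (im : (D.+1 - i = m)%N) : (0 < i)%N -> forall c S,
    (forall p, p \in S -> (i <= p.1)%N /\ free_lie p.1 p.2) -> deg_count i S = c ->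
    exists B, elim_basis D S B.
  by apply: (main D 1%N _ _ (deg_count 1 S)); rewrite ?subn1.
elim: m i im => [|m IHm] i im i0.
  have Di : (D < i)%N by move/eqP: im; rewrite subn_eq0.
  move=> c {S0}S SP _; exists [::]; split=> //.
  - move=> d u dD; apply: (lie_gen_ideal free_f _ dD) => e v /SP[ie _].
    exact: leq_trans Di ie.
  - rewrite /exp_inv /odd_prod /even_prod !big_nil mulr1 => e eD.
    rewrite coefB /gen_poly coef_sum big_seq big1 ?subr0 // => p /SP[ip _].
    by rewrite coefXn ltn_eqF // (leq_ltn_trans eD) // (leq_trans Di ip).
  - move=> d dD; rewrite leqNgt -has_count; apply/hasP => -[p /SP[ip _] /eqP pd].
    by move: ip; rewrite pd leqNgt (leq_ltn_trans dD Di).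
elim=> [|c IHc] {S0}S SP cS.
  apply: (IHm i.+1 _ _ _ S) => //; first by rewrite subnS im.
  move=> p pS; have [ip Fp] := SP p pS; split=> //; rewrite ltn_neqAle ip andbT.
  apply: contra_eqN cS => /eqP ip'; rewrite -lt0n -has_count; apply/hasP.
  by exists p => //; rewrite ip'.
have : has (fun p : nat * T => p.1 == i) S by rewrite has_count -/(deg_count i S) cS.
case/hasP=> [[i' x]] xS /= /eqP ii'; subst i'.
have [_ Fx] := SP _ xS; rewrite /= in Fx.
pose S' := rem (i, x) S; have permS : perm_eq S ((i, x) :: S') := perm_to_rem xS.
have S'S p : p \in S' -> p \in S by move/mem_rem.
pose W := ad_list D i x S'.
have WP p : p \in W -> (i <= p.1)%N /\ free_lie p.1 p.2.
  case/allpairsP=> [[k q] /= [_ /S'S/SP[iq Fq] ->]] /=; split; last exact: ad_free.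
  exact: leq_trans iq (leq_addr _ _).
have cSi : deg_count i S' = c.
  by move: cS; rewrite /deg_count (permP permS) /= eqxx add1n => -[].
have cWi : deg_count i W = c.
  apply/eqP; rewrite eqn_leq -{2}cSi deg_count_ad_list andbT -cSi.
  rewrite /W /ad_list /= /deg_count count_cat -[X in (_ <= X)%N]addn0 leq_add //.
    by rewrite count_map; apply: sub_count => p /=; rewrite mul0n addn0.
  rewrite leqNgt -has_count; apply/hasP => -[_ /allpairsP[[k q] /= [kD qS ->]] /=].
  have [iq _] := SP q (S'S q qS); move: kD; rewrite mem_iota => /andP[k0 _] /eqP e.
  have := leq_pmull i k0; move: e iq i0.
  by clear; move: q.1 (k * i)%N => a b; lia.
have [B BW] := IHc W WP cWi; exists (single i x ++ B).
apply: elim_basis_perm (elim_basis_step i0 Fx _ BW); first by rewrite perm_sym.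
by move=> p /S'S/SP[ip Fp]; split=> //; apply: leq_trans ip.
Qed.

(** Eliminating [x] first leaves the generators ad(x)^k y, one in each degree k + 1, and later
    eliminations do not decrease the counts. *)
Lemma span_elimination_pos D x y S :
  free_lie 1 x -> free_lie 1 y -> (forall p, p \in S -> (0 < p.1)%N /\ free_lie p.1 p.2) ->
  exists2 B, elim_basis D [:: (1%N, x), (1%N, y) & S] B &
    forall d, (0 < d <= D)%N -> (0 < deg_count d B)%N.
Proof.
move=> Fx Fy SP.
have S'P p : p \in (1%N, y) :: S -> (0 < p.1)%N /\ free_lie p.1 p.2.
  by rewrite inE => /orP[/eqP -> //|/SP].
have [|B BW] := @span_elimination D (ad_list D 1 x ((1%N, y) :: S)).
  move=> _ /allpairsP[[k q] /= [_ /S'P[q0 Fq] ->]] /=; split; last exact: ad_free.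
  by rewrite addn_gt0 q0.
exists (single 1 x ++ B); first exact: elim_basis_step.
move=> d /andP[d0 dD]; rewrite /deg_count count_cat addn_gt0; apply/orP; right.
have [_ _ _ Bc] := BW; apply: leq_trans (Bc d dD); rewrite -has_count; apply/hasP.
exists ((1 + d.-1 * 1)%N, ad 1 x d.-1 1 y); last by rewrite muln1 add1n prednK.
apply/allpairsP; exists (d.-1, (1%N, y)); split; rewrite ?inE ?eqxx //.
by rewrite mem_iota /=; lia.
Qed.
End Spanning.

(** * Bipartite relators *)

Section Bipartite.
Variables (K : fieldType) (n' p q r : nat).
Local Notation n := n'.+1.
Hypotheses (pq_n : (p + q = n)%N) (q_gt0 : (0 < q)%N) (r_pq : (r <= p * q)%N).
Local Notation T := (ncpoly K n).

(* The r-th relator is [x_a, x_b] with a q + (b - p) = r, for a < p <= b. *)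
Definition bipartite_coef (t : coef_idx n r) : K :=
  if t.2 is inr e then
    ((p <= (val e).2)%N && ((val e).1 * q + (val e).2 == t.1 + p)%N)%:R
  else 0.

Local Notation s := (relator bipartite_coef).
Let var k : T := ncvar K (inord k).

(** Euclidean division of [i] by [q] recovers a and b - p, so exactly one bracket has a nonzero
    coefficient. *)
Lemma bipartite_relator (i : 'I_r) : s i = sbracket 1 1 (var (i %/ q)) (var (p + i %% q)).
Proof.
have ip : (i %/ q < p)%N by rewrite ltn_divLR // (leq_trans _ r_pq).
have iq : (i %% q < q)%N by rewrite ltn_pmod.
have lt_n : (i %/ q < n)%N by rewrite -pq_n; lia.
have lt_n' : (p + i %% q < n)%N by rewrite -pq_n; lia.
have ab : ((inord (i %/ q) : 'I_n, inord (p + i %% q) : 'I_n).1 <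
           (inord (i %/ q) : 'I_n, inord (p + i %% q) : 'I_n).2)%N.
  by rewrite /= !inordK //; lia.
rewrite /relator big1 => [|j _]; last by rewrite scale0r.
pose e0 : {e : 'I_n * 'I_n | (e.1 < e.2)%N} := exist _ (inord (i %/ q), inord (p + i %% q)) ab.
rewrite add0r (bigD1 e0) //= big1 => [|e e_neq].
  rewrite addr0 /bipartite_coef /= !inordK // leq_addr addnCA -divn_eq addnC eqxx.
  by rewrite scale1r.
rewrite /bipartite_coef /=; case: andP => [[pe /eqP eE]|_]; last by rewrite scale0r.
case/eqP: e_neq; apply: val_inj; case: e pe eE => -[a b] /= lt_ab pb abE.
have bq : (b - p < q)%N by have := ltn_ord b; lia.
have iE : (i = a * q + (b - p) :> nat)%N by lia.
have aE : (i %/ q = a)%N by rewrite iE divnMDl // divn_small // addn0.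
have bE : (p + i %% q = b)%N by rewrite iE modnMDl modn_small //; lia.
by congr (_, _); apply: val_inj; rewrite /= inordK ?aE ?bE.
Qed.

Definition x_gens : seq (nat * T) := [seq (1%N, var a) | a <- iota 0 p].
Definition y_gens : seq (nat * T) := [seq (1%N, var b) | b <- iota p q].

(* iterated brackets of the x_gens with y's, omitting those which vanish *)
Fixpoint y_brackets k : seq (nat * T) :=
  match k with
  | 0 => x_gens
  | 1 => [seq (2%N, sbracket 1 1 (var (p + i %% q)) (var (i %/ q))) | i <- iota r (p * q - r)]
  | k'.+1 => [seq ((1 + w.1)%N, sbracket 1 w.1 (var b) w.2) | b <- iota p q, w <- y_brackets k']
  end.

Definition w_gens D : seq (nat * T) := flatten [seq y_brackets k | k <- iota 0 D].

Lemma y_brackets_deg k w : w \in y_brackets k -> w.1 = k.+1 /\ free_lie w.1 w.2.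
Proof.
elim: k w => [|[|k] IHk] w.
- by case/mapP=> a _ ->; split=> //; apply: FreeLieVar.
- case/mapP=> i _ ->; split=> //.
  exact: (@FreeLieBracket _ _ 1 1 _ _ (FreeLieVar _ _) (FreeLieVar _ _)).
- case/allpairsP=> [[b v] /= [_ /IHk[v1 Fv] ->]] /=; rewrite v1; split=> //.
  by rewrite v1 in Fv; apply: (@FreeLieBracket _ _ 1 k.+2 _ _ (FreeLieVar _ _) Fv).
Qed.

Lemma size_y_brackets k : size (y_brackets k) =
  match k with 0 => p | k'.+1 => ((p * q - r) * q ^ k')%N end.
Proof.
elim: k => [|[|k] IHk]; first by rewrite size_map size_iota.
  by rewrite size_map size_iota muln1.
by rewrite size_allpairs size_iota IHk expnS mulnCA.
Qed.

Lemma free_s i : free_lie 2 (s i). Proof. exact: relator_free_lie. Qed.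

Lemma w_gensP D d w : (d, w) \in w_gens D ->
  exists2 k, (k < D)%N & d = k.+1 /\ (d, w) \in y_brackets k.
Proof.
case/flattenP=> l /mapP[k]; rewrite mem_iota => /andP[_ kD] -> wk.
by exists k => //; have [] := y_brackets_deg wk.
Qed.

Lemma mem_w_gens D k w : (k < D)%N -> w \in y_brackets k -> w \in w_gens D.
Proof.
by move=> kD wk; apply/flattenP; exists (y_brackets k) => //; apply: map_f; rewrite mem_iota.
Qed.

(** A bracket of a y with a listed element is the next listed one by construction, except for
    [y_b, x_a] with index a q + (b - p) below [r], which is a relator up to order. *)
Lemma y_normalizes D d e u v : listed y_gens d u -> listed (w_gens D) e v -> (d + e <= D)%N ->
  lie_gen s (listed (w_gens D)) (d + e) (sbracket d e u v).
Proof.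
case/mapP=> b; rewrite mem_iota => bq [-> ->] /w_gensP[k _ [-> vk]].
rewrite add1n => kD; case: k vk kD => [|k] vk kD; last first.
  apply: LieGenIn; apply: (mem_w_gens (k := k.+2)) => //.
  by apply/allpairsP; exists (b, (k.+2, v)); split=> //; rewrite mem_iota.
case/mapP: vk => a; rewrite mem_iota => /andP[_ ap] [->].
have bq' : (b - p < q)%N by lia.
pose i := (a * q + (b - p))%N.
have ipq : (i < p * q)%N.
  apply: (@leq_trans (a.+1 * q)); first by rewrite mulSn /i; lia.
  by rewrite leq_mul2r; apply/orP; right.
have aE : (i %/ q = a)%N by rewrite /i divnMDl // divn_small // addn0.
have bE : (p + i %% q = b)%N by rewrite /i modnMDl modn_small //; lia.
have [ir | ri] := ltnP i r.
  apply/LieGenIdeal; rewrite sbracketC /=.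
  by have := LieIdealGen s (Ordinal ir); rewrite bipartite_relator /= aE bE.
apply: LieGenIn; apply: (mem_w_gens (k := 1)) => //.
apply/mapP; exists i; last by rewrite aE bE.
by rewrite mem_iota ri subnKC.
Qed.

Lemma free_lie_generated D d u : (d <= D)%N -> (0 < D)%N -> free_lie d u ->
  lie_gen s (fun e v => listed y_gens e v \/ listed (w_gens D) e v) d u.
Proof.
move=> dD D0 Fu; elim: Fu dD => {d u} [j|d|d u v _ IHu _ IHv|d a u _ IHu|d e u v _ IHu _ IHv|d u od _ IHu] dD.
- apply: LieGenIn; have jn := ltn_ord j; have [jp | pj] := ltnP j p.
    right; apply: (mem_w_gens (k := 0)) => //; apply/mapP; exists (val j); rewrite ?mem_iota //.
    by rewrite /var inord_val.
  left; apply/mapP; exists (val j); first by rewrite mem_iota pj pq_n.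
  by rewrite /var inord_val.
- by have [] := lie_gen_subspace s (fun e v => listed y_gens e v \/ listed (w_gens D) e v) d.
- by apply: LieGenD; [apply: IHu | apply: IHv].
- by apply/LieGenZ/IHu.
- by apply: LieGenBracket; [apply: IHu | apply: IHv]; apply: leq_trans dD; rewrite ?leq_addr ?leq_addl.
- by apply: LieGenSq => //; apply: IHu; apply: leq_trans dD; rewrite leq_addr.
Qed.

Lemma gen_poly_y : gen_poly y_gens = q%:R *: 'X.
Proof.
rewrite /gen_poly big_map (eq_bigr (fun _ => 'X)) // big_const_seq count_predT size_iota.
by rewrite iter_addr_0 scaler_nat.
Qed.

Lemma coef_gen_poly_w D i : (i <= D)%N ->
  (gen_poly (w_gens D))`_i = if i is k.+1 then (size (y_brackets k))%:R else 0.
Proof.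
move=> iD; rewrite /gen_poly /w_gens big_flatten big_map coef_sum.
have sumE k : (\sum_(w <- y_brackets k) 'X^(w.1) : {poly rat})`_i =
    if (i == k.+1) then (size (y_brackets k))%:R else 0.
  rewrite coef_sum big_seq (eq_bigr (fun _ => (i == k.+1)%:R)); last first.
    by move=> w /y_brackets_deg[-> _]; rewrite coefXn.
  rewrite -big_seq big_const_seq count_predT iter_addr_0.
  by case: eqP => _; rewrite ?mul0rn.
rewrite (eq_bigr _ (fun k _ => sumE k)); case: i iD {sumE} => [|k] kD.
  by rewrite big1.
rewrite (bigD1_seq k) ?mem_iota ?iota_uniq //=; case: eqP => // _.
by rewrite big1 ?addr0 // => j jk; case: eqP => // -[kj]; rewrite kj eqxx in jk.
Qed.

(** With W(z) = p z + (p q - r) z^2 / (1 - q z), the product (1 - q z) (1 - W(z)) is (1 - q z) (1 -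
    p z) - (p q - r) z^2, that is 1 - n z + r z^2. *)
Lemma bipartite_series D : (0 < D)%N ->
  eqmod D ((1 - gen_poly y_gens) * (1 - gen_poly (w_gens D))) (1 - n%:R *: 'X + r%:R *: 'X^2).
Proof.
move=> D0 i iD; rewrite gen_poly_y mulrBl mul1r -scalerAl !(coefB, coefD, coefZ, coef1, coefX, coefXn, coefXM).
rewrite coef_gen_poly_w //; case: i iD => [|[|[|i]]] iD /=.
- by ring.
- by rewrite coef_gen_poly_w // size_map size_iota -pq_n natrD; ring.
- rewrite coef_gen_poly_w ?(ltnW iD) // (size_y_brackets 1) (size_y_brackets 0) muln1.
  by rewrite natrB // natrM -pq_n natrD; ring.
- rewrite coef_gen_poly_w ?(ltnW iD) // (size_y_brackets i.+2) (size_y_brackets i.+1).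
  by rewrite expnS !natrM; ring.
Qed.

(** The y's normalize the subalgebra of the [w_gens], so the two spanning families are concatenated.
    For the positivity clause: two y's already give elements in every degree, and if r < p q some
    iterated bracket survives in every degree. *)
Theorem bipartite_upper_bound D : (0 < D)%N -> exists B : seq (nat * T),
  [/\ forall d u, (d <= D)%N -> free_lie d u -> in_span (lie_ideal s) B d u,
      exp_inv D (1 - n%:R *: 'X + r%:R *: 'X^2) B
    & (1 < q)%N \/ (r < p * q)%N -> forall d, (0 < d <= D)%N -> (0 < deg_count d B)%N].
Proof.
move=> D0.
have wP w : w \in w_gens D -> (0 < w.1)%N /\ free_lie w.1 w.2.
  by case: w => d w /w_gensP[k _ [-> /y_brackets_deg[_ Fw]]].
have yP w : w \in y_gens -> (0 < w.1)%N /\ free_lie w.1 w.2.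
  by case/mapP=> b _ ->; split=> //; apply: FreeLieVar.
have [BW BWP] := span_elimination free_s D wP.
have [BY BYP Ypos] : exists2 B, elim_basis s D y_gens B &
    ((1 < q)%N -> forall d, (0 < d <= D)%N -> (0 < deg_count d B)%N).
  have [q1 | q2] := leqP q 1.
    by have [B BP] := span_elimination free_s D yP; exists B.
  have yE : y_gens = [:: (1%N, var p), (1%N, var p.+1) & [seq (1%N, var b) | b <- iota p.+2 (q - 2)]].
    by rewrite /y_gens -[q in iota p q](subnKC q2).
  have Fvar k : free_lie 1 (var k) by apply: FreeLieVar.
  have tlP e : e \in [seq (1%N, var b) | b <- iota p.+2 (q - 2)] -> (0 < e.1)%N /\ free_lie e.1 e.2.
    by case/mapP=> b _ ->; split=> //; apply: Fvar.
  rewrite yE; have [B BP Bpos] := span_elimination_pos free_s D (Fvar p) (Fvar p.+1) tlP.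
  by exists B.
have [_ YS Ye Yc] := BYP; have [_ WS We Wc] := BWP.
exists (BY ++ BW); split.
- move=> d u dD Fu.
  have yF e v : listed y_gens e v -> free_lie e v by case/yP.
  have wF e v : listed (w_gens D) e v -> free_lie e v by case/wP.
  have [a [b [ga gb ->]]] := elimination free_s yF wF (@y_normalizes D) dD (free_lie_generated dD D0 Fu).
  by apply: in_span_cat; [exact: lie_ideal_subspace | apply: YS | apply: WS].
- have := exp_inv_cat Ye We; rewrite /exp_inv => e.
  apply: eqmod_trans e; apply: eqmodMr; apply: eqmod_sym; exact: bipartite_series.
- move=> pos d dD; rewrite /deg_count count_cat addn_gt0; apply/orP.
  have [/Ypos/(_ d dD)|rpq] := pos; first by left.
  right; apply: leq_trans (Wc d _); last by case/andP: dD.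
  have : (0 < size (y_brackets d.-1))%N.
    rewrite size_y_brackets; case: d.-1 => [|k]; first by move: rpq; case: (p).
    by rewrite muln_gt0 subn_gt0 rpq expn_gt0 q_gt0.
  case yd: (y_brackets d.-1) => [|w l] // _; have wd : w \in y_brackets d.-1 by rewrite yd mem_head.
  rewrite -has_count; apply/hasP; exists w; last by have [-> _] := y_brackets_deg wd; lia.
  by apply: mem_w_gens wd; lia.
Qed.
End Bipartite.

(** * Quadrics without linear syzygies *)

(** Three adjoined elements. On variables they are new variables w0, w1, w2; on indices of quadrics
    they stand for the squares of these. *)
Definition ext3 (T : Type) : Type := option (option (option T)).
Local Notation old a := (Some (Some (Some a))).
Local Notation new0 := None (only parsing).
Local Notation new1 := (Some None) (only parsing).
Local Notation new2 := (Some (Some None)) (only parsing).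

Lemma big_option (V : nmodType) (T : finType) (F : option T -> V) :
  \sum_i F i = F None + \sum_i F (Some i).
Proof.
rewrite (bigD1 None) //=; congr (_ + _).
rewrite (reindex_omap Some id) /=; last by case.
by apply: eq_bigl => i; rewrite eqxx.
Qed.

Lemma big_ext3 (V : nmodType) (T : finType)
    (F : option (option (option T)) -> V) :
  \sum_i F i = F new0 + (F new1 + (F new2 + \sum_i F (old i))).
Proof. by rewrite !big_option. Qed.

Local Ltac ring_from H := rewrite -[RHS]H; ring.
Local Ltac solve_from H L :=
  have := H; rewrite ?L /=; let e := fresh in intro e; ring_from e.

Section LinearSyzygies.
Variable K : fieldType.
Implicit Types I P : finType.

Lemma mulf_eq0_r (c d : K) : c * d = 0 -> c != 0 -> d = 0.
Proof. by move/eqP; rewrite mulf_eq0 => /orP[/eqP->|/eqP//]; rewrite eqxx. Qed.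

Definition app I (f : I -> I -> K) (x : I -> K) : I -> K :=
  fun a => \sum_b f a b * x b.

(** The polynomial with terms Y a b v_a v_b vanishes. Grouping by commutative monomials instead of
    symmetrizing keeps this correct in characteristic 2; [cubic0] is the analogue in degree 3. *)
Definition quad0 I (Y : I -> I -> K) : Prop :=
  (forall a, Y a a = 0) /\ (forall a b, a != b -> Y a b + Y b a = 0).

Definition cubic0 I (Z : I -> I -> I -> K) : Prop :=
  [/\ forall a, Z a a a = 0,
      forall a b, a != b -> Z a a b + Z a b a + Z b a a = 0
    & forall a b c, a != b -> a != c -> b != c ->
        Z a b c + Z a c b + Z b a c + Z b c a + Z c a b + Z c b a = 0].

Definition no_linear_syzygy I P (B : P -> I -> I -> K) : Prop :=
  forall C : P -> I -> K,
    cubic0 (fun d a b => \sum_p C p d * B p a b) -> forall p d, C p d = 0.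

(** The part of a linear syzygy of the extended quadrics which is quadratic in the old variables and
    linear in w0, w1, w2. For (n + 1)(n + 2) / 6 quadrics the unknowns outnumber the equations by
    one, so a nonzero solution exists; the form [l] detects it, and the term l p w1 w2 added to the
    p-th quadric excludes it. *)
Definition mult_injective I P (B : P -> I -> I -> K) (f g : I -> I -> K)
    (l : P -> K) : Prop :=
  forall (X : I -> I -> K) (p0 p1 p2 : P -> K),
    quad0 (fun a c => X a c + \sum_p p0 p * B p a c) ->
    quad0 (fun a c => app f (X a) c + \sum_p p1 p * B p a c) ->
    quad0 (fun a c => app g (X a) c + \sum_p p2 p * B p a c) ->
    [/\ \sum_p p1 p * l p = 0, \sum_p p2 p * l p = 0
      & \sum_p p0 p * l p = 0 ->
        (forall a c, X a c = 0) /\ forall p, [/\ p0 p = 0, p1 p = 0 & p2 p = 0]].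

(** What remains to be invertible after eliminating unknowns in an extension step: the
    anticommutator comes from the coefficients of v_a w1 w2 in a syzygy, the other two from the
    mixed equations in [mixed_part_injective]. [tau] holds the parameters still available. *)
Record generic_pair I (f g : I -> I -> K) (tau : K -> Prop) : Prop := GenericPair {
  commutator_inj : forall x, (forall a, app f (app g x) a = app g (app f x) a) ->
    forall a, x a = 0;
  anticommutator_inj : forall x,
    (forall a, app f (app g x) a + app g (app f x) a = 0) -> forall a, x a = 0;
  spectrum : forall t, tau t -> forall x,
    (forall a, t * x a - app f (app f x) a + app f (app g x) a
               + app g (app f x) a = 0) -> forall a, x a = 0 }.

Lemma eq_app I (f : I -> I -> K) x y : x =1 y -> app f x =1 app f y.
Proof. by move=> e a; apply: eq_bigr => b _; rewrite e. Qed.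

Lemma appD I (f : I -> I -> K) x y a :
  app f (fun b => x b + y b) a = app f x a + app f y a.
Proof. by rewrite /app -big_split; apply: eq_bigr => b _; rewrite mulrDr. Qed.

Lemma appN I (f : I -> I -> K) x a : app f (fun b => - x b) a = - app f x a.
Proof. by rewrite /app -sumrN; apply: eq_bigr => b _; rewrite mulrN. Qed.

Lemma app0 I (f : I -> I -> K) x a : (forall b, x b = 0) -> app f x a = 0.
Proof. by move=> x0; rewrite /app big1 // => b _; rewrite x0 mulr0. Qed.

(* The equations say [m_jl + phi_j y_l + phi_l z_j = 0] for 0 <= j, l <= 2,
   where [phi_0 = 1], [phi_1 = f], [phi_2 = g] and
   [m_jl = sum_b theta_j[l, b] x_b]. *)
Lemma mixed_part_injective I (f g : I -> I -> K) (tau : K -> Prop) (t : K)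
    (x0 x1 x2 y0 y1 y2 z0 z1 z2 : I -> K) :
  generic_pair f g tau -> tau t ->
  (forall a, x0 a + y0 a + z0 a = 0) ->
  (forall a, x1 a + y1 a + app f z0 a = 0) ->
  (forall a, x2 a + y2 a + app g z0 a = 0) ->
  (forall a, - x1 a + app f y0 a + z1 a = 0) ->
  (forall a, x1 a + app f y1 a + app f z1 a = 0) ->
  (forall a, (t - 1) * x0 a + t * x1 a - x2 a + app f y2 a + app g z1 a = 0) ->
  (forall a, - x2 a + app g y0 a + z2 a = 0) ->
  (forall a, x0 a + (1 - t) * x1 a + x2 a + app g y1 a + app f z2 a = 0) ->
  (forall a, x2 a + app g y2 a + app g z2 a = 0) ->
  forall a, [/\ [/\ x0 a = 0, x1 a = 0 & x2 a = 0],
                [/\ y0 a = 0, y1 a = 0 & y2 a = 0] &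
                [/\ z0 a = 0, z1 a = 0 & z2 a = 0]].
Proof.
move=> [com _ spec] taut e00 e01 e02 e10 e11 e12 e20 e21 e22.
have z0E b : z0 b = - x0 b + - y0 b by apply/subr0_eq; ring_from (e00 b).
have appz0 h b : app h z0 b = - app h x0 b - app h y0 b.
  by rewrite (eq_app h z0E) appD !appN.
have y1E b : y1 b = - x1 b + (app f x0 b + app f y0 b).
  by apply/subr0_eq; rewrite -[RHS](e01 b) appz0; ring.
have y2E b : y2 b = - x2 b + (app g x0 b + app g y0 b).
  by apply/subr0_eq; rewrite -[RHS](e02 b) appz0; ring.
have z1E b : z1 b = x1 b + - app f y0 b.
  by apply/subr0_eq; ring_from (e10 b).
have z2E b : z2 b = x2 b + - app g y0 b.
  by apply/subr0_eq; ring_from (e20 b).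
have appy1 h b : app h y1 b = - app h x1 b + (app h (app f x0) b + app h (app f y0) b).
  by rewrite (eq_app h y1E) appD appN appD.
have appy2 h b : app h y2 b = - app h x2 b + (app h (app g x0) b + app h (app g y0) b).
  by rewrite (eq_app h y2E) appD appN appD.
have appz1 h b : app h z1 b = app h x1 b - app h (app f y0) b.
  by rewrite (eq_app h z1E) appD appN.
have appz2 h b : app h z2 b = app h x2 b - app h (app g y0) b.
  by rewrite (eq_app h z2E) appD appN.
have x1E b : x1 b = - app f (app f x0) b.
  by apply/subr0_eq; rewrite -[RHS](e11 b) appy1 appz1; ring.
have x2E b : x2 b = - app g (app g x0) b.
  by apply/subr0_eq; rewrite -[RHS](e22 b) appy2 appz2; ring.
(* In the sum of [e12] and [e21] the terms in x2 and y0 cancel; as x1 = - f^2 x0, there remains t x0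
   - f^2 x0 + f g x0 + g f x0 = 0. *)
have x00 : forall b, x0 b = 0.
  apply: (spec t taut) => b.
  have := congr2 +%R (e12 b) (e21 b); rewrite addr0 => <-.
  by rewrite appy2 appz1 appy1 appz2 (x1E b); ring.
have x10 b : x1 b = 0 by rewrite x1E app0 ?oppr0 // => c; rewrite app0.
have x20 b : x2 b = 0 by rewrite x2E app0 ?oppr0 // => c; rewrite app0.
(* With the x's equal to zero, [e21] says that f g y0 = g f y0. *)
have y00 : forall b, y0 b = 0.
  apply: com => b; apply/esym/subr0_eq; rewrite -[RHS](e21 b) appy1 appz2 x00 x10 x20.
  rewrite (app0 g b x10) (app0 f b x20) (@app0 _ g (app f x0)) => [|c]; last exact: app0.
  by ring.
move=> a; split; split=> //.
- by rewrite y1E x10 !app0 // oppr0 !addr0.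
- by rewrite y2E x20 !app0 // oppr0 !addr0.
- by rewrite z0E x00 y00 oppr0 addr0.
- by rewrite z1E x10 app0 // oppr0 addr0.
- by rewrite z2E x20 app0 // oppr0 addr0.
Qed.

Section Extension.
Variables (I P : finType) (B : P -> I -> I -> K) (f g : I -> I -> K).
Variables (l : P -> K) (t : K).

(** The quadrics B_p + l_p w1 w2 for each old p, v_e w0 + f(v_e) w1 + g(v_e) w2 for each old
    variable v_e, and the squares of w0, w1, w2: m + n + 3 quadrics in n + 3 variables. *)
Definition ext_rel (p : ext3 (P + I)) (a b : ext3 I) : K :=
  match p, a, b with
  | old (inl p), old a, old b => B p a b
  | old (inl p), new1, new2 => l p
  | old (inr e), old a, new0 => (a == e)%:R
  | old (inr e), old a, new1 => f a e
  | old (inr e), old a, new2 => g a e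
  | new0, new0, new0 => 1
  | new1, new1, new1 => 1
  | new2, new2, new2 => 1
  | _, _, _ => 0
  end.

(** [ext_f] and [ext_g] extend f and g by 3 x 3 blocks F and G. They are chosen so that F^2 - F G -
    G F is triangular with eigenvalues t, t, 2: a later parameter only has to differ from t and
    2. *)
Definition ext_f (a b : ext3 I) : K :=
  match a, b with
  | old a, old b => f a b
  | new0, new1 => -1
  | new1, new1 => 1
  | new2, new0 => t - 1
  | new2, new1 => t
  | new2, new2 => -1
  | _, _ => 0
  end.

Definition ext_g (a b : ext3 I) : K :=
  match a, b with
  | old a, old b => g a b
  | new0, new2 => -1
  | new1, new0 => 1
  | new1, new1 => 1 - t
  | new1, new2 => 1
  | new2, new2 => 1
  | _, _ => 0
  end.

Definition ext_form (p : ext3 (P + I)) : K := if p is old (inl p) then l p else 0.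

Lemma app_ext_f x c : app ext_f x c =
  match c with
  | old a => app f (fun b => x (old b)) a
  | new0 => - x new1
  | new1 => x new1
  | new2 => (t - 1) * x new0 + t * x new1 - x new2
  end.
Proof.
have sum0 (F : I -> K) : \sum_i 0 * F i = 0.
  by rewrite big1 // => i _; rewrite mul0r.
by rewrite /app big_ext3; case: c => [[[a|]|]|] /=; rewrite ?sum0; ring.
Qed.

Lemma app_ext_g x c : app ext_g x c =
  match c with
  | old a => app g (fun b => x (old b)) a
  | new0 => - x new2
  | new1 => x new0 + (1 - t) * x new1 + x new2
  | new2 => x new2
  end.
Proof.
have sum0 (F : I -> K) : \sum_i 0 * F i = 0.
  by rewrite big1 // => i _; rewrite mul0r.
by rewrite /app big_ext3; case: c => [[[a|]|]|] /=; rewrite ?sum0; ring.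
Qed.

Lemma sum_ext_rel (C : ext3 (P + I) -> K) (a b : ext3 I) :
  \sum_p C p * ext_rel p a b =
  match a, b with
  | old a, old b => \sum_p C (old (inl p)) * B p a b
  | old a, new0 => C (old (inr a))
  | old a, new1 => app f (fun e => C (old (inr e))) a
  | old a, new2 => app g (fun e => C (old (inr e))) a
  | new0, new0 => C new0
  | new1, new1 => C new1
  | new2, new2 => C new2
  | new1, new2 => \sum_p C (old (inl p)) * l p
  | _, _ => 0
  end.
Proof.
have sum0 (T : finType) (F : T -> K) : \sum_i F i * 0 = 0.
  by rewrite big1 // => i _; rewrite mulr0.
rewrite big_ext3 big_sumType.
case: a => [[[a|]|]|]; case: b => [[[b|]|]|] /=; rewrite ?sum0; try ring.
- by rewrite !mulr0 !add0r; apply: eq_bigr => e _; rewrite mulrC.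
- by rewrite !mulr0 !add0r; apply: eq_bigr => e _; rewrite mulrC.
- rewrite !mulr0 !add0r (bigD1 a) //= eqxx mulr1 big1 ?addr0 // => e.
  by rewrite eq_sym => /negPf ->; rewrite mulr0.
Qed.

(** The old and new blocks decouple. On the new one the commutator and anticommutator are inverted
    by dividing by [t], and the spectral condition by dividing by [s - t] and [s - 2]. *)
Lemma ext_generic_pair (tau tau' : K -> Prop) :
  generic_pair f g tau -> t != 0 ->
  (forall s, tau' s -> [/\ tau s, s != t & s != 2]) ->
  generic_pair ext_f ext_g tau'.
Proof.
move=> [com acom spec] t0 tau'P.
split.
- move=> x H.
  have Ho a : x (old a) = 0.
    apply: (com (fun b => x (old b))) => {}a; have := H (old a).
    by rewrite app_ext_f app_ext_g (eq_app f (fun b => app_ext_g x (old b)))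
               (eq_app g (fun b => app_ext_f x (old b))).
  move: (H new0) (H new1) (H new2); rewrite !(app_ext_f, app_ext_g).
  move=> /eqP; rewrite -subr_eq0 => /eqP H0 /eqP; rewrite -subr_eq0 => /eqP H1 /eqP.
  rewrite -subr_eq0 => /eqP H2.
  have x1 : x new1 = 0.
    by have := congr2 +%R H0 H1; rewrite addr0 => e; apply: (@mulf_eq0_r t) => //; rewrite -e; ring.
  have x0 : x new0 = 0.
    have := congr2 (fun y z => y + 2 * z) H0 H2; rewrite /= mulr0 addr0 x1 => e.
    by apply: (@mulf_eq0_r t) => //; rewrite -e; ring.
  have x2 : x new2 = 0.
    by move: H2; rewrite x1 x0 => <-; ring.
  by case=> [[[a|]|]|].
- move=> x H.
  have Ho a : x (old a) = 0.
    apply: (acom (fun b => x (old b))) => {}a; have := H (old a).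
    by rewrite app_ext_f app_ext_g (eq_app f (fun b => app_ext_g x (old b)))
               (eq_app g (fun b => app_ext_f x (old b))).
  move: (H new0) (H new1) (H new2); rewrite !(app_ext_f, app_ext_g).
  move=> H0 H1 H2.
  have x1 : x new1 = 0.
    have := congr2 +%R H0 H1; rewrite addr0 => e.
    by apply: (@mulf_eq0_r t) => //; apply: oppr_inj; rewrite oppr0 -e; ring.
  have x0 : x new0 = 0.
    by apply: (@mulf_eq0_r t) => //; apply: oppr_inj; rewrite oppr0 -H0 x1; ring.
  have x2 : x new2 = 0.
    by apply: oppr_inj; rewrite oppr0; move: H2; rewrite x1 x0 => <-; ring.
  by case=> [[[a|]|]|].
- move=> s /tau'P[taus st s2] x H.
  have Ho a : x (old a) = 0.
    apply: (spec s taus (fun b => x (old b))) => {}a; have := H (old a).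
    rewrite !(app_ext_f, app_ext_g) (eq_app f (fun b => app_ext_g x (old b))).
    by rewrite (eq_app g (fun b => app_ext_f x (old b)))
               (eq_app f (fun b => app_ext_f x (old b))).
  move: (H new0) (H new1) (H new2); rewrite !(app_ext_f, app_ext_g).
  move=> H0 H1 H2.
  have x0 : x new0 = 0.
    by apply: (@mulf_eq0_r (s - t)); rewrite ?subr_eq0 // -H0; ring.
  have x1 : x new1 = 0.
    by apply: (@mulf_eq0_r (s - t)); rewrite ?subr_eq0 // -H1 x0; ring.
  have x2 : x new2 = 0.
    by apply: (@mulf_eq0_r (s - 2)); rewrite ?subr_eq0 // -H2 x0 x1; ring.
  by case=> [[[a|]|]|].
Qed.

(** The cubic relation is sorted by its degree in w0, w1, w2: degree 0 is a syzygy of [B], degree 1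
    is the situation of [mult_injective], degree 2 reduces to the anticommutator, and degree 3 is
    read off directly. *)
Lemma ext_no_linear_syzygy tau : generic_pair f g tau ->
  no_linear_syzygy B -> mult_injective B f g l -> no_linear_syzygy ext_rel.
Proof.
move=> [com acom spec] synB injB C [Z1 Z2 Z3].
have C_oo p d : C (old (inl p)) (old d) = 0.
  apply: (synB (fun p d => C (old (inl p)) (old d))); split.
  - by move=> a; have := Z1 (old a); rewrite sum_ext_rel.
  - by move=> a b ab; have := Z2 (old a) (old b) ab; rewrite !sum_ext_rel.
  - by move=> a b c ab ac bc; have := Z3 (old a) (old b) (old c) ab ac bc; rewrite !sum_ext_rel.
pose X a e := C (old (inr e)) (old a).
pose p0 p := C (old (inl p)) new0.
pose p1 p := C (old (inl p)) new1.
pose p2 p := C (old (inl p)) new2.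
have [] := injB X p0 p1 p2.
- split=> [a|a b ab].
    by have := Z2 (old a) new0 isT; rewrite !sum_ext_rel /X /p0 => e; ring_from e.
  by have := Z3 (old a) (old b) new0 ab isT isT; rewrite !sum_ext_rel /X /p0 => e; ring_from e.
- split=> [a|a b ab].
    by have := Z2 (old a) new1 isT; rewrite !sum_ext_rel /X /p1 => e; ring_from e.
  by have := Z3 (old a) (old b) new1 ab isT isT; rewrite !sum_ext_rel /X /p1 => e; ring_from e.
- split=> [a|a b ab].
    by have := Z2 (old a) new2 isT; rewrite !sum_ext_rel /X /p2 => e; ring_from e.
  by have := Z3 (old a) (old b) new2 ab isT isT; rewrite !sum_ext_rel /X /p2 => e; ring_from e.
move=> lp1 lp2 injB0.
pose y0 e := C (old (inr e)) new0.
pose y1 e := C (old (inr e)) new1.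
pose y2 e := C (old (inr e)) new2.
have y1E a : y1 a = - app f y0 a.
  by apply/subr0_eq; have := Z3 (old a) new0 new1 isT isT isT; rewrite !sum_ext_rel => eZ; rewrite -[RHS]eZ /y0 /y1; ring.
have y2E a : y2 a = - app g y0 a.
  by apply/subr0_eq; have := Z3 (old a) new0 new2 isT isT isT; rewrite !sum_ext_rel => eZ; rewrite -[RHS]eZ /y0 /y2; ring.
have y00 : forall a, y0 a = 0.
  apply: acom => a; have := Z3 (old a) new1 new2 isT isT isT; rewrite !sum_ext_rel => e.
  apply: oppr_inj; rewrite oppr0 -[RHS]e big1 => [|p _]; last by rewrite C_oo mul0r.
  by rewrite (eq_app f y2E) (eq_app g y1E) !appN; ring.
have y10 a : y1 a = 0 by rewrite y1E app0 ?oppr0.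
have y20 a : y2 a = 0 by rewrite y2E app0 ?oppr0.
(* The coefficient of w0 w1 w2 is the value of [l] on [p0]. *)
have [|X0 pp0] := injB0.
  solve_from (Z3 new0 new1 new2 isT isT isT) sum_ext_rel.
have C_n k a : [\/ k = new0, k = new1 | k = new2] -> C k (old a) = 0.
  case=> ->.
  - have := Z2 new0 (old a) isT; rewrite !sum_ext_rel -/(y0 a) y00 => e.
    by ring_from e.
  - have := Z2 new1 (old a) isT; rewrite !sum_ext_rel -/y1 app0 // => e.
    by ring_from e.
  - have := Z2 new2 (old a) isT; rewrite !sum_ext_rel -/y2 app0 // => e.
    by ring_from e.
have C_nn k m : [\/ k = new0, k = new1 | k = new2] ->
    [\/ m = new0, m = new1 | m = new2] -> C k m = 0.
  case=> -> [] ->.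
  - by have := Z1 new0; rewrite !sum_ext_rel.
  - solve_from (Z2 new0 new1 isT) sum_ext_rel.
  - solve_from (Z2 new0 new2 isT) sum_ext_rel.
  - solve_from (Z2 new1 new0 isT) sum_ext_rel.
  - by have := Z1 new1; rewrite !sum_ext_rel.
  - solve_from (Z2 new1 new2 isT) (sum_ext_rel, lp1).
  - solve_from (Z2 new2 new0 isT) sum_ext_rel.
  - solve_from (Z2 new2 new1 isT) (sum_ext_rel, lp2).
  - by have := Z1 new2; rewrite !sum_ext_rel.
case=> [[[[p|e]|]|]|] [[[a|]|]|] //=.
all: try by apply: C_n; first [exact: Or31 | exact: Or32 | exact: Or33].
all: try by apply: C_nn; first [exact: Or31 | exact: Or32 | exact: Or33].
all: try by [exact: C_oo | have [] := pp0 p].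
- exact: X0.
- exact: y20.
- exact: y10.
- exact: y00.
Qed.

(** [X] is cut into blocks: old-old is the hypothesis, old-new is [mixed_part_injective] with the
    current parameter [t], and new-new is solved by hand, where the squares of the w's absorb the
    diagonal equations. *)
Lemma ext_mult_injective (tau : K -> Prop) : generic_pair f g tau -> tau t -> t != 0 ->
  mult_injective B f g l -> mult_injective ext_rel ext_f ext_g ext_form.
Proof.
move=> gen taut t0 injB X p0 p1 p2 [A0 B0] [A1 B1] [A2 B2].
have sum_form (p : ext3 (P + I) -> K) :
    \sum_q p q * ext_form q = \sum_q p (old (inl q)) * l q.
  rewrite big_ext3 big_sumType /= !mulr0 !add0r [X in _ + X]big1 ?addr0 // => i _.
  by rewrite mulr0.
rewrite !sum_form.
have [] := injB (fun a c => X (old a) (old c)) (fun p => p0 (old (inl p)))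
  (fun p => p1 (old (inl p))) (fun p => p2 (old (inl p))).
- split=> [a|a b ab].
    by have := A0 (old a); rewrite sum_ext_rel.
  by have := B0 (old a) (old b) ab; rewrite !sum_ext_rel.
- split=> [a|a b ab].
    by have := A1 (old a); rewrite sum_ext_rel app_ext_f.
  by have := B1 (old a) (old b) ab; rewrite !sum_ext_rel !app_ext_f.
- split=> [a|a b ab].
    by have := A2 (old a); rewrite sum_ext_rel app_ext_g.
  by have := B2 (old a) (old b) ab; rewrite !sum_ext_rel !app_ext_g.
move=> lp1 lp2 injB0; split=> // lp0.
have [Xo po] := injB0 lp0.
have mixed := mixed_part_injective (x0 := fun a => X (old a) new0)
  (x1 := fun a => X (old a) new1) (x2 := fun a => X (old a) new2)
  (y0 := fun a => X new0 (old a)) (y1 := fun a => X new1 (old a))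
  (y2 := fun a => X new2 (old a)) (z0 := fun a => p0 (old (inr a)))
  (z1 := fun a => p1 (old (inr a))) (z2 := fun a => p2 (old (inr a))) gen taut.
have {}mixed : forall a, [/\ [/\ X (old a) new0 = 0, X (old a) new1 = 0 & X (old a) new2 = 0],
    [/\ X new0 (old a) = 0, X new1 (old a) = 0 & X new2 (old a) = 0]
  & [/\ p0 (old (inr a)) = 0, p1 (old (inr a)) = 0 & p2 (old (inr a)) = 0]].
  apply: mixed => a.
  - solve_from (B0 (old a) new0 isT) sum_ext_rel.
  - solve_from (B0 (old a) new1 isT) sum_ext_rel.
  - solve_from (B0 (old a) new2 isT) sum_ext_rel.
  - solve_from (B1 (old a) new0 isT) (sum_ext_rel, app_ext_f).
  - solve_from (B1 (old a) new1 isT) (sum_ext_rel, app_ext_f).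
  - solve_from (B1 (old a) new2 isT) (sum_ext_rel, app_ext_f).
  - solve_from (B2 (old a) new0 isT) (sum_ext_rel, app_ext_g).
  - solve_from (B2 (old a) new1 isT) (sum_ext_rel, app_ext_g).
  - solve_from (B2 (old a) new2 isT) (sum_ext_rel, app_ext_g).
have e10 : X new1 new0 = - X new0 new1.
  by apply/subr0_eq; solve_from (B0 new0 new1 isT) sum_ext_rel.
have e20 : X new2 new0 = - X new0 new2.
  by apply/subr0_eq; solve_from (B0 new0 new2 isT) sum_ext_rel.
have e21 : X new2 new1 = - X new1 new2.
  by apply/subr0_eq; solve_from (B0 new1 new2 isT) (sum_ext_rel, lp0).
have e11 : X new1 new1 = X new0 new1.
  by apply/esym/subr0_eq; solve_from (B1 new0 new1 isT) (sum_ext_rel, app_ext_f).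
have e22 : X new2 new2 = X new0 new2.
  by apply/esym/subr0_eq; solve_from (B2 new0 new2 isT) (sum_ext_rel, app_ext_g).
have x12 : X new1 new2 = 0.
  apply: (@mulf_eq0_r t) => //; have := B2 new1 new2 isT; rewrite !(sum_ext_rel, app_ext_g) lp2.
  by rewrite e20 e21 e22 => e; ring_from e.
have x01 : X new0 new1 = 0.
  solve_from (B1 new1 new2 isT) (sum_ext_rel, app_ext_f, lp1, e10, e11, e21, x12).
have e00 : X new0 new0 = - X new0 new2.
  apply/subr0_eq; solve_from (B2 new0 new1 isT) (sum_ext_rel, app_ext_g, x01, x12).
have x02 : X new0 new2 = 0.
  apply: (@mulf_eq0_r t) => //; apply: oppr_inj; rewrite oppr0.
  solve_from (B1 new0 new2 isT) (sum_ext_rel, app_ext_f, e00, e21, x01, x12).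
have X0 a c : X a c = 0.
  case: a c => [[[a|]|]|] [[[c|]|]|].
  all: try by have [[? ? ?] [? ? ?] _] := mixed a.
  all: try by have [[? ? ?] [? ? ?] _] := mixed c.
  all: rewrite ?Xo ?e00 ?e10 ?e11 ?e20 ?e21 ?e22 ?x01 ?x02 ?x12 ?oppr0 //.
split=> // p.
have q0 a : \sum_q p0 q * ext_rel q a a = 0 by rewrite -[RHS](A0 a) X0 add0r.
have q1 a : \sum_q p1 q * ext_rel q a a = 0.
  by rewrite -[RHS](A1 a) app0 ?add0r.
have q2 a : \sum_q p2 q * ext_rel q a a = 0.
  by rewrite -[RHS](A2 a) app0 ?add0r.
case: p => [[[[p|e]|]|]|].
- by have [_ /(_ p)] := injB0 lp0.
- by have [_ _ []] := mixed e.
- by split; [have := q0 new2|have := q1 new2|have := q2 new2]; rewrite sum_ext_rel.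
- by split; [have := q0 new1|have := q1 new1|have := q2 new1]; rewrite sum_ext_rel.
- by split; [have := q0 new0|have := q1 new0|have := q2 new0]; rewrite sum_ext_rel.
Qed.
End Extension.

(* two variables and the quadrics v0^2, v1^2 *)
Lemma base2_exists (tau : K -> Prop) :
  (forall t, tau t -> t != 0 /\ t != 2) ->
  exists B : option (option void) -> option (option void) -> option (option void) -> K,
  exists f g : option (option void) -> option (option void) -> K,
  exists l : option (option void) -> K,
  [/\ no_linear_syzygy B, mult_injective B f g l & generic_pair f g tau].
Proof.
move=> tauP.
pose v0 : option (option void) := None; pose v1 : option (option void) := Some None.
pose B (p a b : option (option void)) : K := ((a == p) && (b == p))%:R.
(* [f] swaps the two variables and [g] projects on the second; t - f^2 + f g + g f then has
   determinant t (t - 2). *)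
pose f (a b : option (option void)) : K := (a != b)%:R.
pose g (a b : option (option void)) : K := ((a == v1) && (b == v1))%:R.
pose l (p : option (option void)) : K := (p == v0)%:R.
have big2 (F : option (option void) -> K) : \sum_i F i = F v0 + F v1.
  by rewrite !big_option [X in _ + (_ + X)]big1 ?addr0 // => -[].
have sumB p a b : \sum_q p q * B q a b = if a == b then p a else 0.
  by rewrite big2 /B; case: a => [[[]|]|]; case: b => [[[]|]|] /=; ring.
have appf x a : app f x a = if a is None then x v1 else x v0.
  by rewrite /app big2 /f; case: a => [[[]|]|] /=; ring.
have appg x a : app g x a = if a is None then 0 else x v1.
  by rewrite /app big2 /g; case: a => [[[]|]|] /=; ring.
exists B, f, g, l; split.
- move=> C [Z1 Z2 _] p d; case: (altP (p =P d)) => [<-|pd].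
    by have := Z1 p; rewrite sumB eqxx.
  have := Z2 p d pd; rewrite !sumB eqxx (negPf pd) eq_sym (negPf pd) => e.
  by ring_from e.
- move=> X p0 p1 p2 [A0 B0] [A1 B1] [A2 B2].
  move: (A0 v0) (A0 v1) (B0 v0 v1 isT) (A1 v0) (A1 v1) (B1 v0 v1 isT) (A2 v0) (A2 v1) (B2 v0 v1 isT).
  rewrite !sumB !appf !appg !big2 /= !addr0 ?add0r /l /= !mulr1 !mulr0 !addr0.
  move=> e00 e01 e02 e10 e11 e12 e20 e21 e22.
  have x10 : X v1 v0 = 0 by move: e02; rewrite e22 add0r.
  move: e10 e11; rewrite e22 x10 !add0r => p10 p11; split=> //.
  move=> p00; move: e00; rewrite p00 addr0 => x00.
  have x11 : X v1 v1 = 0 by move: e12; rewrite x00 add0r.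
  move: e01 e21; rewrite x11 !add0r => p01 p21.
  by split; [case=> [[[]|]|] [[[]|]|] | case=> [[[]|]|]].
split.
- move=> x H; move: (H v0) (H v1); rewrite !(appf, appg) /= => x1 x0.
  by case=> [[[]|]|].
- move=> x H; move: (H v0) (H v1); rewrite !(appf, appg) /= add0r addr0 => x1 x0.
  by case=> [[[]|]|].
- move=> t /tauP[t0 t2] x H; move: (H v0) (H v1); rewrite !(appf, appg) /= => e0 e1.
  have x0 : x v0 = 0.
    apply: (@mulf_eq0_r (t - 2)); rewrite ?subr_eq0 //; apply: (@mulf_eq0_r t) => //.
    have := congr2 (fun y z => (t - 1) * y - z) e0 e1; rewrite /= mulr0 subr0 => e.
    by ring_from e.
  have x1 : x v1 = 0 by rewrite -[RHS]e0 x0; ring.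
  by case=> [[[]|]|].
Qed.

(* four variables and the quadrics v0^2, v1^2, v2^2, v3^2, v0 v3 + v1 v2 *)
Lemma base4_exists (tau : K -> Prop) :
  (forall t, tau t -> [/\ t != 0, t != 1 & t != -1]) ->
  let I := option (option (option (option void))) in
  exists B : option I -> I -> I -> K, exists f g : I -> I -> K, exists l : option I -> K,
  [/\ no_linear_syzygy B, mult_injective B f g l & generic_pair f g tau].
Proof.
move=> tauP I.
pose v0 : I := None; pose v1 : I := Some None.
pose v2 : I := Some (Some None); pose v3 : I := Some (Some (Some None)).
pose B (p : option I) (a b : I) : K :=
  if p is Some p then ((a == p) && (b == p))%:R
  else (((a == v0) && (b == v3)) || ((a == v1) && (b == v2)))%:R.
pose f (a b : I) : K :=
  (((a == v3) && (b == v1)) || ((a == v0) && (b == v2)))%:R.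
pose g (a b : I) : K :=
  (((a == v1) && (b == v0)) || ((a == v2) && (b == v3)))%:R - ((a == v2) && (b == v2))%:R.
pose l (p : option I) : K := (p == Some v3)%:R.
have big4 (F : I -> K) : \sum_i F i = F v0 + (F v1 + (F v2 + F v3)).
  by rewrite !big_option [X in _ + (_ + (_ + (_ + X)))]big1 ?addr0 // => -[].
have sumB p a b : \sum_q p q * B q a b =
    if a == b then p (Some a)
    else if ((a == v0) && (b == v3)) || ((a == v1) && (b == v2)) then p None else 0.
  rewrite big_option big4 /B.
  by case: a => [[[[[]|]|]|]|]; case: b => [[[[[]|]|]|]|] /=; ring.
have appf x a : app f x a = if a == v3 then x v1 else if a == v0 then x v2 else 0.
  by rewrite /app big4 /f; case: a => [[[[[]|]|]|]|] /=; ring.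
have appg x a : app g x a = if a == v1 then x v0 else if a == v2 then x v3 - x v2 else 0.
  by rewrite /app big4 /g; case: a => [[[[[]|]|]|]|] /=; ring.
exists B, f, g, l; split.
- move=> C [Z1 Z2 Z3].
  have n0 : C None v0 = 0 by solve_from (Z3 v0 v1 v2 isT isT isT) sumB.
  have n1 : C None v1 = 0 by solve_from (Z3 v0 v1 v3 isT isT isT) sumB.
  have n2 : C None v2 = 0 by solve_from (Z3 v0 v2 v3 isT isT isT) sumB.
  have n3 : C None v3 = 0 by solve_from (Z3 v1 v2 v3 isT isT isT) sumB.
  have n d : C None d = 0 by case: d => [[[[[]|]|]|]|].
  case=> [p|] // d; case: (altP (p =P d)) => [<-|pd].
    by have := Z1 p; rewrite sumB eqxx.
  have dp : (d == p) = false by rewrite eq_sym; apply: negPf.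
  have := Z2 p d pd; rewrite !sumB eqxx (negPf pd) dp !n !if_same => e.
  by ring_from e.
- move=> X p0 p1 p2 [A0 B0] [A1 B1] [A2 B2].
  have e12 : p1 None = 0 by solve_from (B1 v1 v2 isT) (sumB, appf).
  have e03 : p2 None = 0 by solve_from (B2 v0 v3 isT) (sumB, appg).
  have x12 : X v1 v2 = 0 by solve_from (B1 v0 v1 isT) (sumB, appf).
  have x22 : X v2 v2 = 0 by solve_from (B1 v0 v2 isT) (sumB, appf).
  have x11 : X v1 v1 = 0 by solve_from (B1 v1 v3 isT) (sumB, appf).
  have x21 : X v2 v1 = 0 by solve_from (B1 v2 v3 isT) (sumB, appf).
  have x00 : X v0 v0 = 0 by solve_from (B2 v0 v1 isT) (sumB, appg).
  have x30 : X v3 v0 = 0 by solve_from (B2 v1 v3 isT) (sumB, appg).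
  have p0n : p0 None = 0 by solve_from (B0 v1 v2 isT) (sumB, x12, x21).
  have x03 : X v0 v3 = 0 by solve_from (B0 v0 v3 isT) (sumB, x30, p0n).
  have x02 : X v0 v2 = 0.
    apply: oppr_inj; rewrite oppr0.
    solve_from (B2 v0 v2 isT) (sumB, appg, x03).
  have x20 : X v2 v0 = 0 by solve_from (B0 v0 v2 isT) (sumB, x02).
  have x13 : X v1 v3 = 0 by solve_from (B2 v1 v2 isT) (sumB, appg, x12, x20, e03).
  have x31 : X v3 v1 = 0 by solve_from (B0 v1 v3 isT) (sumB, x13).
  have d0 a : p0 (Some a) = - X a a.
    by apply/subr0_eq; have := A0 a; rewrite sumB eqxx => e; ring_from e.
  have d1 a : p1 (Some a) = - app f (X a) a.
    by apply/subr0_eq; have := A1 a; rewrite sumB eqxx => e; ring_from e.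
  have d2 a : p2 (Some a) = - app g (X a) a.
    by apply/subr0_eq; have := A2 a; rewrite sumB eqxx => e; ring_from e.
  have suml p : \sum_q p q * l q = p (Some v3).
    by rewrite big_option big4 /l /=; ring.
  rewrite !suml d0 d1 d2 !(appf, appg) /= x31 !oppr0; split=> // /eqP.
  rewrite oppr_eq0 => /eqP x33.
  have x32 : X v3 v2 = 0.
    apply: oppr_inj; rewrite oppr0.
    solve_from (B2 v2 v3 isT) (sumB, appg, x33).
  have x23 : X v2 v3 = 0 by solve_from (B0 v2 v3 isT) (sumB, x32).
  have x01 : X v0 v1 = 0 by solve_from (B1 v0 v3 isT) (sumB, appf, x32, e12).
  have x10 : X v1 v0 = 0 by solve_from (B0 v0 v1 isT) (sumB, x01).
  have X0 a c : X a c = 0 by case: a => [[[[[]|]|]|]|]; case: c => [[[[[]|]|]|]|].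
  split=> // -[p|]; last by [].
  by rewrite d0 d1 d2 !app0 ?X0 ?oppr0.
split.
- move=> x H; move: (H v0) (H v1) (H v2) (H v3); rewrite !(appf, appg) /=.
  rewrite subr0 => h0 h1 h2 h3.
  have x1 : x v1 = 0 by rewrite -h2.
  have x2 : x v2 = 0 by rewrite -h1.
  have x3 : x v3 = 0 by apply/subr0_eq; rewrite -[RHS]h0 x2; ring.
  by case=> [[[[[]|]|]|]|].
- move=> x H; move: (H v0) (H v1) (H v2) (H v3); rewrite !(appf, appg) /=.
  rewrite !addr0 !add0r subr0 => h0 h1 h2 h3.
  have x3 : x v3 = 0 by rewrite -[RHS]h0 h1 subr0.
  by case=> [[[[[]|]|]|]|].
move=> t /tauP[t0 t1 tN1] x H.
move: (H v0) (H v1) (H v2) (H v3); rewrite !(appf, appg) /=.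
move=> h0 h1 h2 h3.
(* Here f^2 = 0, and t + f g + g f is block triangular with two diagonal blocks of determinant t^2 -
   1. *)
have scal c : (t ^+ 2 - 1) * c = 0 -> c = 0.
  rewrite -[1](expr1n _ 2) subr_sqr => /eqP; rewrite !mulf_eq0 subr_eq0 addr_eq0.
  by rewrite (negPf t1) (negPf tN1) => /eqP.
have lin (y z w : K) : y = 0 -> z = 0 -> w = t * y - z -> w = 0.
  by move=> -> -> ->; ring.
have x1 : x v1 = 0.
  by apply: scal; apply: (lin _ _ _ h1 h2); ring.
have x2 : x v2 = 0.
  by rewrite -[RHS]h1 x1; ring.
have x3 : x v3 = 0.
  by apply: scal; apply: (lin _ _ _ h3 h0); rewrite x2; ring.
have x0 : x v0 = 0.
  by rewrite -[RHS]h3 x3; ring.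
by case=> [[[[[]|]|]|]|].
Qed.

(** By computation [optn n.+3] is [ext3 (optn n)], so an extension step needs no reindexing. *)
Fixpoint optn (n : nat) : finType := if n is m.+1 then option (optn m) else void.

Lemma card_optn n : #|optn n| = n.
Proof. by elim: n => [|n IHn] /=; [apply: card_void | rewrite card_option IHn]. Qed.

Section Induction.
Variable tau : nat -> K.
Hypotheses (tau_inj : injective tau) (tau_neq0 : forall i, tau i != 0).
Hypotheses (tau_neq1 : forall i, tau i != 1) (tau_neqN1 : forall i, tau i != -1).
Hypothesis tau_neq2 : forall i, tau i != 2.

Definition later k (t : K) : Prop := exists2 i, (k <= i)%N & t = tau i.

Definition syzygy_free_stage k n m : Prop :=
  exists P : finType, exists B : P -> optn n -> optn n -> K,
  exists f g : optn n -> optn n -> K, exists l : P -> K,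
  [/\ #|P| = m, no_linear_syzygy B, mult_injective B f g l
    & generic_pair f g (later k)].

(** The k-th step spends [tau k]; the later values differ from it and from 2, as [ext_generic_pair]
    requires. *)
Lemma stage_step k n m :
  syzygy_free_stage k n m -> syzygy_free_stage k.+1 n.+3 (m + n + 3).
Proof.
case=> P [B [f [g [l [cardP synB injB gen]]]]].
have tk : later k (tau k) by exists k.
exists (option (option (option (P + optn n))%type)), (ext_rel B f g l).
exists (ext_f f (tau k)), (ext_g g (tau k)), (ext_form (I := optn n) l); split.
- by rewrite !card_option card_sum cardP card_optn !addnS addn0.
- exact: ext_no_linear_syzygy gen synB injB.
- exact: ext_mult_injective gen tk (tau_neq0 k) injB.
- apply: (ext_generic_pair gen) => // s [i ki ->]; split=> //.
    by exists i => //; apply: ltnW.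
  by rewrite (inj_eq tau_inj) gtn_eqF.
Qed.

Lemma stage0 : syzygy_free_stage 0 0 0.
Proof.
exists void, (fun p _ _ => match p : void with end).
exists (fun a _ => match a : void with end), (fun a _ => match a : void with end).
exists (fun p => match p : void with end).
split; [exact: card_void | by move=> ? _ [] | | by split=> [? _ []|? _ []|? _ ? _ []]].
move=> X p0 p1 p2 _ _ _; split=> [||_]; try by rewrite big1 // => -[].
by split; case.
Qed.

Lemma stage2 : syzygy_free_stage 0 2 2.
Proof.
have [t [i _ ->]|B [f [g [l [synB injB gen]]]]] := @base2_exists (later 0).
  by split.
exists (optn 2), B, f, g, l; split=> //; exact: card_optn.
Qed.

Lemma stage4 : syzygy_free_stage 0 4 5.
Proof.
have [t [i _ ->]|B [f [g [l [synB injB gen]]]]] := @base4_exists (later 0).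
  by split.
by exists (optn 5), B, f, g, l; split=> //; exact: card_optn.
Qed.

(** Replacing (n, m) by (n + 3, m + n + 3) adds 6 n + 18 to 6 m and to n (n + 3), so the optimal
    count persists. *)
Lemma stage_iter n0 m0 k :
  syzygy_free_stage 0 n0 m0 ->
  (6 * m0 = n0 * (n0 + 3) + (n0 %% 3 != 0) * 2)%N ->
  exists2 m, syzygy_free_stage k (3 * k + n0) m &
    (6 * m = (3 * k + n0) * (3 * k + n0 + 3) + (n0 %% 3 != 0) * 2)%N.
Proof.
move=> st0 m0E; elim: k => [|k [m st mE]]; first by exists m0.
exists (m + (3 * k + n0) + 3)%N; last by move: mE; case: (_ != _); lia.
have -> : (3 * k.+1 + n0 = (3 * k + n0).+3)%N by rewrite mulnS -addnA.
exact: stage_step.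
Qed.

(* [(n + 1)(n + 2) / 6] quadrics if 3 does not divide n, [n (n + 3) / 6] otherwise *)
Lemma exists_no_linear_syzygy n :
  exists (P : finType) (B : P -> optn n -> optn n -> K),
  (6 * #|P| = n * (n + 3) + (n %% 3 != 0) * 2)%N /\ no_linear_syzygy B.
Proof.
have conclude k n0 m0 : syzygy_free_stage 0 n0 m0 ->
    (6 * m0 = n0 * (n0 + 3) + (n0 %% 3 != 0) * 2)%N -> n = (3 * k + n0)%N ->
    exists (P : finType) (B : P -> optn n -> optn n -> K),
    (6 * #|P| = n * (n + 3) + (n %% 3 != 0) * 2)%N /\ no_linear_syzygy B.
  move=> st0 m0E ->; have [m [P [B [f [g [l [cardP synB _ _]]]]]] mE] := stage_iter k st0 m0E.
  have nm : ((3 * k + n0) %% 3 = n0 %% 3)%N by rewrite mulnC modnMDl.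
  by exists P, B; rewrite cardP mE nm.
have [|[]] : ((n = 3 * (n %/ 3) + 0) \/ (n = 3 * (n %/ 3) + 1) \/
    (n = 3 * (n %/ 3) + 2))%N by lia.
- exact: (conclude _ _ _ stage0 erefl).
(* With a single variable [f] and [g] commute and [commutator_inj] fails, so this residue class
   starts at n = 4 and n = 1 is done directly with the quadric v^2. *)
- case: (posnP (n %/ 3)) => [-> -> | k0 nE].
    exists unit, (fun _ _ _ => 1); rewrite card_unit; split=> // C [Z1 _ _] [] [[]|].
    by have := Z1 None; rewrite (bigD1 tt) //= big1 ?addr0 ?mulr1 // => -[].
  by apply: (conclude (n %/ 3).-1 _ _ stage4 erefl); lia.
- exact: (conclude _ _ _ stage2 erefl).
Qed.
End Induction.
End LinearSyzygies.

(** * From quadrics without linear syzygies to relators *)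

Notation sym_idx n := ('I_n + {p : 'I_n * 'I_n | (p.1 < p.2)%N})%type.

Lemma card_sym_idx n : #|{: sym_idx n}| = 'C(n.+1, 2).
Proof.
rewrite card_sum card_ord card_sig binS bin1 addnC; congr (_ + _)%N.
rewrite -bin2_sum big_mkord -sum1_card.
rewrite (eq_bigl (fun p : 'I_n * 'I_n => true && (p.1 < p.2)%N)) //.
rewrite -(pair_big_dep xpredT (fun i j : 'I_n => (i < j)%N) (fun _ _ => 1%N)) /=.
rewrite (exchange_big_dep xpredT) //=; apply: eq_bigr => j _.
by rewrite -(big_ord_widen n (fun=> 1%N) (ltnW (ltn_ord j))) sum1_card card_ord.
Qed.

(** The index of the commutative monomial v_a v_b, and at the same time of the degree 2 Lie element
    x_a^2 or [x_a, x_b]; being symmetric, it lets the Jacobi identities be stated without ordering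
    the variables. *)
Definition upair n (a b : 'I_n) : sym_idx n :=
  match insub (a, b) : option {p : 'I_n * 'I_n | (p.1 < p.2)%N} with
  | Some p => inr p
  | None => match insub (b, a) : option {p : 'I_n * 'I_n | (p.1 < p.2)%N} with
            | Some p => inr p
            | None => inl a
            end
  end.

Lemma upairE n (p : {p : 'I_n * 'I_n | (p.1 < p.2)%N}) :
  upair (val p).1 (val p).2 = inr p.
Proof. by rewrite /upair -surjective_pairing valK. Qed.

Lemma upairC n (a b : 'I_n) : upair a b = upair b a.
Proof.
rewrite /upair; case: (ltngtP a b) => ab; last by rewrite (val_inj ab).
- by rewrite (insubT (fun p : 'I_n * 'I_n => (p.1 < p.2)%N) (ab : ((a, b).1 < (a, b).2)%N))
             insubF //= ltnNge ltnW.
- by rewrite (insubT (fun p : 'I_n * 'I_n => (p.1 < p.2)%N) (ab : ((b, a).1 < (b, a).2)%N))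
             insubF //= ltnNge ltnW.
Qed.

Lemma upairxx n (a : 'I_n) : upair a a = inl a.
Proof. by rewrite /upair insubF ?insubF //= ltnn. Qed.

Section LinearSystem.
Variables (K : fieldType) (n r : nat).

(* [u d t] is the value of a linear form at the bracket of x_d with the t-th
   basis element of the degree 2 component. *)
Definition jacobi_form (u : 'I_n -> sym_idx n -> K) : Prop :=
  [/\ forall a, u a (upair a a) = 0,
      forall a b, a != b -> u b (upair a a) + u a (upair a b) = 0
    & forall a b c, a != b -> a != c -> b != c ->
        u a (upair b c) + u b (upair a c) + u c (upair a b) = 0].

(** The dual form of the vanishing in degree 3: only the zero linear form on the brackets [x_d, w_t]
    respects the Jacobi identities and kills the brackets with the relators. *)
Definition only_zero_form (c : coef_idx n r -> K) : Prop :=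
  forall u, jacobi_form u -> (forall d i, \sum_t u d t * c (i, t) = 0) ->
  forall d t, u d t = 0.
End LinearSystem.

(** The relators span the orthogonal of the quadrics [BT]. A form killing their brackets has all its
    rows in the span of the [BT p], and the Jacobi conditions then say that its coefficients are a
    linear syzygy. *)
Lemma exists_only_zero_form (K : fieldType) (tau : nat -> K) (n r : nat) :
  injective tau -> (forall i, [/\ tau i != 0, tau i != 1, tau i != -1 & tau i != 2]) ->
  (0 < n)%N -> (n ^ 2 <= 3 * r + 1)%N ->
  exists c : coef_idx n r -> K, only_zero_form c.
Proof.
move=> tau_inj tauP n_gt0 nr.
have [||||P [B [cardP synB]]] := exists_no_linear_syzygy tau_inj _ _ _ _ n.
1-4: by move=> i; have [] := tauP i.
have e := card_optn n.
pose h (a : 'I_n) : optn n := enum_val (cast_ord (esym e) a).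
pose h' (a : optn n) : 'I_n := cast_ord e (enum_rank a).
have hK : cancel h h' by move=> a; rewrite /h /h' enum_valK cast_ordKV.
have h'K : cancel h' h by move=> a; rewrite /h /h' cast_ordK enum_rankK.
pose BT p (t : sym_idx n) : K := match t with
  | inl a => B p (h a) (h a)
  | inr q => B p (h (val q).1) (h (val q).2) + B p (h (val q).2) (h (val q).1)
  end.
have BTE p (a b : 'I_n) : a != b -> BT p (upair a b) = B p (h a) (h b) + B p (h b) (h a).
  wlog ab : a b / (a < b)%N => [wl ab|_].
    move: (ab); rewrite neq_ltn => /orP[|] lt; first exact: wl.
    by rewrite upairC wl 1?eq_sym // addrC.
  by rewrite -[a]/(val (Sub (a, b) ab : {p : 'I_n * 'I_n | (p.1 < p.2)%N})).1
             -[b]/(val (Sub (a, b) ab : {p : 'I_n * 'I_n | (p.1 < p.2)%N})).2 upairE.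
(* a combination of the BT whose coefficients are linear forms is a cubic *)
have combination (x : 'I_n -> P -> K) (u : 'I_n -> sym_idx n -> K) :
    (forall d t, u d t = \sum_p x d p * BT p t) -> jacobi_form u ->
    forall d p, x d p = 0.
  move=> uE [J1 J2 J3].
  have uE2 (a b c : 'I_n) : b != c -> u a (upair b c) = \sum_p x a p * B p (h b) (h c) +
     \sum_p x a p * B p (h c) (h b).
    move=> bc; rewrite uE -big_split; apply: eq_bigr => p _.
    by rewrite BTE // mulrDr.
  have uE1 a b : u a (upair b b) = \sum_p x a p * B p (h b) (h b).
    by rewrite uE; apply: eq_bigr => p _; rewrite upairxx.
  have C0 := synB (fun p d => x (h' d) p); move=> d p.
  rewrite -(hK d); apply: C0; split.
  - by move=> a; have := J1 (h' a); rewrite uE1 h'K.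
  - move=> a b ab; have ab' : h' a != h' b by rewrite (can_eq h'K).
    have := J2 _ _ ab'; rewrite uE1 uE2 // !h'K => eJ; rewrite -[RHS]eJ; ring.
  - move=> a b c ab ac bc.
    have := J3 (h' a) (h' b) (h' c); rewrite !uE2 ?(can_eq h'K) // !h'K.
    by move=> /(_ ab ac bc) eJ; rewrite -[RHS]eJ; ring.
pose M : 'M[K]_(#|P|, #|{: sym_idx n}|) := \matrix_(i, j) BT (enum_val i) (enum_val j).
have M_sum (v : 'rV[K]_#|P|) t : (v *m M) 0 (enum_rank t) = \sum_p v 0 (enum_rank p) * BT p t.
  rewrite mxE (reindex (@enum_rank P)) /=; last first.
    by exists enum_val => p _; rewrite ?enum_rankK ?enum_valK.
  by apply: eq_bigr => p _; rewrite mxE !enum_rankK.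
have M_free : row_free M.
  rewrite -kermx_eq0; apply/eqP/row_matrixP => i; rewrite row0; apply/rowP => j.
  rewrite !mxE -(enum_valK j).
  pose v := row i (kermx M).
  have vM : v *m M = 0 by rewrite -row_mul mulmx_ker row0.
  have v0 : (forall (d : 'I_n) t, 0 = \sum_p v 0 (enum_rank p) * BT p t) ->
      v 0 (enum_rank (enum_val j)) = 0.
    move=> vE; apply: (combination (fun _ p => v 0 (enum_rank p)) (fun _ _ => 0) vE _ (Ordinal n_gt0)).
    by split=> *; rewrite ?addr0.
  suff: v 0 (enum_rank (enum_val j)) = 0 by rewrite !mxE.
  by apply: v0 => d t; rewrite -M_sum vM mxE.
(* The orthogonal has dimension C(n + 1, 2) minus the number of quadrics, that is (n^2 - 1) / 3
   rounded up. *)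
have rkC : (\rank (cokermx M) <= r)%N.
  rewrite mxrank_coker (eqP M_free) card_sym_idx bin2 /=.
  have := cardP; case: eqP => [n3 | _]; rewrite /= ?mul0n ?mul1n ?addn0 => cP.
    have nE : n = (3 * (n %/ 3))%N by lia.
    by rewrite nE in nr cP *; nia.
  by nia.
(* The rank factorization replaces [cokermx M] by exactly [r] columns with the same left
   annihilator; surplus columns are zero. *)
pose C : 'M[K]_(_, r) := col_ebase (cokermx M) *m pid_mx (\rank (cokermx M)).
have CE : cokermx M = C *m (pid_mx (\rank (cokermx M)) *m row_ebase (cokermx M)).
  rewrite /C !mulmxA -[_ *m pid_mx _ *m pid_mx _]mulmxA mul_pid_mx minnn.
  by rewrite (minn_idPr rkC) mulmx_ebase.
exists (fun q => C (enum_rank q.2) q.1) => u uJ uC.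
have u_row d : exists x : 'rV_#|P|, forall t, u d t = \sum_p x 0 (enum_rank p) * BT p t.
  pose v : 'rV_(#|{: sym_idx n}|) := \row_j u d (enum_val j).
  have : (v <= M)%MS.
    rewrite submxE CE mulmxA.
    suff -> : v *m C = 0 by rewrite mul0mx.
    apply/rowP => i; rewrite !mxE -[RHS](uC d i) [RHS]sum_enum_val.
    by apply: eq_bigr => j _; rewrite mxE enum_valK.
  by case/submxP=> x vE; exists x => t; rewrite -M_sum -vE mxE enum_rankK.
have [x xE] := fin_all_exists u_row.
have x0 := combination (fun d p => x d 0 (enum_rank p)) u xE uJ.
by move=> d t; rewrite xE big1 // => p _; rewrite x0 mul0r.
Qed.

(** * The enveloping algebra *)

Lemma coef_gen_poly A (S : seq (nat * A)) d : (gen_poly S)`_d = (deg_count d S)%:R.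
Proof.
rewrite /gen_poly /deg_count -sum1_count [in RHS]big_mkcond /= coef_sum natr_sum.
by apply: eq_bigr => p _; rewrite coefXn eq_sym; case: eqP.
Qed.

Section SumMul.
Variables (A : nzRingType) (m : nat).
Implicit Types (g v w : 'I_m -> A) (u : A).

Lemma sum_mulrD g v w : \sum_j g j * (v j + w j) = \sum_j g j * v j + \sum_j g j * w j.
Proof. by rewrite -big_split; apply: eq_bigr => j _; rewrite mulrDr. Qed.

Lemma sum_mulr0 g : \sum_j g j * 0 = 0.
Proof. by rewrite big1 // => j _; rewrite mulr0. Qed.

Lemma sum_mulr_delta g j u : \sum_k g k * (if k == j then u else 0) = g j * u.
Proof.
by rewrite (bigD1 j) //= eqxx big1 ?addr0 // => k /negPf ->; rewrite mulr0.
Qed.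

Lemma mulr_suml_assoc g v u : (\sum_j g j * v j) * u = \sum_j g j * (v j * u).
Proof. by rewrite mulr_suml; apply: eq_bigr => j _; rewrite mulrA. Qed.

Lemma sum_mulrB g v w : \sum_j g j * (v j - w j) = \sum_j g j * v j - \sum_j g j * w j.
Proof. by rewrite -sumrB; apply: eq_bigr => j _; rewrite mulrBr. Qed.
End SumMul.

Section SumMulPair.
Variables (F : fieldType) (A : lalgType F) (m l : nat).
Hypothesis scaleAr : forall (a : F) (u v : A), u * (a *: v) = a *: (u * v).

Lemma sum_mul_pair (g : 'I_m -> A) (b : 'I_l -> A) (a : 'I_m * 'I_l -> F) :
  \sum_p a p *: (g p.1 * b p.2) = \sum_j g j * \sum_i a (j, i) *: b i.
Proof.
rewrite (eq_bigr (fun p => (fun j i => a (j, i) *: (g j * b i)) p.1 p.2)); last by case.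
rewrite -(pair_big xpredT xpredT (fun j i => a (j, i) *: (g j * b i))) /=.
by apply: eq_bigr => j _; rewrite mulr_sumr; apply: eq_bigr => i _; rewrite scaleAr.
Qed.
End SumMulPair.

Lemma sub0_eq (V : zmodType) (x y : V) : x = y -> x - y = 0.
Proof. by move=> ->; rewrite subrr. Qed.

Lemma sub_sum_add (V : zmodType) (x a p q : V) : x - a = p + q ->
  forall b c, q - b = c -> x - (a + b) = p + c.
Proof. by move=> e b c <-; rewrite opprD addrA e addrA. Qed.

Section AssociativeIdeal.
Variables (K : fieldType) (n r : nat) (f : 'I_r -> ncpoly K n).
Local Notation T := (ncpoly K n).
Hypothesis free_f : forall i, free_lie 2 (f i).
Implicit Types (u v : T) (d e : nat) (S B : seq (nat * T)).

Let homogeneous_f i : homogeneous 2 (f i). Proof. exact: free_lie_homogeneous. Qed.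

(* the two-sided ideal generated by the f i, which is determined by
   I_(e+2) = sum_j x_j I_(e+1) + sum_i f_i T_e *)
Fixpoint assoc_ideal d u : Prop :=
  if d is d'.+1 then
    if d' is e.+1 then exists v : 'I_n -> T, exists w : 'I_r -> T,
      [/\ forall j, assoc_ideal d' (v j), forall i, homogeneous e (w i)
        & u = \sum_j ncvar K j * v j + \sum_i f i * w i]
    else u = 0
  else u = 0.

Local Notation I := assoc_ideal.

Lemma sum_mulrZ (m : nat) (g v : 'I_m -> T) (a : K) :
  \sum_j g j * (a *: v j) = a *: \sum_j g j * v j.
Proof. by rewrite scaler_sumr; apply: eq_bigr => j _; apply: ncscaleAr. Qed.

Lemma assoc_ideal_subspace d : subspace (I d).
Proof.
elim: d => [|[|d] [I0 ID IZ]]; try exact: zero_subspace.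
have [h0 hD hZ] := homogeneous_subspace K n d; split.
- exists (fun _ => 0), (fun _ => 0); split=> //.
  exact: (esym (etrans (congr2 +%R (sum_mulr0 _) (sum_mulr0 _)) (addr0 _))).
- move=> _ _ [v [w [Iv hw ->]]] [v' [w' [Iv' hw' ->]]].
  exists (fun j => v j + v' j), (fun i => w i + w' i); split=> [j|i|].
  + exact: ID _ _ (Iv j) (Iv' j).
  + exact: hD _ _ (hw i) (hw' i).
  + exact: (etrans (addrACA _ _ _ _) (esym (congr2 +%R (sum_mulrD _ _ _) (sum_mulrD _ _ _)))).
- move=> a _ [v [w [Iv hw ->]]].
  exists (fun j => a *: v j), (fun i => a *: w i); split=> [j|i|].
  + exact: IZ _ _ (Iv j).
  + exact: hZ _ _ (hw i).
  + exact: (etrans (scalerDr _ _ _) (esym (congr2 +%R (sum_mulrZ _ _ _) (sum_mulrZ _ _ _)))).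
Qed.

Lemma assoc_ideal0 d : I d 0. Proof. by have [] := assoc_ideal_subspace d. Qed.

Lemma assoc_ideal_var d j u : I d u -> I d.+1 (ncvar K j * u).
Proof.
case: d => [|d] Iu; first by rewrite Iu mulr0.
have [h0 _ _] := homogeneous_subspace K n d.
exists (fun k => if k == j then u else 0), (fun _ => 0); split=> // [k|].
  by case: eqP => // _; apply: assoc_ideal0.
exact: (esym (etrans (congr2 +%R (sum_mulr_delta _ _ _) (sum_mulr0 _)) (addr0 _))).
Qed.

Lemma assoc_ideal_mull d e u v : homogeneous e v -> I d u -> I (e + d) (v * u).
Proof.
elim: e v => [|e IHe] v /=.
  by move=> [a ->] Iu; rewrite ncscaleAl mul1r; have [_ _ IZ] := assoc_ideal_subspace d; apply: IZ.
move=> [w hw ->] Iu; rewrite mulr_suml.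
apply: (subspace_sum _ (assoc_ideal_subspace (e + d).+1)) => j _.
by rewrite -mulrA; apply: assoc_ideal_var; apply: IHe.
Qed.

Lemma assoc_ideal_mulr d e u v : I d u -> homogeneous e v -> I (d + e) (u * v).
Proof.
elim: d u => [|[|d] IHd] u.
- by move=> -> _; rewrite mul0r; apply: assoc_ideal0.
- by move=> -> _; rewrite mul0r; apply: assoc_ideal0.
move=> [w [z [Iw hz ->]]] hv; exists (fun j => w j * v), (fun i => z i * v); split=> [j|i|].
- exact: IHd _ (Iw j) hv.
- exact: homogeneous_mul (hz i) hv.
- rewrite mulrDl; apply: (congr2 +%R); exact: mulr_suml_assoc.
Qed.

Lemma assoc_ideal_gen e i v : homogeneous e v -> I e.+2 (f i * v).
Proof.
move=> hv; have [h0 _ _] := homogeneous_subspace K n e.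
exists (fun _ => 0), (fun k => if k == i then v else 0); split=> [j|k|].
- exact: (assoc_ideal0 e.+1).
- by case: eqP.
exact: (esym (etrans (congr2 +%R (sum_mulr0 _) (sum_mulr_delta _ _ _)) (add0r _))).
Qed.

Lemma lie_ideal_assoc d u : lie_ideal f d u -> I d u.
Proof.
elim=> {d u} [i|d|d u v _ Iu _ Iv|d a u _ Iu|d e u v _ Iu Fv|d u od Ju Iu].
- by rewrite -[f i]mulr1; apply: (@assoc_ideal_gen 0); exists 1; rewrite scale1r.
- exact: assoc_ideal0.
- by have [_ ID _] := assoc_ideal_subspace d; apply: ID.
- by have [_ _ IZ] := assoc_ideal_subspace d; apply: IZ.
- have hv := free_lie_homogeneous Fv.
  have uv : I (d + e) (u * v) by apply: assoc_ideal_mulr.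
  have vu : I (d + e) (v * u) by rewrite addnC; apply: assoc_ideal_mull.
  have sI := assoc_ideal_subspace (d + e); rewrite /sbracket; case: ifP => _.
    by have [_ ID _] := sI; apply: ID.
  exact: subspaceB.
- apply: assoc_ideal_mulr => //; apply/free_lie_homogeneous/lie_ideal_sub_free/Ju; exact: free_f.
Qed.

Lemma assoc_dim_exists d : exists a, quot_dim (@homogeneous K n d) (I d) a.
Proof.
have [N [b bS]] := homogeneous_spanned K n d.
have [|a _ aP] := @quot_dim_exists _ _ (@homogeneous K n d) _ N (assoc_ideal_subspace d); last by exists a.
by exists b => u /bS[a e]; exists a; apply: (eq_ind_r (I d) (assoc_ideal0 d) e).
Qed.

Lemma assoc_dim0 a : quot_dim (@homogeneous K n 0) (I 0) a -> a = 1%N.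
Proof.
move=> aP; apply: (quot_dim_unique (assoc_ideal_subspace 0) aP).
exists (fun _ => 1); split=> [i|u [b ->]|b].
- by exists 1; rewrite scale1r.
- by exists (fun _ => b); rewrite big_ord1 subrr.
- rewrite big_ord1 /= => /eqP; rewrite scaler_eq0 oner_eq0 orbF => /eqP b0 i.
  by rewrite [i]ord1.
Qed.

Lemma var_ideal_subspace d : subspace (fun u : T =>
  exists2 v : 'I_n -> T, forall j, I d (v j) & u = \sum_j ncvar K j * v j).
Proof.
have [I0 ID IZ] := assoc_ideal_subspace d; split.
- by exists (fun _ => 0) => //; apply/esym; apply: sum_mulr0.
- move=> _ _ [v Iv ->] [w Iw ->]; exists (fun j => v j + w j) => [j|].
    exact: ID _ _ (Iv j) (Iw j).
  by apply/esym; apply: sum_mulrD.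
- move=> a _ [v Iv ->]; exists (fun j => a *: v j) => [j|]; first exact: IZ _ _ (Iv j).
  by apply/esym; apply: sum_mulrZ.
Qed.

(* I_(d+2) is spanned by the x_j I_(d+1) and the products of the f_i with
   representatives of a basis of T_d / I_d. *)
Theorem golod_shafarevich d a0 a1 a2 :
  quot_dim (@homogeneous K n d) (I d) a0 ->
  quot_dim (@homogeneous K n d.+1) (I d.+1) a1 ->
  quot_dim (@homogeneous K n d.+2) (I d.+2) a2 -> (n * a1 <= a2 + r * a0)%N.
Proof.
case=> b0 [hb0 b0S _] [b1 [hb1 _ b1I]] [b2 [_ b2S _]].
(* The count takes place modulo W = sum_j x_j I_(d+1): the n a1 products x_j b1 are independent
   modulo W, and they are combinations of the a2 elements b2 and the r a0 products f_i b0. *)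
have sW := var_ideal_subspace d.+1; set W := (X in subspace X) in sW.
(* Writing f_i as sum_j x_j g_j shows that f_i I_d lies in W, so only representatives of T_d / I_d
   matter. *)
have fW i t : I d t -> W (f i * t).
  move=> It; have [g hg ->] := homogeneous_f i.
  exists (fun j => g j * t) => [j|]; last exact: mulr_suml_assoc.
  exact: (@assoc_ideal_mull _ 1).
pose v (p : 'I_n * 'I_a1) := ncvar K p.1 * b1 p.2.
pose w (x : 'I_a2 + 'I_r * 'I_a0) := match x with inl i => b2 i | inr p => f p.1 * b0 p.2 end.
have := @indep_mod_fin_le K _ W _ _ v w sW.
rewrite card_sum !card_prod !card_ord; apply.
- move=> a [u Iu e].
  have e' : \sum_j ncvar K j * (\sum_i a (j, i) *: b1 i - u j) = 0.
    have e2 := sum_mul_pair (@ncscaleAr K n) (fun j => ncvar K j) b1 a.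
    have e3 := sum_mulrB (fun j => ncvar K j) (fun j => \sum_i a (j, i) *: b1 i) u.
    exact: etrans e3 (sub0_eq (etrans (esym e2) e)).
  move=> [j i]; apply: (b1I (fun i => a (j, i))).
  by rewrite (subr0_eq (ncvar_free e' j)).
- move=> [j i]; have [a] := b2S _ (homogeneous_var_mul j (hb1 i)).
  case=> u [z [Iu hz e]].
  have [c cP] := fin_all_exists (fun k => b0S _ (hz k)).
  exists (fun x => match x with inl k => a k | inr p => c p.1 p.2 end).
  have eW : W (\sum_j ncvar K j * u j + \sum_k f k * (z k - \sum_l c k l *: b0 l)).
    have [_ WD _] := sW; apply: WD; first by exists u.
    by apply: (subspace_sum _ sW) => k _; apply: fW.
  apply: eq_ind eW _ _; apply/esym; rewrite big_sumType.
  apply: (sub_sum_add e); apply/esym.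
  apply: (etrans (sum_mulrB _ _ _)); apply: (congr1 (fun y => _ - y)); apply/esym.
  exact: (sum_mul_pair (@ncscaleAr K n) f b0 (fun p => c p.1 p.2)).
Qed.

Lemma golod_shafarevich1 a1 :
  quot_dim (@homogeneous K n 1) (I 1) a1 -> (n <= a1)%N.
Proof.
case=> b1 [_ b1S _].
have := @indep_mod_fin_le K _ (fun u : T => u = 0) _ _ (fun j => ncvar K j) b1 (zero_subspace _).
rewrite !card_ord; apply=> [a e j|j]; last exact: (b1S _ (homogeneous_var K j)).
have e' : \sum_j ncvar K j * (a j *: 1) = 0.
  by rewrite -[RHS]e; apply: eq_bigr => k _; rewrite ncscaleAr mulr1.
by have /eqP := ncvar_free e' j; rewrite scaler_eq0 oner_eq0 orbF => /eqP.
Qed.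
End AssociativeIdeal.

(** * Ordered monomials *)

Section OrderedMonomials.
Variables (K : fieldType) (A : lalgType K).
Hypothesis scaleAr : forall (a : K) (u v : A), u * (a *: v) = a *: (u * v).
Variables (H I : nat -> A -> Prop).
Hypotheses (sH : forall d, subspace (H d)) (sI : forall d, subspace (I d)).
Hypotheses (H1 : H 0 1) (HM : forall d e u v, H d u -> H e v -> H (d + e) (u * v)).
Hypothesis IH : forall d u, I d u -> H d u.
Hypothesis I_mull : forall d e u v, H e v -> I d u -> I (e + d) (v * u).
Hypothesis I_mulr : forall d e u v, I d u -> H e v -> I (d + e) (u * v).
Implicit Types (u v y b : A) (d e i k D : nat) (B S : seq (nat * A)).

(** Products grow by one generator on the left at a time, so that induction on this predicate is
    induction on words. *)
Inductive assoc_gen S : nat -> A -> Prop :=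
| AssocIdeal d u : I d u -> assoc_gen S d u
| Assoc1 : assoc_gen S 0 1
| AssocD d u v : assoc_gen S d u -> assoc_gen S d v -> assoc_gen S d (u + v)
| AssocZ d (a : K) u : assoc_gen S d u -> assoc_gen S d (a *: u)
| AssocMul d e u v : (d, u) \in S -> assoc_gen S e v -> assoc_gen S (d + e) (u * v).

Lemma assoc_gen_homogeneous S d u : (forall p, p \in S -> H p.1 p.2) -> assoc_gen S d u -> H d u.
Proof.
move=> SH; elim=> {d u} [d u /IH //||d u v _ Hu _ Hv|d a u _ Hu|d e u v uS _ Hv] //.
- by have [_ HD _] := sH d; apply: HD.
- by have [_ _ HZ] := sH d; apply: HZ.
- by apply: HM => //; apply: (SH (d, u)).
Qed.

Lemma assoc_gen_sub S S' d u : {subset S <= S'} -> assoc_gen S d u -> assoc_gen S' d u.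
Proof.
move=> SS'; elim=> {d u} [d u /AssocIdeal //||d u v _ Su _ Sv|d a u _ Su|d e u v uS _ Sv].
- exact: Assoc1.
- exact: AssocD.
- exact: AssocZ.
- by apply: AssocMul => //; apply: SS'.
Qed.

(* products of weakly increasing sequences of elements of B, in which no odd
   element is repeated, with exponents at most D *)
Fixpoint monomials D B : seq (nat * A) :=
  if B is (i, b) :: B' then
    let M := monomials D B' in
    if odd i then M ++ [seq ((i + m.1)%N, b * m.2) | m <- M]
    else [seq ((k * i + m.1)%N, b ^+ k * m.2) | k <- iota 0 D.+1, m <- M]
  else [:: (0%N, 1)].

Lemma monomials_cons D i b B : monomials D ((i, b) :: B) =
  if odd i then monomials D B ++ [seq ((i + m.1)%N, b * m.2) | m <- monomials D B]
  else [seq ((k * i + m.1)%N, b ^+ k * m.2) | k <- iota 0 D.+1, m <- monomials D B].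
Proof. by []. Qed.

(** An odd element contributes 1 + z^i and an even one a geometric series; cutting the latter at
    exponent [D] changes nothing modulo z^(D + 1) because i > 0. *)
Lemma gen_poly_monomials D B : (forall p, p \in B -> (0 < p.1)%N) ->
  eqmod D (gen_poly (monomials D B) * even_prod B) (odd_prod B).
Proof.
elim: B => [|[i b] B IHB] B0 /=.
  by rewrite /even_prod /odd_prod /gen_poly big_seq1 !big_nil mulr1.
have i0 : (0 < i)%N by apply: (B0 (i, b)); rewrite mem_head.
have {}IHB : eqmod D (gen_poly (monomials D B) * even_prod B) (odd_prod B).
  by apply: IHB => p pB; apply: B0; rewrite inE pB orbT.
set M := monomials D B in IHB *; rewrite odd_prod_cons even_prod_cons; case: ifP => oi.
  have -> : gen_poly (M ++ [seq ((i + m.1)%N, b * m.2) | m <- M]) = (1 + 'X^i) * gen_poly M.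
    rewrite /gen_poly big_cat big_map /= mulrDl mul1r mulr_sumr; congr (_ + _).
    by apply: eq_bigr => m _; rewrite exprD.
  by rewrite mul1r -mulrA; apply: eqmodMl.
have -> : gen_poly [seq ((k * i + m.1)%N, b ^+ k * m.2) | k <- iota 0 D.+1, m <- M] =
    (\sum_(k < D.+1) ('X^i) ^+ k) * gen_poly M.
  rewrite /gen_poly big_allpairs_dep /= -/(iota 0 D.+1).
  rewrite -/(index_iota 0 D.+1) big_mkord mulr_suml.
  apply: eq_bigr => k _; rewrite mulr_sumr; apply: eq_bigr => p _.
  by rewrite -exprM mulnC -exprD.
have geo : (1 - 'X^i) * (\sum_(k < D.+1) ('X^i) ^+ k) = 1 - 'X^(i * D.+1) :> {poly rat}.
  by rewrite -opprB mulNr -subrX1 opprB exprM.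
rewrite mul1r; apply: eqmod_trans IHB.
have -> : (\sum_(k < D.+1) ('X^i) ^+ k) * gen_poly M * ((1 - 'X^i) * even_prod B) =
   gen_poly M * even_prod B - 'X^(i * D.+1) * (gen_poly M * even_prod B).
  rewrite mulrACA [X in X * _]mulrC geo; ring.
by apply: eqmodMXn; rewrite leq_pmull.
Qed.

(** Supercommutators with the head, and its square if odd, are rewritten by strictly later elements.
    This triangularity allows straightening by plain induction on the list; sorting by degree
    provides it. *)
Fixpoint straightening D B : Prop :=
  if B is (i, b) :: B' then
    [/\ (0 < i)%N /\ H i b,
        forall e y, (e, y) \in B' -> (e + i <= D)%N ->
          in_span I B' (e + i) (scomm (odd e && odd i) y b),
        odd i -> (i + i <= D)%N -> in_span I B' (i + i) (b * b)
      & straightening D B']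
  else True.

Lemma straightening_homogeneous D B p : straightening D B -> p \in B -> H p.1 p.2.
Proof.
elim: B => [//|[i b] B IHB] /= [[_ Hb] _ _ sB]; rewrite inE => /orP[/eqP -> //|].
exact: IHB.
Qed.

Lemma monomials_gen D B m : m \in monomials D B -> assoc_gen B m.1 m.2.
Proof.
elim: B m => [|[i b] B IHB] m; first by rewrite inE => /eqP ->; apply: Assoc1.
rewrite monomials_cons.
have up d u : assoc_gen B d u -> assoc_gen ((i, b) :: B) d u.
  by apply: assoc_gen_sub => p pB; rewrite inE pB orbT.
have bmul d u : assoc_gen ((i, b) :: B) d u -> assoc_gen ((i, b) :: B) (i + d) (b * u).
  by apply: AssocMul; rewrite mem_head.
case: ifP => oi.
  rewrite mem_cat => /orP[mM|/mapP[m' mM ->]]; first exact/up/IHB.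
  exact/bmul/up/IHB.
case/allpairsP=> [[k m'] /= [_ mM ->]] /=.
have gm' := up _ _ (IHB _ mM).
elim: k => [|k IHk]; first by rewrite mul0n expr0 mul1r.
by rewrite mulSn -addnA exprS -mulrA; apply: bmul.
Qed.

Lemma mulr_scomm c y b t :
  y * (b * t) = scomm c y b * t + (if c then - (b * (y * t)) else b * (y * t)).
Proof. by case: c => /=; rewrite ?mulrDl ?mulNr !mulrA ?addrK ?subrK. Qed.

(** The span of the monomials contains 1 and is closed, up to degree [D], under left multiplication
    by the head [b] ([Xb]) and by each later element ([Xy]); products of later elements alone are
    covered by the induction hypothesis ([Xgen]). *)
Theorem monomials_span D B d u : straightening D B -> (d <= D)%N ->
  assoc_gen B d u -> in_span I (monomials D B) d u.
Proof.
elim: B d u => [|[i b] B IHB] d u.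
  move=> _ _; elim=> {d u} [d u Iu||d u v _ Su _ Sv|d a u _ Su|//].
  - exact: in_span0.
  - by exists 1; rewrite scale1r subrr; have [] := sI 0.
  - by have [_ SD _] := in_span_subspace sI (monomials D [::]) d; apply: SD.
  - by have [_ _ SZ] := in_span_subspace sI (monomials D [::]) d; apply: SZ.
move=> st; have [[i0 Hb] st1 st2 sB] := st.
have BH p : p \in B -> H p.1 p.2 by apply: straightening_homogeneous sB.
set M := monomials D B; set M' := monomials D ((i, b) :: B).
have I0 e : I e 0 by have [] := sI e.
pose X := in_span I M'; have sX e : subspace (X e) := in_span_subspace sI M' e.
have XI e v : I e v -> X e v by apply: in_span0.
have XM' e v : (e, v) \in M' -> X e v by apply: in_span_mem.
have MM' e v : (e, v) \in M -> X e v.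
  move=> evM; apply: XM'; rewrite /M' monomials_cons -/M; case: ifP => oi; first by rewrite mem_cat evM.
  apply/allpairsP; exists (0%N, (e, v)); split=> //=.
  by rewrite mul0n add0n expr0 mul1r.
have Xgen e v : (e <= D)%N -> assoc_gen B e v -> X e v.
  move=> eD /(IHB e v sB eD); apply: in_span_min => // [w /XI //|w]; exact: MM'.
have genH e v : assoc_gen B e v -> H e v by apply: assoc_gen_homogeneous.
have mgen m : m \in M -> assoc_gen B m.1 m.2 := @monomials_gen D B m.
(* An even [b] raises its exponent, which the degree bound keeps within range; a repeated odd [b] is
   replaced by later elements through the expression of its square. *)
have Xb e v : X e v -> (i + e <= D)%N -> X (i + e)%N (b * v).
  move=> Xv ieD; have [X0 XD XZ] := sX (i + e)%N.
  apply: (in_span_min (X := fun v => X (i + e)%N (b * v)) _ _ _ Xv).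
  - split=> [|w w' Xw Xw'|a w Xw]; first by rewrite mulr0.
      by rewrite mulrDr; apply: XD.
    by rewrite scaleAr; apply: XZ.
  - by move=> w Iw; apply/XI/I_mull.
  move=> w; rewrite /M' monomials_cons -/M; case: ifP => oi.
    rewrite mem_cat => /orP[wM|/mapP[m mM [eE ->]]].
      apply: XM'; rewrite /M' monomials_cons oi mem_cat; apply/orP; right.
      by apply/mapP; exists (e, w).
    have iiD : (i + i <= D)%N by move: ieD; rewrite eE; clear; lia.
    rewrite eE mulrA addnA.
    have [X0' XD' XZ'] := sX (i + i + m.1)%N.
    apply: (in_span_min (X := fun c => X (i + i + m.1)%N (c * m.2)) _ _ _ (st2 oi iiD)).
    + split=> [|c c' Xc Xc'|a c Xc]; first by rewrite mul0r.
        by rewrite mulrDl; apply: XD'.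
      by rewrite -scalerAl; apply: XZ'.
    + by move=> c Ic; apply/XI/I_mulr => //; apply/genH/mgen.
    by move=> y yB; apply: Xgen; [move: ieD; rewrite eE addnA | apply: AssocMul => //; apply: mgen].
  case/allpairsP=> [[k m] /= [_ mM [eE ->]]]; rewrite eE in ieD *.
  apply: XM'; rewrite /M' monomials_cons oi; apply/allpairsP; exists (k.+1, m); split=> //; last first.
    by rewrite /= mulSn addnA exprS mulrA.
  by rewrite mem_iota /=; have := leq_pmulr k i0; move: ieD; clear -i0; lia.
(* [y] is moved across one factor [b] at a time: the supercommutator is a combination of later
   elements, to which the induction on [k] applies, and in the other term [b] is already in
   front. *)
have Xy k e y d' s : (e, y) \in B -> assoc_gen B d' s -> (e + (k * i + d') <= D)%N ->
    X (e + (k * i + d'))%N (y * (b ^+ k * s)).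
  elim: k e y => [|k IHk] e y yB gs eD.
    by rewrite mul0n add0n expr0 mul1r; apply: Xgen; [move: eD; lia | apply: AssocMul].
  rewrite exprS -mulrA (mulr_scomm (odd e && odd i)).
  have eD1 : (e + (k * i + d') <= D)%N by move: eD; rewrite mulSn; lia.
  have -> : (e + (k.+1 * i + d') = e + i + (k * i + d'))%N by rewrite mulSn; lia.
  have [X0 XD XZ] := sX (e + i + (k * i + d'))%N.
  have Ht : H (k * i + d') (b ^+ k * s).
    apply: (HM _ (genH _ _ gs)); elim: k {IHk eD eD1 X0 XD XZ} => [|k IHk]; first by rewrite expr0.
    by rewrite exprS mulSn; apply: HM.
  apply: XD.
    have [X0' XD' XZ'] := sX (e + i + (k * i + d'))%N.
    have eiD : (e + i <= D)%N by move: eD; rewrite mulSn; lia.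
    apply: (in_span_min (X := fun c => X (e + i + (k * i + d'))%N (c * (b ^+ k * s))) _ _ _ (st1 e y yB eiD)).
    - split=> [|c c' Xc Xc'|a c Xc]; first by rewrite mul0r.
        by rewrite mulrDl; apply: XD'.
      by rewrite -scalerAl; apply: XZ'.
    - by move=> c Ic; apply/XI/I_mulr.
    - by move=> y' y'B; apply: IHk => //; move: eD; rewrite mulSn; lia.
  have Xby : X (e + i + (k * i + d'))%N (b * (y * (b ^+ k * s))).
    rewrite (addnC e) -addnA; apply: Xb; first exact: IHk.
    by move: eD; rewrite mulSn; lia.
  by case: ifP => // _; apply: subspaceN (sX _) Xby.
move=> dD gu; elim: gu dD => {d u} [d u /XI //||d u v _ IHu _ IHv|d a u _ IHu|d e u v uB _ IHv] dD.
- by apply: Xgen => //; apply: Assoc1.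
- by have [_ XD _] := sX d; apply: XD; [apply: IHu | apply: IHv].
- by have [_ _ XZ] := sX d; apply: XZ; apply: IHu.
have Xv : X e v by apply: IHv; apply: leq_trans dD; rewrite leq_addl.
move: uB; rewrite inE => /orP[/eqP[di ub]|uB]; first by subst d u; apply: Xb.
have [X0 XD XZ] := sX (d + e)%N.
apply: (in_span_min (X := fun v => X (d + e)%N (u * v)) _ _ _ Xv).
- split=> [|w w' Xw Xw'|a w Xw]; first by rewrite mulr0.
    by rewrite mulrDr; apply: XD.
  by rewrite scaleAr; apply: XZ.
- by move=> w Iw; apply/XI/I_mull => //; apply: (BH (d, u)).
move=> w; rewrite /M' monomials_cons -/M; case: ifP => oi.
  rewrite mem_cat => /orP[wM|/mapP[m mM [eE ->]]].
    by apply: Xgen => //; apply: AssocMul => //; apply: (mgen (e, w)).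
  have := @Xy 1%N d u _ _ uB (mgen m mM); rewrite mul1n expr1 eE; apply.
  by rewrite -eE.
case/allpairsP=> [[k m] /= [_ mM [eE ->]]]; rewrite eE; apply: Xy => //; last by rewrite -eE.
exact: mgen.
Qed.

Lemma assoc_gen_mul B d e w v : in_span I B d w -> assoc_gen B e v -> H e v ->
  assoc_gen B (d + e) (w * v).
Proof.
move=> dw gv Hv; apply: (in_span_min (X := fun w => assoc_gen B (d + e) (w * v)) _ _ _ dw).
- split=> [|u u' gu gu'|a u gu]; first by rewrite mul0r; apply: AssocIdeal; have [] := sI (d + e).
    by rewrite mulrDl; apply: AssocD.
  by rewrite -scalerAl; apply: AssocZ.
- by move=> u Iu; apply/AssocIdeal/I_mulr.
- by move=> b dB; apply: AssocMul.
Qed.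
End OrderedMonomials.

Lemma in_span_sub (K : fieldType) (V : lmodType K) (W W' : nat -> V -> Prop) B d u :
  (forall e, subspace (W' e)) -> (forall e v, W e v -> W' e v) ->
  in_span W B d u -> in_span W' B d u.
Proof.
move=> sW' WW'; apply: in_span_min; first exact: in_span_subspace.
- by move=> v /WW'; apply: in_span0.
- by move=> b; apply: in_span_mem => // e; have [] := sW' e.
Qed.

(** * Bounding the associative dimensions by ordered monomials *)

Section LowerBound.
Variables (K : fieldType) (n r : nat) (f : 'I_r -> ncpoly K n).
Local Notation T := (ncpoly K n).
Hypothesis free_f : forall i, free_lie 2 (f i).
Local Notation J := (lie_ideal f).
Local Notation I := (assoc_ideal f).
Local Notation H := (@homogeneous K n).
Implicit Types (u v b : T) (d e m : nat) (B : seq (nat * T)).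

Definition degree_sorted B : bool := pairwise (fun p q => (p.1 <= q.1)%N) B.

Definition graded_basis D B : Prop :=
  [/\ degree_sorted B, forall p, p \in B -> (0 < p.1 <= D)%N /\ free_lie p.1 p.2
    & forall d u, (0 < d <= D)%N -> free_lie d u -> in_span J B d u].

Lemma graded_basis_exists D (N : nat -> nat) :
  (forall d, (0 < d <= D)%N -> quot_dim (@free_lie K n d) (J d) (N d)) ->
  exists2 B, graded_basis D B & forall d, (0 < d <= D)%N -> deg_count d B = N d.
Proof.
elim: D => [|D IHD] ND; first by exists [::] => [|[]//]; split=> // -[].
have [|B [sB BP BS] BN] := IHD; first by move=> d dD; apply: ND; lia.
have [|b [Fb bS _]] := ND D.+1; first by lia.
have sJ := lie_ideal_subspace f.
pose L := [seq (D.+1, b i) | i <- enum 'I_(N D.+1)].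
have LP p : p \in L -> p.1 = D.+1 by case/mapP=> i _ ->.
have countL d : deg_count d L = if d == D.+1 then N D.+1 else 0%N.
  rewrite /deg_count count_map /=; case: eqP => [->|dD].
    by rewrite (eq_count (a2 := xpredT)) ?count_predT ?size_enum_ord // => i; rewrite /= eqxx.
  by rewrite (eq_count (a2 := xpred0)) ?count_pred0 // => i; apply/eqP => e; case: dD.
have countB d : (d == D.+1) -> deg_count d B = 0%N.
  move=> /eqP ->; apply/eqP; rewrite -leqn0 leqNgt -has_count; apply/hasP => -[p /BP[pD _] /eqP pE].
  by move: pD; rewrite pE ltnn andbF.
exists (B ++ L); [split|].
- rewrite /degree_sorted pairwise_cat; rewrite /degree_sorted in sB; rewrite sB /=; apply/andP; split.
    by apply/allrelP => p q /BP[pD _] /LP ->; case/andP: pD => _ /leqW.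
  by rewrite pairwise_map; elim: (enum _) => //= i s ->; rewrite andbT; apply/allP => j _ /=; apply: leqnn.
- move=> p; rewrite mem_cat => /orP[/BP[pD Fp]|]; first by split=> //; case/andP: pD => -> /leqW ->.
  by case/mapP=> i _ -> /=; rewrite leqnn.
- move=> d u dD Fu; have [dD' | Dd] := leqP d D.
    rewrite -[u]addr0; apply: in_span_cat => //; first by apply: BS => //; lia.
    by have [] := in_span_subspace sJ L d.
  have {dD Dd}dE : d = D.+1 by lia.
  subst d.
  rewrite -[u]add0r; apply: in_span_cat => //; first by have [] := in_span_subspace sJ B D.+1.
  have [a Ja] := bS _ Fu; have sL := in_span_subspace sJ L D.+1; have [_ LD LZ] := sL.
  rewrite -[u](subrK (\sum_i a i *: b i)); apply: LD; first exact: in_span0.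
  apply: (subspace_sum _ sL) => i _; apply: LZ; apply: in_span_mem => // [e|].
    by have [] := sJ e.
  by apply/mapP; exists i; rewrite ?mem_enum.
- move=> d dD; rewrite /deg_count count_cat -/(deg_count d B) -/(deg_count d L) countL.
  by case: eqP => [->|dD']; [rewrite countB | rewrite addn0 BN //; lia].
Qed.

(** Brackets with the head and its square have degree above that of the head, and in such degrees
    the tail spans the same as the whole list. *)
Lemma graded_straightening D B : graded_basis D B -> straightening H I D B.
Proof.
case=> sB BP BS; have sI := assoc_ideal_subspace f.
suff st m : (forall p, p \in B -> (m <= p.1)%N) ->
    (forall d u, (m < d <= D)%N -> free_lie d u -> in_span J B d u) -> straightening H I D B.
  exact: (st 0%N).
elim: B m sB BP {BS} => [//|[i b] B IHB] m sB BP Bm BS.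
move: sB; rewrite /degree_sorted /= => /andP[/allP iB sB].
have [iD Fb] := BP (i, b) (mem_head _ _); rewrite /= in iD Fb.
have mi : (m <= i)%N by apply: (Bm (i, b)); rewrite mem_head.
have BP' p : p \in B -> (0 < p.1 <= D)%N /\ free_lie p.1 p.2.
  by move=> pB; apply: BP; rewrite inE pB orbT.
have BS' d u : (i < d <= D)%N -> free_lie d u -> in_span J B d u.
  move=> /andP[id dD] Fu; have := BS d u; rewrite /= ltn_eqF //; apply=> //.
  by rewrite (leq_ltn_trans mi id).
split; last 1 first.
- exact: (IHB i).
- by split; [case/andP: iD | apply: free_lie_homogeneous].
- move=> e y yB eD; have [/= e0 Fy] := BP' _ yB.
  apply: (in_span_sub sI (lie_ideal_assoc free_f)); rewrite -sbracketE.
  apply: BS'; last exact: FreeLieBracket.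
  by rewrite eD andbT; case/andP: e0; lia.
- move=> oi iiD; apply: (in_span_sub sI (lie_ideal_assoc free_f)).
  apply: BS'; last exact: FreeLieSq.
  by rewrite iiD andbT; case/andP: iD; lia.
Qed.

Lemma assoc_ideal_homogeneous d u : I d u -> H d u.
Proof.
have sH := @homogeneous_subspace K n; have h0 e : H e 0 by have [] := sH e.
elim: d u => [|[|d] IHd] u; try by move=> ->; apply: h0.
move=> [v [w [Iv hw ->]]]; have [_ hD _] := sH d.+2; apply: hD.
  by apply: (subspace_sum _ (sH d.+2)) => j _; apply: (homogeneous_var_mul j (IHd _ (Iv j))).
apply: (subspace_sum _ (sH d.+2)) => i _.
exact: (@homogeneous_mul _ _ 2 d _ _ (free_lie_homogeneous (free_f i)) (hw i)).
Qed.

Let scaleAr : forall (a : K) u v, u * (a *: v) = a *: (u * v) := @ncscaleAr K n.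

Lemma homogeneous_assoc_gen D B d u : (0 < D)%N -> graded_basis D B -> H d u ->
  assoc_gen I B d u.
Proof.
move=> D0 [_ _ BS]; elim: d u => [|d IHd] u /=.
  by move=> [a ->]; apply: AssocZ; apply: Assoc1.
move=> [v hv ->].
have sG : subspace (assoc_gen I B d.+1).
  by split; [apply/AssocIdeal/assoc_ideal0 | apply: AssocD | apply: AssocZ].
apply: (subspace_sum _ sG) => j _; apply: (@assoc_gen_mul _ _ H I _ _ B 1 d) => //.
- exact: assoc_ideal_subspace.
- exact: assoc_ideal_mulr.
- apply: (in_span_sub (assoc_ideal_subspace f) (lie_ideal_assoc free_f)).
  by apply: BS => //; apply: FreeLieVar.
- exact: IHd.
Qed.

(** Variables have degree 1, hence are combinations of [B] modulo the ideal; so [B] generates A, and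
    straightening leaves only ordered monomials. *)
Theorem assoc_dim_le D B d a : (0 < D)%N -> graded_basis D B -> (d <= D)%N ->
  quot_dim (H d) (I d) a -> (a <= deg_count d (monomials D B))%N.
Proof.
move=> D0 BB dD aP; apply: quot_dim_le (assoc_ideal_subspace f d) aP _.
apply: in_span_spanned => u hu.
apply: (monomials_span scaleAr (@homogeneous_subspace K n) (assoc_ideal_subspace f) _ _ _ _ _ (graded_straightening BB) dD).
- by exists 1; rewrite scale1r.
- exact: homogeneous_mul.
- exact: assoc_ideal_homogeneous.
- by move=> e i v w; apply: assoc_ideal_mull.
- by move=> e i v w; apply: assoc_ideal_mulr.
- exact: (homogeneous_assoc_gen D0 BB hu).
Qed.
End LowerBound.

(** * Lower bound for the dimensions *)

Section ExpProducts.
Implicit Types (d e D : nat) (c b : nat -> nat) (q G : {poly rat}).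

Definition odd_series c D : {poly rat} :=
  \prod_(i < D) (if odd i.+1 then (1 + 'X^(i.+1)) ^+ c i.+1 else 1).
Definition even_series c D : {poly rat} :=
  \prod_(i < D) (if odd i.+1 then 1 else (1 - 'X^(i.+1)) ^+ c i.+1).

Lemma eqmod_1DXn_mul D (u v : rat) : (0 < D)%N ->
  eqmod D ((1 + u *: 'X^D) * (1 + v *: 'X^D)) (1 + (u + v) *: 'X^D).
Proof.
move=> D0 i iD; have DD : (D < D + D)%N by lia.
have -> : (1 + u *: 'X^D) * (1 + v *: 'X^D) =
    1 + (u + v) *: 'X^D - 'X^(D + D) * (- (u * v)%:P) :> {poly rat}.
  by rewrite -!mul_polyC exprD polyCD polyCM; ring.
exact: (eqmodMXn _ _ DD).
Qed.

Lemma eqmod_1DXn_exp D (u : rat) k : (0 < D)%N ->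
  eqmod D ((1 + u *: 'X^D) ^+ k) (1 + (k%:R * u) *: 'X^D).
Proof.
move=> D0; elim: k => [|k IHk]; first by rewrite expr0 mul0r scale0r addr0.
have -> : k.+1%:R * u = u + k%:R * u by rewrite -add1n natrD mulrDl mul1r.
rewrite exprS.
exact: eqmod_trans (eqmodMl _ IHk) (eqmod_1DXn_mul _ _ D0).
Qed.

Lemma eqmod_1DXn_pow D k : (0 < D)%N -> eqmod D ((1 + 'X^D) ^+ k) (1 + k%:R *: 'X^D : {poly rat}).
Proof. by move=> D0; have := eqmod_1DXn_exp 1 k D0; rewrite mulr1 scale1r. Qed.

Lemma eqmod_1BXn_pow D k : (0 < D)%N -> eqmod D ((1 - 'X^D) ^+ k) (1 + (- k%:R) *: 'X^D : {poly rat}).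
Proof. by move=> D0; have := eqmod_1DXn_exp (- 1) k D0; rewrite mulrN1 scaleN1r. Qed.

Lemma odd_series0 c D : (odd_series c D)`_0 = 1.
Proof.
rewrite -horner_coef0 horner_prod big1 // => i _; case: ifP => _; rewrite !hornerE //.
by rewrite expr0n /= addr0 expr1n.
Qed.

Lemma even_series0 c D : (even_series c D)`_0 = 1.
Proof.
rewrite -horner_coef0 horner_prod big1 // => i _; case: ifP => _; rewrite !hornerE //.
by rewrite expr0n /= subr0 expr1n.
Qed.

Lemma eq_odd_series c b D : (forall d, (0 < d <= D)%N -> c d = b d) ->
  odd_series c D = odd_series b D.
Proof. by move=> cb; apply: eq_bigr => i _; rewrite cb //=. Qed.

Lemma eq_even_series c b D : (forall d, (0 < d <= D)%N -> c d = b d) ->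
  even_series c D = even_series b D.
Proof. by move=> cb; apply: eq_bigr => i _; rewrite cb //=. Qed.

(** The factors up to degree D cancel. Those of degree D + 1 only count through their first order
    term, and (1 + z^i)^c and (1 - z^i)^(-c) have the same one, so both parities give the same
    difference. *)
Lemma exp_compare D c b q G : (forall d, (0 < d <= D)%N -> c d = b d) ->
  eqmod D.+1 (G * even_series c D.+1) (odd_series c D.+1) ->
  eqmod D.+1 (q * odd_series b D.+1) (even_series b D.+1) ->
  eqmod D.+1 (G * q) (1 + ((c D.+1)%:R - (b D.+1)%:R) *: 'X^(D.+1)).
Proof.
move=> cb; rewrite /odd_series /even_series !big_ord_recr /=.
rewrite -!/(odd_series _ D) -!/(even_series _ D).
rewrite (eq_odd_series cb) (eq_even_series cb).
set Po := odd_series b D; set Pe := even_series b D.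
set oc := (X in eqmod _ _ (Po * X) -> _); set ec := (X in eqmod _ (G * (Pe * X)) _ -> _).
set ob := (X in _ -> eqmod _ (q * (Po * X)) _ -> _); set eb := (X in _ -> eqmod _ _ (Pe * X) -> _).
move=> GE qE.
have P0 : (Pe * Po)`_0 = 1.
  by rewrite coefM big_ord1 subn0 odd_series0 even_series0 mul1r.
have : eqmod D.+1 (ec * ob * (G * q)) (oc * eb).
  apply: (eqmod_cancel P0).
  have := eqmodM GE qE; congr (eqmod _ _ _); ring.
have [e0 eE] : (ec * ob)`_0 = 1 /\
  eqmod D.+1 (ec * ob * (1 + ((c D.+1)%:R - (b D.+1)%:R) *: 'X^(D.+1))) (oc * eb).
  rewrite /ec /ob /oc /eb; case: (~~ odd D) => /=.
    split.
      by rewrite mul1r -horner_coef0 !hornerE expr0n /= addr0 expr1n.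
    rewrite mul1r mulr1; apply: eqmod_trans (eqmodMr _ (eqmod_1DXn_pow _ _)) _ => //.
    apply: eqmod_trans (eqmod_1DXn_mul _ _ _) _ => //.
    by rewrite [X in (1 + X *: _)]addrC subrK; apply/eqmod_sym/eqmod_1DXn_pow.
  split.
    by rewrite mulr1 -horner_coef0 !hornerE expr0n /= subr0 expr1n.
  rewrite mul1r mulr1; apply: eqmod_trans (eqmodMr _ (eqmod_1BXn_pow _ _)) _ => //.
  apply: eqmod_trans (eqmod_1DXn_mul _ _ _) _ => //.
  have -> : - (c D.+1)%:R + ((c D.+1)%:R - (b D.+1)%:R) = - (b D.+1)%:R :> rat by ring.
  exact/eqmod_sym/eqmod_1BXn_pow.
move=> h; apply: (eqmod_cancel e0); apply: eqmod_trans h _; exact: eqmod_sym.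
Qed.
End ExpProducts.

Section CountProducts.
Variable A : Type.
Implicit Types (B : seq (nat * A)) (d D i : nat).

Lemma odd_prod_count D B : eqmod D (odd_prod B) (odd_series (fun d => deg_count d B) D).
Proof.
elim: B => [|[i b] B IHB].
  rewrite /odd_prod big_nil /odd_series big1 // => j _.
  by case: ifP => _ //; rewrite expr0.
have -> : odd_series (fun d => deg_count d ((i, b) :: B)) D =
    (\prod_(j < D) (if (i == j.+1) && odd i then 1 + 'X^i else 1)) *
      odd_series (fun d => deg_count d B) D.
  rewrite /odd_series -big_split /=; apply: eq_bigr => j _; rewrite /deg_count /=.
  case: eqP => [->|_] /=; last by rewrite add0n mul1r.
  by case: ifP => _; rewrite ?mulr1 // add1n exprS.
rewrite odd_prod_cons; apply: eqmodM => // {IHB}.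
have [oi|oi] := boolP (odd i); last by rewrite big1 // => j _; rewrite andbF.
case: i oi => // i oi; have [iD|Di] := ltnP i D.
  rewrite (bigD1 (Ordinal iD)) //= eqxx big1 ?mulr1 // => j.
  by rewrite -val_eqE eq_sym eqSS /= => /negPf ->.
rewrite big1 => [|j _]; last by rewrite eqSS gtn_eqF // (leq_trans (ltn_ord j)).
have -> : 1 + 'X^(i.+1) = 1 - 'X^(i.+1) * (- 1) :> {poly rat} by ring.
exact: eqmodMXn.
Qed.

Lemma even_prod_count D B : deg_count 0 B = 0%N ->
  eqmod D (even_prod B) (even_series (fun d => deg_count d B) D).
Proof.
elim: B => [|[i b] B IHB] B0.
  rewrite /even_prod big_nil /even_series big1 // => j _.
  by case: ifP => _ //; rewrite expr0.
have -> : even_series (fun d => deg_count d ((i, b) :: B)) D =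
    (\prod_(j < D) (if (i == j.+1) && ~~ odd i then 1 - 'X^i else 1)) *
      even_series (fun d => deg_count d B) D.
  rewrite /even_series -big_split /=; apply: eq_bigr => j _; rewrite /deg_count /=.
  case: eqP => [->|_] /=; last by rewrite add0n mul1r.
  by case: ifP => _; rewrite ?mulr1 // add1n exprS.
have [i0 {}B0] : i != 0%N /\ deg_count 0 B = 0%N.
  by move: B0; rewrite /deg_count /=; case: eqP => //.
rewrite even_prod_cons; apply: eqmodM; last exact: IHB.
have [oi|oi] := boolP (odd i); first by rewrite big1 // => j _; rewrite andbF.
case: i i0 oi => // i _ oi; have [iD|Di] := ltnP i D.
  rewrite (bigD1 (Ordinal iD)) //= eqxx big1 ?mulr1 // => j.
  by rewrite -val_eqE eq_sym eqSS /= => /negPf ->.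
rewrite big1 => [|j _]; last by rewrite eqSS gtn_eqF // (leq_trans (ltn_ord j)).
have -> : 1 - 'X^(i.+1) = 1 - 'X^(i.+1) * 1 :> {poly rat} by rewrite mulr1.
exact: eqmodMXn.
Qed.

(** An element of degree 0 would put the factor 1 - z^0 = 0 into [even_prod]. *)
Lemma exp_inv_deg0 D (q : {poly rat}) B : q`_0 = 1 -> exp_inv D q B -> deg_count 0 B = 0%N.
Proof.
move=> q0 /(_ 0%N (leq0n D)); rewrite coefM big_ord1 subn0 q0 mul1r => qB.
apply/eqP; rewrite -leqn0 leqNgt; apply/negP => B0.
suff even0 : even_prod B = 0.
  move: qB; rewrite even0 coef0 -horner_coef0 horner_prod big1 => [/eqP|p op].
    by rewrite oner_eq0.
  by rewrite !hornerE expr0n; case: (p.1) op => //= _ _; rewrite addr0.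
elim: B B0 {qB} => [//|[i b] B IHB]; rewrite even_prod_cons /deg_count /=.
by case: eqP => [-> _ | _ /IHB ->]; rewrite ?mulr0 //= expr0 subrr mul0r.
Qed.
End CountProducts.

Lemma coef_quadratic_mul n r (p : {poly rat}) d :
  (p * (1 - n%:R *: 'X + r%:R *: 'X^2))`_d =
  p`_d - n%:R * (if d is e.+1 then p`_e else 0) + r%:R * (if d is e.+2 then p`_e else 0).
Proof.
have -> : p * (1 - n%:R *: 'X + r%:R *: 'X^2) = p - n%:R *: (p * 'X) + r%:R *: (p * 'X^2).
  by rewrite mulrDr mulrBr mulr1 -!scalerAr.
rewrite coefD coefB !coefZ coefMX coefMXn.
by case: d => [|[|d]] //=; rewrite subn2.
Qed.

Section LowerBound.
Variables (K : fieldType) (n r : nat) (f : 'I_r -> ncpoly K n).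
Hypothesis free_f : forall i, free_lie 2 (f i).
Hypothesis nr : (4 * r <= n ^ 2)%N.
Local Notation q := (1 - n%:R *: 'X + r%:R *: 'X^2 : {poly rat}).

(* the roots of z^2 - n z + r are real and positive, so that the coefficients of
   1 / (1 - n z + r z^2) are a lower bound for the dimensions a_d *)
Lemma assoc_dim_ge (h : {poly rat}) D d a0 a1 : eqmod D (h * q) 1 -> (d < D)%N ->
  quot_dim (@homogeneous K n d) (assoc_ideal f d) a0 ->
  quot_dim (@homogeneous K n d.+1) (assoc_ideal f d.+1) a1 ->
  0 <= a0%:R - h`_d /\ n%:R / 2 * (a0%:R - h`_d) <= a1%:R - h`_d.+1.
Proof.
move=> hq; elim: d a0 a1 => [|d IHd] a0 a1 dD a0P a1P.
  have := hq 0%N (leq0n D); have := hq 1%N dD; rewrite !coef_quadratic_mul !coef1 /=.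
  rewrite (assoc_dim0 a0P) !mulr0 !addr0 ?subr0 => h1 h0; rewrite h0 mulr1 in h1.
  have := golod_shafarevich1 a1P; rewrite -(ler_nat rat) h0 => na1.
  by split; lra.
have [a aP] := assoc_dim_exists f d.
have [g0 g1] := IHd _ _ (ltnW dD) aP a0P.
have := golod_shafarevich free_f aP a0P a1P; rewrite -(ler_nat rat) natrD !natrM => gs.
have := hq d.+2 dD; rewrite coef_quadratic_mul coef1 /= => h2.
have n0 : 0 <= n%:R :> rat by rewrite ler0n.
have nr' : 4 * r%:R <= n%:R * n%:R :> rat by rewrite -!natrM ler_nat mulnn.
(* With g_d = a_d - h_d one has g_(d+2) >= n g_(d+1) - r g_d, and g_(d+1) >= (n / 2) g_d bounds this
   below by (n / 2) g_(d+1) + (n^2 / 4 - r) g_d. *)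
by split; nra.
Qed.

Lemma monomials_exp D C (N : nat -> nat) : graded_basis f D C ->
  (forall d, (0 < d <= D)%N -> deg_count d C = N d) ->
  eqmod D (gen_poly (monomials D C) * even_series N D) (odd_series N D).
Proof.
case=> _ Cpos _ CN; have C0 p : p \in C -> (0 < p.1)%N by case/Cpos => /andP[].
rewrite -(eq_even_series CN) -(eq_odd_series CN).
have C00 : deg_count 0 C = 0%N.
  apply/eqP; rewrite -leqn0 leqNgt -has_count; apply/hasP => -[p /C0]; by case: (p.1).
apply: (eqmod_trans (q := gen_poly (monomials D C) * even_prod C)).
  by apply: eqmodMl; apply: eqmod_sym; apply: even_prod_count.
apply: (eqmod_trans (q := odd_prod C)); last exact: odd_prod_count.
exact: gen_poly_monomials C0.
Qed.

(** Induction on [D]: if the dimensions agree below the top degree, [exp_compare] shows that the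
    count of ordered monomials differs from 1 / q by x z^(D+1) at first order, and the two bounds on
    the associative dimension force x >= 0. *)
Theorem graded_dims_ge (A : Type) (B : seq (nat * A)) (N : nat -> nat) D :
  exp_inv D q B ->
  (forall d, (0 < d <= D)%N -> quot_dim (@free_lie K n d) (lie_ideal f d) (N d)) ->
  (forall d, (0 < d <= D)%N -> (N d <= deg_count d B)%N) ->
  forall d, (0 < d <= D)%N -> N d = deg_count d B.
Proof.
elim: D => [|D IHD] qB NP NB d; first by case: d.
have q0 : q`_0 = 1.
  by have := coef_quadratic_mul n r 1 0; rewrite mul1r => ->; rewrite coef1 /=; ring.
have {}IHD : forall d, (0 < d <= D)%N -> N d = deg_count d B.
  apply: IHD => [|e eD|e eD]; first exact: eqmod_le qB.
    by apply: NP; lia.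
  by apply: NB; lia.
move=> dD; have [dD' | Dd] := leqP d D; first by apply: IHD; lia.
have {dD Dd}-> : d = D.+1 by lia.
have [C CP CN] := graded_basis_exists NP.
set G := gen_poly (monomials D.+1 C); have GE := monomials_exp CP CN.
have qE : eqmod D.+1 (q * odd_series (fun d => deg_count d B) D.+1)
    (even_series (fun d => deg_count d B) D.+1).
  apply: (eqmod_trans (q := q * odd_prod B)).
    by apply: eqmodMl; apply: eqmod_sym; apply: odd_prod_count.
  by apply: (eqmod_trans qB); apply/even_prod_count/(exp_inv_deg0 q0 qB).
have Gq := exp_compare IHD GE qE.
pose x : rat := (N D.+1)%:R - (deg_count D.+1 B)%:R; rewrite -/x in Gq.
(* Removing the error term from [G] gives the truncation of 1 / q, to which [assoc_dim_ge]
   applies. *)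
pose h : {poly rat} := G - x *: 'X^(D.+1).
have hq : eqmod D.+1 (h * q) 1.
  move=> i iD; rewrite mulrBl coefB Gq // coefD -scalerAl [X in _ - X]coefZ coefXnM.
  rewrite coefZ coefXn; case: ltngtP iD => [_ _|//|-> _]; first by rewrite !mulr0 addr0 subr0.
  by rewrite subnn q0 !mulr1 addrK.
have [a aP] := assoc_dim_exists f D; have [a' a'P] := assoc_dim_exists f D.+1.
have [g0 g1] := assoc_dim_ge hq (ltnSn D) aP a'P.
have := assoc_dim_le free_f (ltn0Sn D) CP (leqnn _) a'P.
rewrite -(ler_nat rat) -coef_gen_poly -/G => a'G.
have hE : h`_D.+1 = G`_D.+1 - x by rewrite coefB coefZ coefXn eqxx mulr1.
rewrite hE in g1.
have x0 : 0 <= x.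
  have : 0 <= n%:R / 2 * (a%:R - h`_D) by rewrite mulr_ge0 // divr_ge0 // ler0n.
  by move: g1 a'G; lra.
apply/eqP; rewrite eqn_leq NB ?leqnn //=.
by rewrite -(ler_nat rat) -subr_ge0.
Qed.
End LowerBound.

(** * The operator Log *)

Section Moebius.
Implicit Types (p q m d : nat).

Lemma moebius_mul_prime p q : prime p -> (0 < q)%N -> ~~ (p %| q)%N ->
  moebius (p * q) = - moebius q.
Proof.
move=> pp q0 pq; have p0 := prime_gt0 pp.
have logp : logn p q = 0%N by apply/eqP; rewrite -leqn0 leqNgt logn_gt0 mem_primes pp q0.
have perm : perm_eq (primes (p * q)) (p :: primes q).
  apply: uniq_perm; first exact: primes_uniq.
    by rewrite /= primes_uniq mem_primes (negPf pq) !andbF.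
  by move=> l; rewrite inE primesM // primes_prime // inE.
rewrite /moebius (perm_all _ perm) (perm_size perm) /= lognM // logn_prime // eqxx logp /=.
rewrite (eq_in_all (a2 := fun l => logn l q == 1%N)); last first.
  move=> l; rewrite mem_primes => /and3P[pl _ lq]; rewrite lognM // logn_prime //.
  by case: (eqVneq l p) => // lp; rewrite -lp lq in pq.
by case: all; rewrite ?oppr0 // exprS mulN1r.
Qed.

Lemma moebius_sq p q : (1 < logn p q)%N -> moebius q = 0.
Proof.
move=> pq; rewrite /moebius; case: ifP => // /allP /(_ p).
rewrite -logn_gt0 (ltn_trans _ pq) // => /(_ isT) /eqP p1.
by rewrite p1 in pq.
Qed.

(** For a prime divisor p of m, each divisor q prime to p cancels against p q, and divisors of
    higher p-valuation contribute 0. *)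
Lemma sum_moebius m : (0 < m)%N -> \sum_(q <- divisors m) moebius q = (m == 1%N)%:R.
Proof.
move=> m0; have [->|m1] := eqVneq m 1%N; first by rewrite /divisors /= big_seq1.
have pp : prime (pdiv m) by apply: pdiv_prime; lia.
set p := pdiv m in pp; have p0 := prime_gt0 pp.
rewrite (bigID (fun q => logn p q == 0%N)) /=.
rewrite [X in _ + X](bigID (fun q => logn p q == 1%N)) /=.
rewrite [X in _ + (_ + X)]big1 ?addr0 => [|q /andP[l0 l1]]; last first.
  by apply: (@moebius_sq p); case: (logn p q) l0 l1 => [|[|k]].
have perm : perm_eq [seq q <- divisors m | (logn p q != 0%N) && (logn p q == 1%N)]
    [seq (p * q)%N | q <- [seq q <- divisors m | logn p q == 0%N]].
  apply: uniq_perm; first by rewrite filter_uniq // divisors_uniq.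
    rewrite map_inj_in_uniq ?filter_uniq ?divisors_uniq // => a b _ _ /eqP.
    by rewrite eqn_pmul2l // => /eqP.
  move=> x; rewrite mem_filter -dvdn_divisors //; apply/idP/mapP => [|[y]].
    case/andP=> /andP[_ /eqP lx] xm; have x0 : (0 < x)%N by apply: dvdn_gt0 xm.
    have px : (p %| x)%N.
      by have := logn_gt0 p x; rewrite lx mem_primes /= => /esym/and3P[].
    exists (x %/ p)%N; last by rewrite mulnC divnK.
    rewrite mem_filter -dvdn_divisors // logn_div // lx logn_prime // eqxx /=.
    by apply: dvdn_trans xm; apply: dvdn_div.
  rewrite mem_filter -dvdn_divisors // => /andP[/eqP ly ym] ->.
  have y0 : (0 < y)%N by apply: dvdn_gt0 ym.
  rewrite lognM // ly logn_prime // eqxx /= Gauss_dvd ?pdiv_dvd //.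
  rewrite prime_coprime //; apply/negP => py.
  by have := logn_gt0 p y; rewrite ly mem_primes pp y0 py.
rewrite -[X in _ + X]big_filter (perm_big _ perm) big_map big_filter /=.
rewrite big_seq_cond [X in _ + X]big_seq_cond -big_split big1 //= => q.
rewrite -dvdn_divisors // => /andP[qm /eqP lq]; have q0 : (0 < q)%N by apply: dvdn_gt0 qm.
rewrite moebius_mul_prime ?addrN //; apply/negP => pq.
by have := logn_gt0 p q; rewrite lq mem_primes pp q0 pq.
Qed.

Lemma sum_moebius_le D m : (0 < m <= D)%N ->
  \sum_(1 <= q < D.+1 | (q %| m)%N) moebius q = (m == 1%N)%:R.
Proof.
case/andP=> m0 mD; rewrite -sum_moebius // -big_filter; apply: perm_big.
apply: uniq_perm; rewrite ?filter_uniq ?iota_uniq ?divisors_uniq // => q.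
rewrite mem_filter mem_index_iota -dvdn_divisors //; case: (boolP (q %| m)%N) => //= qm.
by rewrite (dvdn_gt0 m0 qm) ltnS (leq_trans (dvdn_leq m0 qm) mD).
Qed.

Lemma moebius_inversion (g : nat -> rat) d : (0 < d)%N ->
  \sum_(1 <= q < d.+1 | (q %| d)%N) moebius q * (\sum_(1 <= i < d.+1 | (i %| d %/ q)%N) g i) = g d.
Proof.
move=> d0.
have -> : \sum_(1 <= q < d.+1 | (q %| d)%N) moebius q * (\sum_(1 <= i < d.+1 | (i %| d %/ q)%N) g i) =
  \sum_(1 <= q < d.+1) \sum_(1 <= i < d.+1 | (i * q %| d)%N) moebius q * g i.
  rewrite big_mkcond; apply: eq_big_nat => q q1; have [qd|qd] := boolP (q %| d)%N.
    rewrite mulr_sumr; apply: eq_bigl => i.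
    by rewrite -{2}(divnK qd) dvdn_pmul2r //; case/andP: q1.
  rewrite big1 // => i iq; case/negP: qd; apply: dvdn_trans iq; exact: dvdn_mull.
rewrite (exchange_big_dep_nat predT) //=.
have E i : (1 <= i < d.+1)%N -> \sum_(1 <= q < d.+1 | (i * q %| d)%N) moebius q * g i =
    (i == d)%:R * g i.
  move=> i1; rewrite -mulr_suml; congr (_ * _).
  have [id|id] := boolP (i %| d)%N; last first.
    rewrite big1 => [|q iq]; last by case/negP: id; apply: dvdn_trans iq; apply: dvdn_mulr.
    by case: eqP => // e; rewrite e dvdnn in id.
  have i0 : (0 < i)%N by case/andP: i1.
  rewrite (eq_bigl (fun q => q %| d %/ i)%N) => [|q]; last first.
    by rewrite -{1}(divnK id) mulnC dvdn_pmul2r.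
  rewrite sum_moebius_le; last by rewrite leq_div divn_gt0 // (dvdn_leq d0 id).
  congr (nat_of_bool _)%:R; by rewrite -(eqn_pmul2r i0) divnK // mul1n eq_sym.
rewrite (eq_big_nat _ _ E) (bigD1_seq d) ?mem_index_iota ?iota_uniq ?d0 ?ltnSn //=.
by rewrite eqxx mul1r big1 ?addr0 // => i /negPf ->; rewrite mul0r.
Qed.
End Moebius.

(** * Logarithms of truncated series and inversion of Exp *)

Section Logarithm.
Implicit Types (D d i k q : nat) (p u l : {poly rat}) (V a : series).

(** The Euler operator z d/dz. It multiplies the coefficient of z^d by d, so in characteristic 0 it
    determines a series up to its constant term. *)
Definition theta p : {poly rat} := 'X * p^`().

Lemma coef_theta p d : (theta p)`_d = d%:R * p`_d.
Proof.
by rewrite /theta coefXM; case: d => [|d]; rewrite ?mul0r // coef_deriv mulr_natl.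
Qed.

Lemma eqmod_theta D p u : eqmod D p u -> eqmod D (theta p) (theta u).
Proof. by move=> pu i iD; rewrite !coef_theta pu. Qed.

Lemma thetaM p u : theta (p * u) = theta p * u + p * theta u.
Proof. by rewrite /theta derivM; ring. Qed.

Lemma thetaD p u : theta (p + u) = theta p + theta u.
Proof. by rewrite /theta derivD mulrDr. Qed.

Lemma thetaN p : theta (- p) = - theta p.
Proof. by rewrite /theta derivN mulrN. Qed.

(** Characterizes log p by its logarithmic derivative, cleared of the denominator; products,
    quotients and substitutions are then checked without expanding logarithms. *)
Definition is_log D p l : Prop := l`_0 = 0 /\ eqmod D (p * theta l) (theta p).

Lemma is_log_unique D p l l' : p`_0 = 1 -> is_log D p l -> is_log D p l' -> eqmod D l l'.
Proof.
move=> p0 [l0 pl] [l0' pl'] [|i] iD; first by rewrite l0 l0'.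
have /(_ i.+1 iD) := eqmod_cancel p0 (eqmod_trans pl (eqmod_sym pl')).
by rewrite !coef_theta => /mulfI; apply; rewrite pnatr_eq0.
Qed.

Lemma is_log_eqmod D p p' l l' : eqmod D p p' -> eqmod D l l' -> is_log D p l -> is_log D p' l'.
Proof.
move=> pp ll [l0 pl]; split; first by rewrite -ll.
apply: eqmod_trans (eqmod_theta pp); apply: eqmod_trans pl.
by apply: eqmodM; apply: eqmod_sym => //; apply: eqmod_theta.
Qed.

Lemma is_log1 D : is_log D 1 0.
Proof. by split; rewrite ?coef0 // /theta deriv0 derivC !mulr0. Qed.

Lemma is_logM D p p' l l' : is_log D p l -> is_log D p' l' -> is_log D (p * p') (l + l').
Proof.
move=> [l0 pl] [l0' pl']; split; first by rewrite coefD l0 l0' addr0.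
rewrite thetaM thetaD.
have -> : p * p' * (theta l + theta l') = p' * (p * theta l) + p * (p' * theta l') by ring.
by rewrite [theta p * p']mulrC; apply: eqmodD; apply: eqmodMl.
Qed.

Lemma is_log_prod D (I : Type) (s : seq I) (P L : I -> {poly rat}) :
  (forall x, is_log D (P x) (L x)) -> is_log D (\prod_(i <- s) P i) (\sum_(i <- s) L i).
Proof.
move=> PL; elim: s => [|i s IHs]; first by rewrite !big_nil; apply: is_log1.
by rewrite !big_cons; apply: is_logM.
Qed.

Lemma is_log_exp D p l k : is_log D p l -> is_log D (p ^+ k) (l *+ k).
Proof.
move=> pl; elim: k => [|k IHk]; first exact: is_log1.
by rewrite exprS mulrS; apply: is_logM.
Qed.

Lemma is_log_div D p (s : {poly rat}) u l (m : {poly rat}) : s`_0 = 1 -> eqmod D (u * s) p ->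
  is_log D p l -> is_log D s m -> is_log D u (l - m).
Proof.
move=> s0 us [l0 pl] [m0 sm]; split; first by rewrite coefB l0 m0 subrr.
apply: (eqmod_cancel s0); apply: (eqmod_cancel s0).
have -> : s * (s * (u * theta (l - m))) = s * (u * s * theta l) - u * s * (s * theta m).
  by rewrite thetaD thetaN; ring.
have -> : s * (s * theta u) = s * theta (u * s) - u * s * theta s by rewrite thetaM; ring.
have h1 : eqmod D (s * (u * s * theta l)) (s * theta (u * s)).
  apply: eqmodMl; apply: (eqmod_trans (q := p * theta l)); first exact: eqmodMr.
  by apply: eqmod_trans pl _; apply: eqmod_theta; apply: eqmod_sym.
have h2 : eqmod D (u * s * (s * theta m)) (u * s * theta s) by apply: eqmodMl.
by move=> i iD; rewrite !coefB h1 // h2.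
Qed.

Definition trunc D V : {poly rat} := \poly_(i < D.+1) V i.

Lemma coef_trunc D V i : (i <= D)%N -> (trunc D V)`_i = V i.
Proof. by move=> iD; rewrite coef_poly ltnS iD. Qed.

Lemma trunc_le D d V : (d <= D)%N -> eqmod d (trunc D V) (trunc d V).
Proof. by move=> dD i id; rewrite !coef_trunc // (leq_trans id). Qed.

Lemma eqmod_exp D p u k : eqmod D p u -> eqmod D (p ^+ k) (u ^+ k).
Proof. by move=> pu; elim: k => [//|k IHk]; rewrite !exprS; apply: eqmodM. Qed.

Lemma coef_exp_lt u k d : u`_0 = 0 -> (d < k)%N -> (u ^+ k)`_d = 0.
Proof.
move=> u0; elim: k d => [//|k IHk] d dk; rewrite exprS coefM big1 // => j _.
have [j0|j0] := posnP j; first by rewrite j0 u0 mul0r.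
by rewrite IHk ?mulr0 //; have := ltn_ord j; lia.
Qed.

Lemma comp_trunc D a u : trunc D a \Po u = \sum_(i < D.+1) a i *: u ^+ i.
Proof.
rewrite /trunc poly_def raddf_sum /=; apply: eq_bigr => i _.
by rewrite comp_polyZ comp_Xn_poly.
Qed.

Lemma series_compE D a V d : V 0%N = 0 -> (d <= D)%N ->
  series_comp a V d = (trunc D a \Po trunc D V)`_d.
Proof.
move=> V0 dD; rewrite /series_comp -!/(trunc d _) !comp_trunc !coef_sum.
have t0 e : (trunc e V)`_0 = 0 by rewrite coef_trunc.
rewrite -(subnKC dD) -addSn big_split_ord /= [X in _ = _ + X]big1 ?addr0 => [|i _]; last first.
  by rewrite coefZ coef_exp_lt ?mulr0 //; lia.
apply: eq_bigr => i _; rewrite !coefZ; congr (_ * _).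
by apply: (eqmod_exp _ _ (leqnn d)); apply: eqmod_sym; apply: trunc_le; rewrite leq_addr.
Qed.
End Logarithm.

Section Logarithm.
Implicit Types (D d i k q : nat) (p u l : {poly rat}) (V a : series).

Lemma eqmod0M D (p u : {poly rat}) e : (forall i, (i < e)%N -> p`_i = 0) ->
  (forall i, (i + e <= D)%N -> u`_i = 0) -> eqmod D (p * u) 0.
Proof.
move=> p0 u0 i iD; rewrite coef0 coefM big1 // => j _.
have [je|ej] := ltnP j e; first by rewrite p0 // mul0r.
by rewrite u0 ?mulr0 //; have := ltn_ord j; lia.
Qed.

Lemma geometric_sum u D : (1 + u) * (\sum_(i < D) (-1) ^+ i *: u ^+ i) = 1 - (- u) ^+ D.
Proof.
rewrite (eq_bigr (fun i : 'I_D => (- u) ^+ i)) => [|i _]; last first.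
  by rewrite -scaleN1r exprZn.
by rewrite -[1 - _]opprB subrX1 -mulNr opprB opprK.
Qed.

Lemma trunc_sub_one V D : V 0%N = 1 -> eqmod D (trunc D V) (1 + trunc D (sub_one V)).
Proof.
move=> V0 i iD; rewrite coefD coef1 !coef_trunc // /sub_one.
by rewrite addrC subrK.
Qed.

Lemma trunc_sub_one0 V D : V 0%N = 1 -> (trunc D (sub_one V))`_0 = 0.
Proof. by move=> V0; rewrite coef_trunc // /sub_one V0 subrr. Qed.

Lemma trunc_comp D a V : V 0%N = 0 ->
  eqmod D (trunc D (series_comp a V)) (trunc D a \Po trunc D V).
Proof. by move=> V0 i iD; rewrite coef_trunc // (series_compE _ V0 iD). Qed.

Lemma series_invP D V : V 0%N = 1 -> eqmod D (trunc D (series_inv V) * trunc D V) 1.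
Proof.
move=> V0; have U0 : sub_one V 0%N = 0 by rewrite /sub_one V0 subrr.
apply: (eqmod_trans (eqmodM (trunc_comp _ U0) (trunc_sub_one V0))).
set u := trunc D (sub_one V); rewrite comp_trunc mulrC geometric_sum.
move=> i iD; rewrite coefB coef_exp_lt ?subr0 //.
by rewrite coefN trunc_sub_one0 // oppr0.
Qed.

Lemma series_log_is_log D V : V 0%N = 1 -> is_log D (trunc D V) (trunc D (series_log V)).
Proof.
move=> V0; have U0 : sub_one V 0%N = 0 by rewrite /sub_one V0 subrr.
apply: is_log_eqmod (eqmod_sym (trunc_sub_one V0)) (eqmod_sym (trunc_comp _ U0)) _.
set u := trunc D (sub_one V); pose a m : rat := (-1) ^+ m.+1 / m%:R.
have u0 : u`_0 = 0 by apply: trunc_sub_one0.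
split.
  by rewrite -horner_coef0 horner_comp [u.[0]]horner_coef0 u0 horner_coef0 coef_trunc // invr0 mulr0.
have dA : (trunc D a)^`() \Po u = \sum_(i < D) (-1) ^+ i *: u ^+ i.
  have -> : (trunc D a)^`() = \poly_(i < D) (-1) ^+ i.
    apply/polyP => i; rewrite coef_deriv !coef_poly ltnS; case: ifP => _; last by rewrite mul0rn.
    by rewrite /a -[(_ / _) *+ _]mulr_natr mulfVK ?pnatr_eq0 // !exprS !mulN1r opprK.
  rewrite poly_def raddf_sum /=; apply: eq_bigr => i _.
  by rewrite comp_polyZ comp_Xn_poly.
rewrite /theta deriv_comp -/a dA.
have -> : (1 + u) * ('X * ((\sum_(i < D) (-1) ^+ i *: u ^+ i) * u^`())) =
    'X * u^`() - (- u) ^+ D * ('X * u^`()).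
  by rewrite -[RHS]mul1r; transitivity ((1 + u) * (\sum_(i < D) (-1) ^+ i *: u ^+ i) * ('X * u^`()));
    [ring | rewrite geometric_sum; ring].
have z : eqmod D ((- u) ^+ D * ('X * u^`())) 0.
  apply: (@eqmod0M _ _ _ D) => i iD; first by rewrite coef_exp_lt // coefN u0 oppr0.
  have {iD}-> : i = 0%N by lia.
  by rewrite coefXM eqxx.
by move=> i iD; rewrite coefB z // coef0 subr0 derivD derivC add0r.
Qed.

Lemma coef_comp_scaleXn q (s : rat) p d : (0 < q)%N ->
  (p \Po (s *: 'X^q))`_d = if (q %| d)%N then s ^+ (d %/ q) * p`_(d %/ q) else 0.
Proof.
move=> q0; rewrite comp_polyE coef_sum.
rewrite (eq_bigr (fun i : 'I_(size p) => if d == (q * i)%N then s ^+ i * p`_i else 0)); last first.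
  move=> i _; rewrite exprZn -exprM !coefZ coefXn; case: eqP => _; rewrite ?mulr0 // mulr1.
  exact: mulrC.
case: ifP => [qd|qd]; last first.
  by rewrite big1 // => i _; case: eqP => // e; rewrite e dvdn_mulr in qd.
have [lt|ge] := ltnP (d %/ q) (size p).
  rewrite (bigD1 (Ordinal lt)) //= mulnC divnK // eqxx big1 ?addr0 // => i.
  rewrite -val_eqE /= => ne; case: eqP => // e; case/negP: ne.
  by rewrite e mulKn.
rewrite nth_default // mulr0 big1 // => i _; case: eqP => // e.
by move: ge; rewrite e mulKn // leqNgt ltn_ord.
Qed.

Lemma is_log_comp D p l q (s : rat) : (0 < q)%N -> is_log D p l ->
  is_log D (p \Po (s *: 'X^q)) (l \Po (s *: 'X^q)).
Proof.
move=> q0 [l0 pl]; split; first by rewrite coef_comp_scaleXn // dvdn0 div0n l0 mulr0.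
have thetaE f : theta (f \Po (s *: 'X^q)) = q%:R *: (theta f \Po (s *: 'X^q)).
  apply/polyP => d; rewrite coefZ coef_theta !coef_comp_scaleXn // coef_theta.
  case: ifP => [qd|_]; last by rewrite !mulr0.
  by rewrite mulrCA [in RHS]mulrCA; congr (_ * _); rewrite mulrA -natrM mulnC divnK.
rewrite !thetaE -scalerAr -comp_polyM => i iD; rewrite !coefZ !coef_comp_scaleXn //.
by rewrite pl //; apply: leq_trans iD; apply: leq_div.
Qed.

(** Logarithm commutes with the substitution of (-1)^(q+1) z^q for z, so the coefficient can be read
    from any logarithm [l] of [V]. *)
Lemma series_log_adams D V l q : V 0%N = 1 -> (0 < q)%N -> is_log D (trunc D V) l ->
  series_log (series_adams q V) D =
    if (q %| D)%N then ((-1) ^+ q.+1) ^+ (D %/ q) * l`_(D %/ q) else 0.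
Proof.
move=> V0 q0 Vl; set s : rat := (-1) ^+ q.+1.
have A0 : series_adams q V 0%N = 1 by rewrite /series_adams dvdn0 div0n V0 mulr1.
have VA : eqmod D (trunc D V \Po (s *: 'X^q)) (trunc D (series_adams q V)).
  move=> i iD; rewrite coef_comp_scaleXn // !coef_trunc //.
  exact: leq_trans (leq_div i q) iD.
have := is_log_eqmod VA (eqmod_refl _) (is_log_comp s q0 Vl).
move/(is_log_unique _ (series_log_is_log D A0)) => /(_ _ D (leqnn D)).
rewrite !coef_trunc // => -> //.
exact: coef_comp_scaleXn.
Qed.

(* log (1 + z^i) for i odd, and - log (1 - z^i) for i even *)
Definition log_factor D i : {poly rat} :=
  \poly_(d < D.+1) (if (i %| d)%N then (-1) ^+ (d + i) * i%:R / d%:R else 0).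

Lemma coef_theta_log_factor D i d : (d <= D)%N ->
  (theta (log_factor D i))`_d = if (0 < d)%N && (i %| d)%N then (-1) ^+ (d + i) * i%:R else 0.
Proof.
move=> dD; rewrite coef_theta coef_poly ltnS dD.
case: d dD => [|d] dD; first by rewrite mul0r.
case: ifP => _ /=; last by rewrite mulr0.
by rewrite mulrC mulfVK // pnatr_eq0.
Qed.

Lemma is_log_factor D i : (0 < i)%N ->
  is_log D (1 - (-1) ^+ i *: 'X^i) (- (-1) ^+ i *: log_factor D i).
Proof.
move=> i0; split; first by rewrite coefZ coef_poly /= dvdn0 invr0 !mulr0.
move=> d dD; rewrite mulrBl mul1r coefB -scalerAl coefZ coefXnM.
have thetaZ (x : rat) p : theta (x *: p) = x *: theta p by rewrite /theta derivZ scalerAr.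
rewrite [RHS]coef_theta [in RHS]coefB coef1 [in RHS]coefZ coefXn !thetaZ !coefZ coef_theta_log_factor //.
have sgn2 k : (-1) ^+ k * (-1) ^+ k = 1 :> rat by rewrite -exprMn mulrNN mul1r expr1n.
case: (ltngtP d i) => [di|id|di]; last subst d.
- case: d di {dD} => [|d] di; first by rewrite /= !(mulr0, mul0r) subr0.
  by rewrite /= gtnNdvd // !(mulr0, subr0).
- have d0 : (0 < d)%N by apply: leq_ltn_trans id.
  rewrite coef_theta_log_factor; last by apply: leq_trans dD; apply: leq_subr.
  rewrite d0 subn_gt0 id /= dvdn_subl ?(ltnW id) // gtn_eqF // !(mulr0, subr0).
  case: ifP => _; last by rewrite !(mulr0, subr0).
  rewrite subnK ?(ltnW id) // exprD.
  by ring.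
- rewrite subnn dvdnn i0 /= coef_theta_log_factor //= !(mulr0, subr0) gtn_eqF //.
  by rewrite exprD sgn2 mul1r mulr1 sub0r mulrC.
Qed.

Lemma is_logN_factor D i : (0 < i)%N -> ~~ odd i -> is_log D (1 - 'X^i) (- log_factor D i).
Proof.
move=> i0 oi; have := is_log_factor D i0.
by rewrite -signr_odd (negPf oi) expr0 scale1r scaleN1r.
Qed.

Lemma is_logP_factor D i : (0 < i)%N -> odd i -> is_log D (1 + 'X^i) (log_factor D i).
Proof.
move=> i0 oi; have := is_log_factor D i0.
by rewrite -signr_odd oi expr1 scaleN1r !opprK scale1r.
Qed.

Lemma is_log_exp_inv D (c : nat -> nat) u :
  eqmod D (u * even_series c D) (odd_series c D) ->
  is_log D u (\sum_(i < D) log_factor D i.+1 *+ c i.+1).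
Proof.
move=> uc; pose L i := log_factor D i.+1 *+ c i.+1.
have -> : \sum_(i < D) L i = \sum_(i < D) (if odd i.+1 then L i else 0) -
    \sum_(i < D) (if odd i.+1 then 0 else - L i).
  by rewrite -sumrB; apply: eq_bigr => i _; case: ifP; rewrite ?subr0 // sub0r opprK.
apply: (is_log_div (even_series0 c D) uc).
  apply: is_log_prod => i; case: ifP => [oi|_]; last exact: is_log1.
  by apply/is_log_exp/is_logP_factor.
apply: is_log_prod => i; case: ifP => [_|oi]; first exact: is_log1.
by rewrite /L -mulNrn; apply/is_log_exp/is_logN_factor => //; rewrite oi.
Qed.

(** The coefficient of z^m in log Exp is the sum over i dividing m of (-1)^(m+i) i c_i / m. For d =
    q m the sign (-1)^((q+1) m) of the substitution turns (-1)^(m+i) into (-1)^(d+i), which is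
    independent of q, and Moebius inversion isolates c_d. *)
Theorem series_Log_exp D V (c : nat -> nat) : V 0%N = 1 ->
  eqmod D (trunc D V * even_series c D) (odd_series c D) ->
  forall d, (0 < d <= D)%N -> series_Log V d = (c d)%:R.
Proof.
move=> V0 Vc d /andP[d0 dD].
pose g i : rat := (c i)%:R * ((-1) ^+ (d + i) * i%:R / d%:R).
have -> : (c d)%:R = g d.
  by rewrite /g exprD -expr2 -exprM mulnC exprM sqrrN !expr1n mul1r divff ?mulr1 // pnatr_eq0 -lt0n.
rewrite -(moebius_inversion g d0) /series_Log [RHS]big_mkcond; apply: eq_big_nat => q /andP[q0 qd].
set l := \sum_(i < D) log_factor D i.+1 *+ c i.+1.
have Vl : is_log d (trunc d V) l.
  have [l0 Vl] := is_log_exp_inv Vc; split=> //.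
  apply: (eqmod_trans (q := trunc D V * theta l)).
    by apply: eqmodMr; apply: eqmod_sym; apply: trunc_le.
  by apply: eqmod_trans (eqmod_le dD Vl) _; apply: eqmod_theta; apply: trunc_le.
rewrite (series_log_adams V0 q0 Vl); case: ifP => [dq|_]; last by rewrite mulr0.
set m := (d %/ q)%N; have dE : d = (m * q)%N by rewrite divnK.
have m0 : (0 < m)%N by rewrite divn_gt0 // dvdn_leq.
have mD : (m <= D)%N by apply: leq_trans dD; apply: leq_div.
have lE : l`_m = \sum_(1 <= i < d.+1 | (i %| m)%N) (c i)%:R * ((-1) ^+ (m + i) * i%:R / m%:R).
  rewrite [RHS]big_mkcond; have tail : \sum_(d.+1 <= i < D.+1) (if (i %| m)%N
      then (c i)%:R * ((-1) ^+ (m + i) * i%:R / m%:R) else 0) = 0 :> rat.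
    rewrite big_nat big1 // => i /andP[di _]; rewrite gtnNdvd //.
    by apply: leq_ltn_trans di; apply: leq_div.
  apply: (etrans _ (addr0 _)); apply: (etrans _ (congr1 (+%R _) tail)).
  rewrite -big_cat_nat // big_add1 /= big_mkord /l coef_sum.
  apply: eq_bigr => i _; rewrite coefMn coef_poly ltnS mD.
  by case: ifP => _; rewrite ?mul0rn // mulr_natl.
rewrite lE !mulr_sumr; apply: eq_bigr => i im; rewrite /g.
have q1 : q%:R != 0 :> rat by rewrite pnatr_eq0 -lt0n.
have m1 : m%:R != 0 :> rat by rewrite pnatr_eq0 -lt0n.
have sE : (-1) ^+ (d + i) = ((-1) ^+ q.+1) ^+ m * (-1) ^+ (m + i) :> rat.
  rewrite -exprM -exprD; have -> : (q.+1 * m + (m + i) = 2 * m + (d + i))%N by rewrite dE; lia.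
  by rewrite [RHS]exprD exprM sqrrN !expr1n mul1r.
by rewrite sE dE natrM; field; rewrite q1 m1.
Qed.
End Logarithm.

Section QuadraticLog.
Variables (n r : nat).
Local Notation Q := (quadratic_series n r).
Local Notation V := (series_inv (quadratic_series n r)).
Local Notation q := (1 - n%:R *: 'X + r%:R *: 'X^2 : {poly rat}).

Lemma quadratic_series0 : Q 0%N = 1.
Proof. by rewrite /quadratic_series !coefE /= !mulr0 subr0 addr0. Qed.

Lemma inv_quadratic D : eqmod D (trunc D V * q) 1.
Proof.
apply: eqmod_trans (series_invP quadratic_series0) => //.
by apply: eqmodMl => i iD; rewrite coef_trunc.
Qed.

Lemma inv_quadratic0 : V 0%N = 1.
Proof.
have := inv_quadratic (leqnn 0); rewrite coefM big_ord1 subn0 coef_trunc // coef1 eqxx.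
by rewrite -[q`_0]/(Q 0%N) quadratic_series0 mulr1.
Qed.

Theorem series_Log_quadratic (A : Type) (B : seq (nat * A)) D : exp_inv D q B ->
  forall d, (0 < d <= D)%N -> series_Log V d = (deg_count d B)%:R.
Proof.
move=> qB; have B0 : deg_count 0 B = 0%N := exp_inv_deg0 quadratic_series0 qB.
apply: (series_Log_exp inv_quadratic0 (c := fun d => deg_count d B)).
apply: (eqmod_trans (q := trunc D V * even_prod B)).
  by apply: eqmodMl; apply: eqmod_sym; apply: even_prod_count.
apply: (eqmod_trans (q := trunc D V * (q * odd_prod B))).
  by apply: eqmodMl; apply: eqmod_sym.
rewrite mulrA; apply: (eqmod_trans (q := 1 * odd_prod B)).
  by apply: eqmodMr; apply: inv_quadratic.
by rewrite mul1r; apply: odd_prod_count.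
Qed.

(** If 1 - n z + r z^2 = (1 - u z)(1 - v z), the numerators are the power sums u + v, u^2 + v^2, u^3
    + v^3. *)
Let l : {poly rat} := n%:R *: 'X + ((n%:R ^+ 2 - 2 * r%:R) / 2) *: 'X^2
  + ((n%:R ^+ 3 - 3 * n%:R * r%:R) / 3) *: 'X^3.

Lemma is_log_inv_quadratic d : (d <= 3)%N -> is_log d (trunc d V) l.
Proof.
move=> d3; have : is_log d (trunc d V) (0 - (- l)).
  apply: (is_log_div (p := 1) (s := q)).
  - exact: quadratic_series0.
  - exact: inv_quadratic.
  - exact: is_log1.
  split; first by rewrite /l !coefE /= !mulr0 !addr0 oppr0.
  move=> i iD; rewrite coefM.
  have : (i <= 3)%N by apply: leq_trans iD d3.
  by case: i {iD} => [|[|[|[|]]]] // _; rewrite !big_ord_recl big_ord0 /= !coef_theta /l !coefE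
    /= /bump ?leq0n ?add1n ?(subn0, subSS, subnn); field.
by rewrite sub0r opprK.
Qed.

Lemma series_Log_1 : series_Log V 1 = n%:R.
Proof.
rewrite /series_Log big_nat1 (series_log_adams inv_quadratic0 _ (is_log_inv_quadratic _)) //=.
by rewrite /l !coefE /= /moebius /=; field.
Qed.

Lemma series_Log_2 : series_Log V 2 = (n%:R ^+ 2 + n%:R) / 2 - r%:R.
Proof.
rewrite /series_Log big_nat_recr //= big_nat1.
rewrite !(series_log_adams inv_quadratic0 _ (is_log_inv_quadratic _)) //=.
by rewrite (@moebius_mul_prime 2 1) // /l !coefE /= /moebius /=; field.
Qed.

(** This is n / 3 times n^2 - 1 - 3 r: its sign is the threshold of the theorem. *)
Lemma series_Log_3 : series_Log V 3 = (n%:R ^+ 3 - n%:R) / 3 - n%:R * r%:R.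
Proof.
rewrite /series_Log 2?big_nat_recr //= big_nat1.
rewrite !(series_log_adams inv_quadratic0 _ (is_log_inv_quadratic _)) //=.
by rewrite (@moebius_mul_prime 3 1) // /l !coefE /= /moebius /=; field.
Qed.
End QuadraticLog.

(** * The component of degree 3 *)

Lemma rows_span (K : fieldType) (V : lmodType K) (W : V -> Prop) (E J : finType)
    (M : E -> J -> K) (v : J -> V) : subspace W ->
  (forall e, W (\sum_j M e j *: v j)) ->
  (forall u : J -> K, (forall e, \sum_j u j * M e j = 0) -> forall j, u j = 0) ->
  forall j, W (v j).
Proof.
move=> sW WM Minj j0; have [W0 WD WZ] := sW.
have A_full := row_full_of_injective Minj; set A := \matrix_(_, _) _ in A_full.
have : ((delta_mx 0 (enum_rank j0) : 'rV[K]_#|J|) <= A)%MS by rewrite submx_full.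
case/submxP=> D DE.
have -> : v j0 = \sum_(i < #|E|) D 0 i *: (\sum_j M (enum_val i) j *: v j).
  under eq_bigr do rewrite scaler_sumr.
  rewrite exchange_big /= (bigD1 j0) //= [X in _ + X]big1 ?addr0 => [|j jj0].
    under eq_bigr do rewrite scalerA; rewrite -scaler_suml.
    have := congr1 (fun B : 'rV_#|J| => B 0 (enum_rank j0)) DE; rewrite !mxE !eqxx /=.
    under eq_bigr do rewrite !mxE enum_rankK.
    by move=> <-; rewrite scale1r.
  under eq_bigr do rewrite scalerA; rewrite -scaler_suml.
  have := congr1 (fun B : 'rV_#|J| => B 0 (enum_rank j)) DE; rewrite !mxE.
  under [in RHS]eq_bigr do rewrite !mxE enum_rankK.
  by rewrite (inj_eq enum_rank_inj) (negPf jj0) andbF => <-; rewrite scale0r.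
by apply: (subspace_sum _ sW) => i _; apply: WZ.
Qed.

(** * Generators and Jacobi relations in degrees 1, 2 and 3 *)

Section LowDegrees.
Variables (K : fieldType) (n : nat).
Local Notation T := (ncpoly K n).
Local Notation x := (@ncvar K n).
Implicit Types (u v w : T) (d e : nat).

Definition quad_elt (t : sym_idx n) : T :=
  match t with
  | inl j => x j * x j
  | inr p => sbracket 1 1 (x (val p).1) (x (val p).2)
  end.

Lemma relatorE r (c : coef_idx n r -> K) i : relator c i = \sum_t c (i, t) *: quad_elt t.
Proof. by rewrite big_sumType. Qed.

Lemma quad_elt_upair a b : a != b -> quad_elt (upair a b) = sbracket 1 1 (x a) (x b).
Proof.
wlog ab : a b / (a < b)%N => [wl ab|_].
  move: (ab); rewrite neq_ltn => /orP[|] lt; first exact: wl.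
  rewrite upairC; apply: (etrans (wl b a lt _)); first by rewrite eq_sym.
  exact: (sbracketC 1 1).
by rewrite -[a]/(val (Sub (a, b) ab : {p : 'I_n * 'I_n | (p.1 < p.2)%N})).1
           -[b]/(val (Sub (a, b) ab : {p : 'I_n * 'I_n | (p.1 < p.2)%N})).2 upairE.
Qed.

Lemma quad_elt_free t : free_lie 2 (quad_elt t).
Proof.
case: t => [j|p]; first exact: (@FreeLieSq _ _ 1 _ isT (FreeLieVar _ j)).
exact: (@FreeLieBracket _ _ 1 1 _ _ (FreeLieVar _ _) (FreeLieVar _ _)).
Qed.

Lemma free_lie0 d u : free_lie d u -> d = 0%N -> u = 0.
Proof.
elim=> {d u} [j|d|d u v _ IHu _ IHv|d a u _ IHu|d e u v _ IHu _ IHv|d u od _ IHu] //.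
- by move=> d0; rewrite IHu // IHv // addr0.
- by move=> d0; rewrite IHu // scaler0.
- by move/eqP; rewrite addn_eq0 => /andP[/eqP d0 _]; rewrite IHu // sbracket0l.
- by move/eqP; rewrite addn_eq0 => /andP[/eqP d0 _]; rewrite d0 in od.
Qed.

Lemma bracket_small d e u v : free_lie d u -> free_lie e v ->
  d = 0%N \/ e = 0%N -> sbracket d e u v = 0.
Proof.
by move=> Fu Fv [d0|e0]; [rewrite (free_lie0 Fu d0) sbracket0l | rewrite (free_lie0 Fv e0) sbracket0r].
Qed.

Lemma free_lie1_min (X : T -> Prop) d u : subspace X -> (forall j, X (x j)) ->
  free_lie d u -> d = 1%N -> X u.
Proof.
move=> [X0 XD XZ] Xx; elim=> {d u} [j|d|d u v _ IHu _ IHv|d a u _ IHu|d e u v Fu IHu Fv IHv|d u od _ IHu] //.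
- by move=> d1; apply: XD; [apply: IHu | apply: IHv].
- by move=> d1; apply/XZ/IHu.
- by move=> de; rewrite (bracket_small Fu Fv) //; lia.
- by lia.
Qed.

Lemma free_lie2_min (X : T -> Prop) d u : subspace X -> (forall t, X (quad_elt t)) ->
  free_lie d u -> d = 2%N -> X u.
Proof.
move=> sX Xw; have [X0 XD XZ] := sX.
have X11 u' v : free_lie 1 u' -> free_lie 1 v -> X (sbracket 1 1 u' v).
  move=> Fu Fv; apply: (free_lie1_min (X := fun w => X (sbracket 1 1 w v)) _ _ Fu erefl).
    split=> [|w w' Xu' Xv'|a w Xu']; rewrite ?sbracket0l ?sbracketDl ?sbracketZl //.
      exact: XD.
    exact: XZ.
  move=> j; apply: (free_lie1_min (X := fun w => X (sbracket 1 1 (x j) w)) _ _ Fv erefl).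
    split=> [|w w' Xu' Xv'|a w Xu']; rewrite ?sbracket0r ?sbracketDr ?sbracketZr //.
      exact: XD.
    exact: XZ.
  move=> k; have [<-|jk] := eqVneq j k; last by rewrite -quad_elt_upair.
  by apply: XD; apply: (Xw (inl j)).
elim=> {d u} [j|d|d u v _ IHu _ IHv|d a u _ IHu|d e u v Fu IHu Fv IHv|d u od Fu IHu] //.
- by move=> d1; apply: XD; [apply: IHu | apply: IHv].
- by move=> d1; apply/XZ/IHu.
- move=> de; have [d1 | d1] := eqVneq d 1%N; last first.
    by rewrite (bracket_small Fu Fv) //; move/eqP: d1; lia.
  have e1 : e = 1%N by lia.
  by subst d e; apply: X11.
- move=> dd; have d1 : d = 1%N by lia.
  subst d; suff [] : free_lie 1 u /\ X (u * u) by [].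
  apply: (free_lie1_min (X := fun u => free_lie 1 u /\ X (u * u)) _ _ Fu erefl); last first.
    by move=> j; split; [apply: FreeLieVar | apply: (Xw (inl j))].
  split=> [|v w [Fv Xv] [Fw Xw']|a v [Fv Xv]].
  + by split; [apply: FreeLie0 | rewrite mul0r].
  + split; first exact: FreeLieD.
    apply: (eq_ind_r X _ (mulr_sqD v w)); exact: XD _ _ (XD _ _ Xv (X11 _ _ Fv Fw)) Xw'.
  + by split; [apply: FreeLieZ | rewrite ncscaleAl ncscaleAr; apply/XZ/XZ].
Qed.

Definition cubic_elt j t : T := sbracket 1 2 (x j) (quad_elt t).

(** Squares have even degree and brackets of degrees 2 and 1 are turned around by antisymmetry, so
    only brackets [x_j, w_t] remain. *)
Lemma free_lie3_min (X : T -> Prop) d u : subspace X -> (forall j t, X (cubic_elt j t)) ->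
  free_lie d u -> d = 3%N -> X u.
Proof.
move=> sX Xw; have [X0 XD XZ] := sX.
have X12 u' v : free_lie 1 u' -> free_lie 2 v -> X (sbracket 1 2 u' v).
  move=> Fu Fv; apply: (free_lie1_min (X := fun w => X (sbracket 1 2 w v)) _ _ Fu erefl).
    split=> [|w w' Xu' Xv'|a w Xu']; rewrite ?sbracket0l ?sbracketDl ?sbracketZl //.
      exact: XD.
    exact: XZ.
  move=> j; apply: (free_lie2_min (X := fun w => X (sbracket 1 2 (x j) w)) _ _ Fv erefl).
    split=> [|w w' Xu' Xv'|a w Xu']; rewrite ?sbracket0r ?sbracketDr ?sbracketZr //.
      exact: XD.
    exact: XZ.
  exact: Xw.
elim=> {d u} [j|d|d u v _ IHu _ IHv|d a u _ IHu|d e u v Fu IHu Fv IHv|d u od Fu IHu] //.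
- by move=> d1; apply: XD; [apply: IHu | apply: IHv].
- by move=> d1; apply/XZ/IHu.
- move=> de; have [d1 | d1] := eqVneq d 1%N.
    have e1 : e = 2%N by lia.
    by subst d e; apply: X12.
  have [d2 | d2] := eqVneq d 2%N; last first.
    by rewrite (bracket_small Fu Fv) //; move/eqP: d1; move/eqP: d2; lia.
  have e1 : e = 1%N by lia.
  by subst d e; rewrite sbracketC; apply: (subspaceN sX); apply: X12.
- by lia.
Qed.

(** With the next two lemmas, this gives one relation for each cubic monomial v_a^3, v_a^2 v_b, v_a
    v_b v_d. The signs are all positive because the generators are odd. *)
Lemma jacobi_same a : cubic_elt a (upair a a) = 0.
Proof. by rewrite upairxx; apply: scomm_self_sq. Qed.

Lemma jacobi_square a b : a != b -> cubic_elt b (upair a a) + cubic_elt a (upair a b) = 0.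
Proof.
move=> ab; rewrite upairxx /cubic_elt (quad_elt_upair ab).
have e1 : sbracket 1 2 (x b) (x a * x a) = sbracket 2 1 (sbracket 1 1 (x b) (x a)) (x a).
  exact: (@sbracket_sq _ _ 1 1).
have e2 : sbracket 2 1 (sbracket 1 1 (x b) (x a)) (x a) = - sbracket 1 2 (x a) (sbracket 1 1 (x b) (x a)).
  exact: (sbracketC 2 1).
have e3 : sbracket 1 1 (x b) (x a) = sbracket 1 1 (x a) (x b) by exact: (sbracketC 1 1).
apply: (etrans (congr1 (fun z => z + _) (etrans e1 e2))); rewrite e3; exact: addNr.
Qed.

Lemma jacobi_distinct a b c : a != b -> a != c -> b != c ->
  cubic_elt a (upair b c) + cubic_elt b (upair a c) + cubic_elt c (upair a b) = 0.
Proof.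
move=> ab ac bc; rewrite /cubic_elt (quad_elt_upair ab) (quad_elt_upair ac) (quad_elt_upair bc).
have abs (V : zmodType) (p q s : V) : p = - s - q -> p + q + s = 0.
  by move=> ->; rewrite subrK addNr.
apply: abs; apply: (etrans (@sbracket_jacobi _ _ 1 1 1 _ _ _)).
apply: (congr1 (fun z => z - _)); exact: (sbracketC 2 1).
Qed.
End LowDegrees.

(** * The linear system in degree 3 *)

Section JacobiMatrix.
Variables (n r : nat).
Local Notation J := ('I_n * sym_idx n)%type.
Local Notation E := ('I_n + ('I_n * 'I_n + ('I_n * 'I_n * 'I_n + 'I_n * 'I_r)))%type.

Section Matrix.
Variables (R : comNzRingType) (c : coef_idx n r -> R).

(* The rows are the Jacobi relations among the [x_d, w_t] and the brackets of
   the x_d with the relators. *)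
Definition jacobi_matrix (e : E) (j : J) : R :=
  match e with
  | inl a => (j == (a, upair a a))%:R
  | inr (inl p) => let: (a, b) := p in
      (a != b)%:R * ((j == (b, upair a a))%:R + (j == (a, upair a b))%:R)
  | inr (inr (inl p)) => let: (a, b, d) := p in
      [&& a != b, a != d & b != d]%:R *
      ((j == (a, upair b d))%:R + (j == (b, upair a d))%:R + (j == (d, upair a b))%:R)
  | inr (inr (inr p)) => (j.1 == p.1)%:R * c (p.2, j.2)
  end.
End Matrix.

Lemma rmorph_jacobi_matrix (R S : comNzRingType) (phi : {rmorphism R -> S}) (c : coef_idx n r -> R) e j :
  phi (jacobi_matrix c e j) = jacobi_matrix (phi \o c) e j.
Proof.
by case: e => [a|[[a b]|[[[a b] d]|p]]] /=; rewrite ?(rmorphM, rmorphD, rmorph_nat).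
Qed.

Section Combination.
Variables (K : fieldType) (V : lmodType K) (v : J -> V).

Lemma sum_deltaZ (j0 : J) : \sum_j (j == j0)%:R *: v j = v j0.
Proof.
rewrite (bigD1 j0) //= eqxx scale1r big1 ?addr0 // => j /negPf ->; exact: scale0r.
Qed.

Lemma jacobi_combination (c : coef_idx n r -> K) :
  (forall a, v (a, upair a a) = 0) ->
  (forall a b, a != b -> v (b, upair a a) + v (a, upair a b) = 0) ->
  (forall a b d, a != b -> a != d -> b != d ->
     v (a, upair b d) + v (b, upair a d) + v (d, upair a b) = 0) ->
  forall e, \sum_j jacobi_matrix c e j *: v j =
    if e is inr (inr (inr p)) then \sum_t c (p.2, t) *: v (p.1, t) else 0.
Proof.
move=> v1 v2 v3 [a|[[a b]|[[[a b] d]|[a i]]]] /=.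
- by rewrite sum_deltaZ.
- transitivity ((a != b)%:R *: (v (b, upair a a) + v (a, upair a b))).
    rewrite -(sum_deltaZ (b, upair a a)) -(sum_deltaZ (a, upair a b)) -big_split scaler_sumr /=.
    by apply: eq_bigr => j _; rewrite -scalerDl scalerA.
  by have [//|ab] := eqVneq a b; rewrite ?scale0r // v2 ?scaler0.
- transitivity ([&& a != b, a != d & b != d]%:R *:
      (v (a, upair b d) + v (b, upair a d) + v (d, upair a b))).
    rewrite -(sum_deltaZ (a, upair b d)) -(sum_deltaZ (b, upair a d)) -(sum_deltaZ (d, upair a b)).
    rewrite -!big_split scaler_sumr /=.
    by apply: eq_bigr => j _; rewrite -!scalerDl scalerA.
  case: (boolP [&& _, _ & _]) => [/and3P[ab ae be]|_]; last by rewrite scale0r.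
  by rewrite v3 ?scaler0.
transitivity (\sum_b \sum_t ((b == a)%:R * c (i, t)) *: v (b, t)).
  by rewrite pair_big /=; apply: eq_bigr => -[b t].
rewrite (bigD1 a) //= [X in _ + X]big1 ?addr0 => [|b /negPf ->].
  by apply: eq_bigr => t _; rewrite eqxx mul1r.
by rewrite big1 // => t _; rewrite mul0r scale0r.
Qed.
End Combination.

Section Field.
Variables (K : fieldType) (c : coef_idx n r -> K).

Lemma sum_delta (j0 : J) (u : J -> K) : \sum_j u j * (j == j0)%:R = u j0.
Proof.
rewrite (bigD1 j0) //= eqxx mulr1 big1 ?addr0 // => j /negPf ->; exact: mulr0.
Qed.

(** Puts the condition in the form of an injective matrix with polynomial entries, as required to
    pass from a specialization to the indeterminates. *)
Lemma only_zero_formP : only_zero_form c <->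
  (forall u : J -> K, (forall e, \sum_j u j * jacobi_matrix c e j = 0) -> forall j, u j = 0).
Proof.
have sum2 (b : bool) j1 j2 (u : J -> K) :
    \sum_j u j * (b%:R * ((j == j1)%:R + (j == j2)%:R)) = b%:R * (u j1 + u j2).
  rewrite -(sum_delta j1 u) -(sum_delta j2 u) -big_split mulr_sumr /=.
  by apply: eq_bigr => j _; ring.
have sum3 (b : bool) j1 j2 j3 (u : J -> K) :
    \sum_j u j * (b%:R * ((j == j1)%:R + (j == j2)%:R + (j == j3)%:R)) =
    b%:R * (u j1 + u j2 + u j3).
  rewrite -(sum_delta j1 u) -(sum_delta j2 u) -(sum_delta j3 u) -!big_split mulr_sumr /=.
  by apply: eq_bigr => j _; ring.
have sumr d i (u : J -> K) : \sum_j u j * ((j.1 == d)%:R * c (i, j.2)) = \sum_t u (d, t) * c (i, t).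
  transitivity (\sum_a \sum_t u (a, t) * ((a == d)%:R * c (i, t))).
    by rewrite pair_big /=; apply: eq_bigr => -[a t].
  rewrite (bigD1 d) //= [X in _ + X]big1 ?addr0 => [|a /negPf ->].
    by apply: eq_bigr => t _; rewrite eqxx mul1r.
  by rewrite big1 // => t _; rewrite mul0r mulr0.
split=> [zero u uM [d t] | zero u [u1 u2 u3] uc d t].
  apply: (zero (fun d t => u (d, t))); last first.
    by move=> a i; rewrite -sumr; apply: (uM (inr (inr (inr (a, i))))).
  split=> [a|a b ab|a b e ab ae be].
  - by rewrite -(sum_delta (a, upair a a) u); apply: (uM (inl a)).
  - by have := uM (inr (inl (a, b))); rewrite /= sum2 ab mul1r.
  - by have := uM (inr (inr (inl (a, b, e)))); rewrite /= sum3 ab ae be mul1r.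
apply: (zero (fun j => u j.1 j.2) _ (d, t)) => -[a|[[a b]|[[[a b] e]|[a i]]]] /=.
- by rewrite (sum_delta (a, upair a a) (fun j => u j.1 j.2)) u1.
- rewrite sum2; case: eqVneq => [_|ab]; first by rewrite mul0r.
  by rewrite /= u2 // mulr0.
- rewrite sum3; case: (boolP [&& _, _ & _]) => [/and3P[ab ae be]|_]; last by rewrite mul0r.
  by rewrite /= u3 // mulr0.
- by rewrite (sumr a i (fun j => u j.1 j.2)) /= uc.
Qed.

(** Each row, applied to the brackets [x_d, w_t], gives an element of the ideal; injectivity makes
    the rows span everything, so each single bracket lies in the ideal. *)
Theorem cubic_vanish : only_zero_form c -> component_eq0 c 3.
Proof.
move=> /only_zero_formP Minj u Fu; have sJ := lie_ideal_subspace (relator c) 3.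
apply: (free_lie3_min sJ _ Fu erefl) => d t.
apply: (@rows_span _ _ (lie_ideal (relator c) 3) _ _ (jacobi_matrix c) (fun j => cubic_elt K j.1 j.2) sJ _ Minj (d, t)).
move=> e; rewrite jacobi_combination => [|a|a b ab|a b j ab aj bj] /=.
- case: e => [a|[p|[p|[a i]]]]; try by have [] := sJ.
  apply: (eq_ind_r (lie_ideal (relator c) 3) (lie_ideal_bracketr (LieIdealGen _ i) (FreeLieVar K a))).
  rewrite relatorE (big_morph _ (sbracketDr 1 2 (ncvar K a)) (sbracket0r 1 2 (ncvar K a))).
  by apply: eq_bigr => s _; rewrite sbracketZr.
- exact: jacobi_same.
- exact: jacobi_square.
- exact: jacobi_distinct.
Qed.
End Field.
End JacobiMatrix.

(** A bracket of degree at least 4 has a factor of degree at least 3 unless both factors have degree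
    2; the Jacobi identity rewrites that case through brackets of degree 3. The square of an odd
    element of degree 1 has degree only 2. *)
Lemma cubic_vanish_above (K : fieldType) (n r : nat) (c : coef_idx n r -> K) :
  component_eq0 c 3 -> forall d, (3 <= d)%N -> component_eq0 c d.
Proof.
move=> J3 d d3 u Fu; elim: Fu d3 => {d u} [j|d|d u v _ IHu _ IHv|d a u _ IHu|d e u v Fu IHu Fv IHv|d u od Fu IHu] // d3.
- exact: LieIdeal0.
- by apply: LieIdealD; [apply: IHu | apply: IHv].
- by apply/LieIdealZ/IHu.
- have [d3'|d2] := leqP 3 d; first by apply: LieIdealBracket => //; apply: IHu.
  have [e3'|e2] := leqP 3 e; first by apply: lie_ideal_bracketr => //; apply: IHv.
  have F3 (i k : nat) w z : free_lie i w -> free_lie k z -> (i + k = 3)%N ->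
      lie_ideal (relator c) (i + k) (sbracket i k w z).
    by move=> Fw Fz ik; move: (FreeLieBracket Fw Fz); rewrite ik; apply: J3.
  have [de|de] := eqVneq (d + e)%N 3; first exact: F3.
  have [d2' e2'] : d = 2%N /\ e = 2%N by move/eqP: de; lia.
  subst d e.
  have sJ := lie_ideal_subspace (relator c) 4; have [J0 JD JZ] := sJ.
  apply: (free_lie2_min (X := fun w => lie_ideal (relator c) 4 (sbracket 2 2 u w)) (sbracket_subspacer _ _ _ sJ) _ Fv erefl).
  have br j w : free_lie 1 w -> lie_ideal (relator c) 4 (sbracket 3 1 (sbracket 2 1 u (ncvar K j)) w).
    by move=> Fw; apply: (@LieIdealBracket _ _ _ _ 3 1) => //; apply: (F3 2 1) => //; apply: FreeLieVar.
  case=> [j|p] /=.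
    apply: (eq_ind_r (lie_ideal (relator c) 4) (br j _ (FreeLieVar K j))).
    exact: (@sbracket_sq _ _ 2 1).
  have Fx j := FreeLieVar K (n := n) j.
  apply: (eq_ind_r (lie_ideal (relator c) 4) _ (@sbracket_jacobi _ _ 2 1 1 _ _ _)).
  apply: (JD _ _ (br _ _ (Fx _))).
  apply: (@lie_ideal_bracketr _ _ _ _ 3 1) => //; apply: (F3 2 1) => //; apply: FreeLieVar.
- by apply: LieIdealSq => //; apply: IHu; move: od d3; clear; case: d => [|[|[|d]]].
Qed.

Section GenericVanish.
Variables (k0 : fieldType) (n r : nat).
Local Notation R := (mpoly #|coef_idx n r| k0).
Local Notation K1 := {fraction {poly k0}}.

Let to_frac : {rmorphism {poly k0} -> K1} := @FracField.tofrac {poly k0}.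
Let to_K1 : {rmorphism k0 -> K1} := to_frac \o polyC.

(** Nonconstant powers of t are distinct and avoid all constants, even when [k0] is finite. *)
Let tau (i : nat) : K1 := FracField.tofrac 'X^(i.+1).

Lemma tau_injective : injective tau.
Proof.
move=> i j /eqP; rewrite /tau tofrac_eq => /eqP /(congr1 (fun p : {poly k0} => size p)).
by rewrite !size_polyXn => -[].
Qed.

Lemma tau_neq i : [/\ tau i != 0, tau i != 1, tau i != -1 & tau i != 2].
Proof.
have sz (p : {poly k0}) : (size p <= 1)%N -> 'X^(i.+1) != p.
  by move=> sp; apply/eqP => e; rewrite -e size_polyXn in sp.
split.
- by rewrite -(rmorph0 to_frac) tofrac_eq sz // size_poly0.
- by rewrite -(rmorph1 to_frac) tofrac_eq sz // size_poly1.
- by rewrite -(rmorphN1 to_frac) tofrac_eq sz // size_polyN size_poly1.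
- rewrite -(rmorph_nat to_frac) tofrac_eq sz //.
  by rewrite -polyC_natr size_polyC; case: eqP.
Qed.

Lemma generic_only_zero_form : (0 < n)%N -> (n ^ 2 <= 3 * r + 1)%N ->
  only_zero_form (@generic_coef k0 n r).
Proof.
move=> n0 nr; have [s sP] := exists_only_zero_form tau_injective tau_neq n0 nr.
pose C (t : coef_idx n r) : R := mpolyX k0 (mnm1 (enum_rank t)).
(* The special relators have coefficients in k0(t), so the scalars are extended before
   evaluating. *)
pose ev : {rmorphism R -> K1} := meval (fun i => s (enum_val i)) \o map_mpoly to_K1.
have evC t : ev (C t) = s t.
  rewrite /ev /C /= map_mpolyX mevalXU enum_rankK //.
apply/only_zero_formP => u uM.
have := @specialize_injective R K1 _ ev (@FracField.tofrac R) _ _ (jacobi_matrix C).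
apply.
- by move=> x y /eqP; rewrite tofrac_eq => /eqP.
- move=> v vM; move/only_zero_formP: sP => sP; apply: sP => e.
  rewrite -[RHS](vM e); apply: eq_bigr => j _; congr (_ * _).
  rewrite rmorph_jacobi_matrix.
  by case: e => [a|[p|[p|[a i]]]] //=; rewrite -evC.
- move=> e; rewrite -[RHS](uM e); apply: eq_bigr => j _; congr (_ * _).
  exact: rmorph_jacobi_matrix.
Qed.

Lemma generic_cubic_vanish : (0 < n)%N -> (n ^ 2 <= 3 * r + 1)%N ->
  component_eq0 (@generic_coef k0 n r) 3.
Proof. by move=> n0 nr; apply/cubic_vanish/generic_only_zero_form. Qed.
End GenericVanish.

(** * Dimensions in degrees 1 and 2, and necessity of the bound *)

Section LowDimensions.
Variables (K : fieldType) (n r : nat) (c : coef_idx n r -> K).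
Local Notation T := (ncpoly K n).
Local Notation J := (lie_ideal (relator c)).

Lemma lie_ideal_low d u : J d u -> (d < 2)%N -> u = 0.
Proof.
elim=> {d u} [i|d|d u v _ IHu _ IHv|d a u _ IHu|d e u v Ju IHu Fv|d u od Ju IHu] //.
- by move=> d2; rewrite IHu // IHv // addr0.
- by move=> d2; rewrite IHu // scaler0.
- by move=> de; rewrite IHu ?sbracket0l //; lia.
- by case: d od {Ju IHu} => [|[|d]] //; rewrite ?addnS.
Qed.

Lemma lie_ideal2 d u : J d u -> d = 2%N -> combination (relator c) u.
Proof.
have [C0 CD CZ] := combination_subspace (relator c).
elim=> {d u} [i|d|d u v _ IHu _ IHv|d a u _ IHu|d e u v Ju IHu Fv|d u od Ju IHu] d2.
- exact: combination_mem.
- exact: C0.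
- by apply: CD; [apply: IHu | apply: IHv].
- by apply/CZ/IHu.
- have [d2'|d2'] := ltnP d 2; first by rewrite (lie_ideal_low Ju d2') sbracket0l.
  by rewrite (free_lie0 Fv) ?sbracket0r //; lia.
- by rewrite (lie_ideal_low Ju) ?mul0r //; lia.
Qed.

Lemma quot_dim1 : quot_dim (@free_lie K n 1) (J 1) n.
Proof.
exists (fun j => ncvar K j); split=> [j|u Fu|a Ja i].
- exact: FreeLieVar.
- have [J0 _ _] := lie_ideal_subspace (relator c) 1.
  have [a ->] := free_lie1_min (combination_subspace _) (combination_mem (@ncvar K n)) Fu erefl.
  by exists a; rewrite subrr.
have e : \sum_j ncvar K j * (a j *: 1) = 0.
  rewrite -[RHS](lie_ideal_low Ja) //; apply: eq_bigr => j _.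
  by rewrite ncscaleAr mulr1.
have /eqP := ncvar_free e i; rewrite scaler_eq0 oner_eq0 orbF => /eqP //.
Qed.

Lemma mcoeff_var2 (i j k l : 'I_n) :
  mcoeff (mmul (fmu j) (fmu k)) (ncvar K i * ncvar K l) = ((i == j) && (l == k))%:R.
Proof.
rewrite mcoeff_var_mul mcoeffU; have -> : (fmu l == fmu k) = (l == k).
  by rewrite -val_eqE /= !fmuE eqseq_cons andbT.
by case: eqP; case: eqP.
Qed.

Lemma mcoeff_bracket2 (i j k l : 'I_n) :
  mcoeff (mmul (fmu j) (fmu k)) (sbracket 1 1 (ncvar K i) (ncvar K l)) =
  ((i == j) && (l == k))%:R + ((l == j) && (i == k))%:R.
Proof.
exact: etrans (mcoeffD _ _ _) (congr2 +%R (mcoeff_var2 i j k l) (mcoeff_var2 l j k i)).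
Qed.

Lemma quad_elt_indep (a : sym_idx n -> K) : \sum_t a t *: quad_elt K t = 0 -> forall t, a t = 0.
Proof.
move=> e t.
have coef j k : \sum_s a s * mcoeff (mmul (fmu j) (fmu k)) (quad_elt K s) = 0.
  have := congr1 (mcoeff (mmul (fmu j) (fmu k))) e; rewrite raddf_sum mcoeff0 => e'.
  by apply: (etrans _ e'); apply: eq_bigr => s _; rewrite /= mcoeffZ.
case: t => [i|p].
  rewrite -[RHS](coef i i) (bigD1 (inl i)) //= mcoeff_var2 eqxx mulr1 big1 ?addr0 //.
  case=> [j|q] /= ne.
    have /negPf ji : j != i by apply: contra ne => /eqP ->.
    by rewrite mcoeff_var2 ji mulr0.
  rewrite mcoeff_bracket2; have qi : ((val q).1 == i) && ((val q).2 == i) = false.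
    by apply/negP => /andP[/eqP e1 /eqP e2]; have := valP q; rewrite /= e1 e2 ltnn.
  by rewrite [((val q).2 == i) && _]andbC !qi !addr0 mulr0.
have p12 : (val p).2 == (val p).1 = false.
  by apply/negP => /eqP e1; have := valP p; rewrite /= e1 ltnn.
rewrite -[RHS](coef (val p).1 (val p).2) (bigD1 (inr p)) //= mcoeff_bracket2.
rewrite !eqxx p12 addr0 mulr1 big1 ?addr0 //; case=> [j|q] /= ne.
  rewrite mcoeff_var2; case: eqP => [->|_] /=; last by rewrite mulr0.
  by rewrite eq_sym p12 mulr0.
rewrite mcoeff_bracket2.
have -> : ((val q).1 == (val p).1) && ((val q).2 == (val p).2) = false.
  apply/negP => /andP[/eqP e1 /eqP e2]; case/eqP: ne; congr inr; apply: val_inj.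
  by move: e1 e2; case: (val q) (val p) => [? ?] [? ?] /= -> ->.
have -> : ((val q).2 == (val p).1) && ((val q).1 == (val p).2) = false.
  apply/negP => /andP[/eqP e1 /eqP e2]; have := valP q; have := valP p.
  by rewrite /= e1 e2 => /ltnW; rewrite leqNgt => /negPf ->.
by rewrite !addr0 mulr0.
Qed.

Lemma quad_elt_spans u : free_lie 2 u -> combination (@quad_elt K n) u.
Proof.
by move=> Fu; apply: (free_lie2_min (combination_subspace _) (@combination_mem _ _ _ _) Fu erefl).
Qed.

Lemma quot_dim2_exists : exists m, quot_dim (@free_lie K n 2) (J 2) m.
Proof.
have sJ := lie_ideal_subspace (relator c) 2; have [J0 _ _] := sJ.
have [|m _ mP] := @quot_dim_exists _ _ (@free_lie K n 2) (J 2) #|{: sym_idx n}| sJ; last by exists m.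
apply: (@spannedP _ _ _ _ _ (@quad_elt K n)) => u /quad_elt_spans[a ->].
by exists a; rewrite subrr.
Qed.

(** In degree 2 the ideal is just the span of the relators, of dimension [r] by their
    independence. *)
Lemma quot_dim2 m : lin_indep (relator c) -> quot_dim (@free_lie K n 2) (J 2) m ->
  (m + r = 'C(n.+1, 2))%N.
Proof.
move=> hc [b [Fb bS bI]].
have s0 := zero_subspace T.
pose v (x : 'I_m + 'I_r) : T := match x with inl i => b i | inr i => relator c i end.
have [J0 JD JZ] := lie_ideal_subspace (relator c) 2.
have Jrel (a : 'I_r -> K) : J 2 (\sum_i a i *: relator c i).
  by apply: (subspace_sum _ (lie_ideal_subspace (relator c) 2)) => i _; apply/JZ/LieIdealGen.
rewrite -(card_sym_idx n) -[m]card_ord -[r]card_ord -card_sum; apply/eqP; rewrite eqn_leq.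
apply/andP; split.
  apply: (@indep_mod_fin_le _ _ _ _ _ v (@quad_elt K n) s0) => [a|x].
    rewrite big_sumType /= => e.
    have a0 : forall i, a (inl i) = 0.
      apply: bI; have -> : \sum_i a (inl i) *: b i = - \sum_i a (inr i) *: relator c i.
        by apply/eqP; rewrite -addr_eq0; apply/eqP.
      by apply: subspaceN (lie_ideal_subspace (relator c) 2) (Jrel _).
    case=> // i; apply: (hc (fun i => a (inr i))); move: e.
    by rewrite [X in X + _]big1 ?add0r // => j _; rewrite a0 scale0r.
  have [|a aE] := @quad_elt_spans (v x); last by exists a; rewrite aE subrr.
  by case: x => [i|i]; [apply: Fb | apply: relator_free_lie].
apply: (@indep_mod_fin_le _ _ _ _ _ (@quad_elt K n) v s0) => [a|t]; first exact: quad_elt_indep.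
have [a Ja] := bS _ (quad_elt_free K t); have [a' e] := lie_ideal2 Ja erefl.
exists (fun x => match x with inl i => a i | inr i => a' i end).
by rewrite big_sumType /= -e; apply/eqP; rewrite subr_eq0 addrC subrK.
Qed.
End LowDimensions.

Section CubicBound.
Variables (K : fieldType) (n r : nat) (c : coef_idx n r -> K).
Local Notation J := (lie_ideal (relator c)).

Lemma quot_dim_component_eq0 d : component_eq0 c d <-> quot_dim (@free_lie K n d) (J d) 0.
Proof.
split=> [J0|[b [_ bS _]] u /bS[a]]; last by rewrite big_ord0 subr0.
exists (fun _ => 0); split=> [[]//|u Fu|a _ []//].
by exists (fun _ => 0); rewrite big_ord0 subr0; apply: J0.
Qed.

Theorem cubic_vanish_bound : lin_indep (relator c) -> component_eq0 c 3 -> (n ^ 2 <= 3 * r + 1)%N.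
Proof.
move=> hc /quot_dim_component_eq0 d3; have free_f := @relator_free_lie K n r c.
have [m d2] := quot_dim2_exists c; have mr := quot_dim2 hc d2; have d1 := quot_dim1 c.
have [|C CP CN] := @graded_basis_exists _ _ _ (relator c) 3
    (fun d => match d with 1 => n | 2 => m | _ => 0%N end).
  by case=> [|[|[|[|]]]].
have Gl := is_log_exp_inv (monomials_exp CP CN).
have GE := monomials_exp CP CN.
set G := gen_poly _ in Gl GE; case: Gl => _ Gl.
have G0 : G`_0 = 1.
  by have := GE 0%N isT; rewrite coefM big_ord1 subn0 even_series0 odd_series0 mulr1.
set l := (X in theta X) in Gl.
have lE : [/\ (theta l)`_0 = 0, (theta l)`_1 = n%:R, (theta l)`_2 = 2 * m%:R - n%:R & (theta l)`_3 = n%:R].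
  have lE d : (d <= 3)%N -> (theta l)`_d = \sum_(i < 3) (theta (log_factor 3 i.+1))`_d *+
      (match i.+1 with 1 => n | 2 => m | _ => 0%N end).
    move=> d3'; rewrite coef_theta /l coef_sum mulr_sumr; apply: eq_bigr => i _.
    by rewrite coefMn mulrnAr coef_theta.
  by rewrite !lE //; split; rewrite !big_ord_recl big_ord0 !coef_theta_log_factor //=
    /bump ?leq0n ?add1n; ring.
have [l0 l1 l2 l3] := lE.
have := Gl 1%N isT; have := Gl 2%N isT; have := Gl 3%N isT.
rewrite !coef_theta !coefM !big_ord_recl !big_ord0 /= /bump ?leq0n ?add1n ?(subn0, subSS, subnn).
rewrite G0 l0 l1 l2 l3 => g3 g2 g1.
have [a0 a0P] := assoc_dim_exists (relator c) 0.
have [a1 a1P] := assoc_dim_exists (relator c) 1.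
have [a2 a2P] := assoc_dim_exists (relator c) 2.
have [a3 a3P] := assoc_dim_exists (relator c) 3.
have A1 := golod_shafarevich1 a1P.
have A2 := golod_shafarevich free_f a0P a1P a2P.
have A3 := golod_shafarevich free_f a1P a2P a3P.
have B1 := assoc_dim_le free_f (ltn0Sn 2) CP (isT : (1 <= 3)%N) a1P.
have B3 := assoc_dim_le free_f (ltn0Sn 2) CP (isT : (3 <= 3)%N) a3P.
rewrite (assoc_dim0 a0P) muln1 in A2.
have [->//|n0] := posnP n.
have mE : 2 * (m%:R + r%:R) = n%:R * n%:R + n%:R :> rat.
  have : ((m + r) * 2 = n.+1 * n)%N by rewrite mr -[2%N]/(2`!)%N bin_ffact !ffactnS ffactn0 muln1.
  by move/(congr1 (fun k => k%:R : rat)); rewrite !natrM natrD -addn1 natrD => e; lra.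
have a1n : a1 = n.
  apply/eqP; rewrite eqn_leq A1 andbT -(ler_nat rat) -[n%:R]mul1r -[1 * n%:R]addr0.
  have : a1%:R <= G`_1 by rewrite coef_gen_poly ler_nat.
  by move: g1; rewrite mulr0; lra.
subst a1; have {}B3 : a3%:R <= G`_3 by rewrite coef_gen_poly ler_nat.
move: A2 A3; rewrite -!(ler_nat rat) !natrD !natrM => A2 A3.
have n0' : 0 < n%:R :> rat by rewrite ltr0n.
rewrite -(ler_pM2l n0').
have G1 : G`_1 = n%:R by move: g1; rewrite mulr0; lra.
rewrite G1 in g2 g3.
have G2 : G`_2 = n%:R * n%:R - r%:R by move: g2; rewrite mulr0; lra.
rewrite G2 in g3; rewrite mulr0 in g3.
(* The logarithmic derivative gives 3 G_3 = 2 n^3 - 3 n r + n, while a_3 >= n a_2 - r n >= n^3 - 2 n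
   r; together with a_3 <= G_3 this is n^3 - n <= 3 n r. *)
have h2 : n%:R * (n%:R * n%:R - r%:R) <= n%:R * a2%:R :> rat by rewrite ler_pM2l //; lra.
have h3 : n%:R * (2 * m%:R - n%:R) = n%:R * (n%:R * n%:R - 2 * r%:R) :> rat by congr (_ * _); lra.
rewrite h3 in g3.
lra.
Qed.
End CubicBound.

(** * The theorem *)

Section GenericDims.
Variables (k0 : fieldType) (n r : nat).
Local Notation K := {fraction mpoly #|coef_idx n r| k0}.
Local Notation J := (lie_ideal (relator (@generic_coef k0 n r))).
Local Notation V := (series_inv (quadratic_series n r)).

(** The bipartite quotient bounds the generic dimensions from above, [graded_dims_ge] turns this
    into an equality, and the counts of the spanning list are the coefficients of the logarithm. *)
Lemma generic_log_dims (N : nat -> nat) : (0 < n)%N -> (4 * r <= n ^ 2)%N ->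
  (forall d, (0 < d)%N -> quot_dim (@free_lie K n d) (J d) (N d)) ->
  forall d, (0 < d)%N -> series_Log V d = (N d)%:R /\
    ((3 * r + 1 < n ^ 2)%N -> (0 < N d)%N).
Proof.
case: n N => // n' N _ nr NP D D0.
(* The balanced split makes p q = floor (n^2 / 4), the largest number of brackets [x_a, y_b]. *)
pose p := n'.+1./2; pose q := (n'.+1 - p)%N.
have pE : n'.+1 = (odd n'.+1 + 2 * p)%N by rewrite mul2n odd_double_half.
have pq : (p + q = n'.+1)%N by rewrite /q; lia.
have o1 : (odd n'.+1 <= 1)%N by case: odd.
have qE : q = (odd n'.+1 + p)%N by rewrite /q; lia.
have q0 : (0 < q)%N by move: pE; rewrite qE; lia.
have rpq : (r <= p * q)%N.
  move: nr pE; rewrite qE; move: (odd n'.+1) => [] nr pE; move: nr; rewrite pE /=; clear; nia.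
have [B [BS Be Bpos]] := @bipartite_upper_bound k0 n' p q r pq q0 rpq D D0.
have NB : forall d, (0 < d <= D)%N -> (N d <= deg_count d B)%N.
  move=> d /andP[d0 dD].
  apply: (quot_dim_le (lie_ideal_subspace _ d) (NP d d0)).
  apply: (@generic_spanned k0 n'.+1 r (@bipartite_coef k0 n' p q r)).
  by apply: in_span_spanned => u Fu; apply: BS.
have NE := graded_dims_ge (@relator_free_lie _ _ _ _) nr Be (fun d dD => NP d (proj1 (andP dD))) NB.
rewrite (series_Log_quadratic Be) ?D0 ?leqnn // NE ?D0 ?leqnn //; split=> // nr3.
apply: Bpos; last by rewrite D0 leqnn.
(* If q = 1 then n <= 2, and 3 r + 1 < n^2 leaves only n = 2, r = 0, where r < p q. *)
have [q1|q1] := ltnP 1 q; [by left | right].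
move: nr3; rewrite pE; move: qE q0 q1; case: (odd n'.+1) => /= qE q0 q1; nia.
Qed.
End GenericDims.

Lemma has_hilbert_series_dims (K : fieldType) (n r : nat) (c : coef_idx n r -> K) (S : series) :
  has_hilbert_series c S -> exists N : nat -> nat, forall d, (0 < d)%N ->
    quot_dim (@free_lie K n d) (lie_ideal (relator c) d) (N d) /\ S d = (N d)%:R.
Proof.
case=> _ Sd; exists (fun d => Num.truncn (S d)) => d /Sd[m mP ->].
by rewrite natrK.
Qed.

Lemma hilbert_series_vanish (K : fieldType) (n r : nat) (c : coef_idx n r -> K) :
  lin_indep (relator c) -> (0 < n)%N -> (n ^ 2 <= 3 * r + 1)%N -> component_eq0 c 3 ->
  has_hilbert_series c (truncate_pos (series_Log (series_inv (quadratic_series n r)))).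
Proof.
move=> hc n0 nr c3; split=> // d d0; rewrite /truncate_pos d0 /=.
have n0' : 0 < n%:R :> rat by rewrite ltr0n.
case: d d0 => [//|[|[|d]]] _.
- exists n; first exact: quot_dim1.
  by rewrite /= series_Log_1 n0'.
- have [m mP] := quot_dim2_exists c; exists m => //.
  have mE : (n%:R ^+ 2 + n%:R) / 2 - r%:R = m%:R :> rat.
    have : ((m + r) * 2 = n * n + n)%N.
      by rewrite (quot_dim2 hc mP) -[2%N]/(2`!)%N bin_ffact !ffactnS ffactn0 muln1 mulSn addnC.
    move/(congr1 (fun k => k%:R : rat)); rewrite natrM (natrD _ m) (natrD _ (n * n)) natrM => e.
    rewrite -[n%:R ^+ 2]/(n%:R * n%:R); lra.
  rewrite /= series_Log_1 n0' series_Log_2 mE /= andbT.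
  by case: m {mP mE} => [|m]; rewrite ?ltxx // ltr0n.
exists 0%N; first by apply/quot_dim_component_eq0/cubic_vanish_above.
(* The logarithm has a nonpositive coefficient in degree 3, so the truncation vanishes from there
   on. *)
case: ifP => // /and4P[_ _ + _]; rewrite series_Log_3.
have : n%:R ^+ 2 <= 3 * r%:R + 1 :> rat.
  by rewrite -natrX -natrM -[1]/(1%:R) -natrD ler_nat.
rewrite -(ler_pM2l n0') exprS => h1 h2; lra.
Qed.

Theorem theorem3p9 (k0 k : fieldType) (iota : {rmorphism k0 -> k}) (n r : nat)
    (hk0 : prime_field k0) (htr : trdeg_ge iota #|coef_idx n r|)
    (hn : (1 <= n)%N) (hr : (r <= 'C(n.+1, 2))%N)
    (c : coef_idx n r -> k) (hc : lin_indep (relator c))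
    (hgen : generic k0 c) :
  ((r%:R <= n%:R ^+ 2 / 4 :> rat) \/ (n%:R ^+ 2 - 1) / 3 <= r%:R :> rat ->
     has_hilbert_series c
       (truncate_pos (series_Log (series_inv (quadratic_series n r)))))
  /\ (component_eq0 c 3 <-> (n%:R ^+ 2 - 1) / 3 <= r%:R :> rat).
Proof.
have [S [Sc Sg]] := hgen.
have [N NP] := has_hilbert_series_dims Sc; have [N' N'P] := has_hilbert_series_dims Sg.
(* Both algebras have the series [S], so their dimensions agree degree by degree. *)
have NN d : (0 < d)%N -> N d = N' d.
  move=> d0; have [_ Nd] := NP d d0; have [_ N'd] := N'P d d0.
  by apply/eqP; rewrite -(eqr_nat rat) -Nd N'd.
have thirdE : ((n%:R ^+ 2 - 1) / 3 <= r%:R :> rat) = (n ^ 2 <= 3 * r + 1)%N.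
  by rewrite ler_pdivrMr // lerBlDr -(ler_nat rat) natrX natrD natrM mulrC.
have quarterE : (r%:R <= n%:R ^+ 2 / 4 :> rat) = (4 * r <= n ^ 2)%N.
  by rewrite ler_pdivlMr // -(ler_nat rat) natrX natrM mulrC.
have c3 : (n ^ 2 <= 3 * r + 1)%N -> component_eq0 c 3.
  move=> nr; have /quot_dim_component_eq0 g3 := @generic_cubic_vanish k0 n r hn nr.
  apply/quot_dim_component_eq0; have [cN _] := NP 3 isT; have [gN _] := N'P 3 isT.
  exact: (eq_ind _ _ cN _ (etrans (NN 3 isT) (quot_dim_unique (lie_ideal_subspace _ 3) gN g3))).
rewrite thirdE quarterE; split; last by split=> [/(cubic_vanish_bound hc)|/c3].
(* Where the two ranges overlap the vanishing case is taken; otherwise 3 r + 1 < n^2, all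
   coefficients of the logarithm are positive, and nothing is truncated. *)
have [nr _|nr] := leqP (n ^ 2) (3 * r + 1); first by apply: hilbert_series_vanish (c3 nr).
case=> // nr4; split=> // d d0.
have log_dims := generic_log_dims hn nr4 (fun d d0 => proj1 (N'P d d0)).
have [cN _] := NP d d0; exists (N d) => //.
rewrite /truncate_pos d0 /=; have -> : all (fun j => 0 < series_Log (series_inv (quadratic_series n r)) j) (seq.iota 1 d).
  apply/allP => j; rewrite mem_iota => /andP[j0 _].
  by have [-> Npos] := log_dims j j0; rewrite ltr0n Npos.
by have [-> _] := log_dims d d0; rewrite NN.
Qed.
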